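(* Let $B>0$ and let $\phi\in L^1(\mathbb R)$ satisfy $\operatorname{supp}\phi\subset[-B,B]$, $\overline{\phi(-x)}=\phi(x)$, and $\phi(x)\ne 0$ for a.e. $x\in[-B,B]$. Let $\psi(x)=\phi(x)(e^{2\pi i xb}-1)$, where $0<b\le 1/(2B)$. Suppose that $\{\omega_n\}_{n\ge1}=\{k/(4B)\}_{k\in\mathbb Z}$, or that $\{\omega_n\}_{n\ge1}$ is a sequence of positive numbers satisfying $\limsup_{n\to\infty} n/\omega_n>4B$. Let $0<T<2B$. Suppose that $f\in\tilde L(T)$ and that $t_0,t_1$ are real numbers such that both $f\phi(\cdot-t_0)$ and $f\phi(\cdot-t_1)$ are integrable. If $(t_1-t_0)/T$ is an irrational number and $f$ is $(2B-T)$-nonseparable when $B<T<2B$, then $f$ is determined up to a global phase by the measurements $$\{|\mathcal V_\phi f(t_j,\omega_n)|,\ |\mathcal V_\psi f(t_j,\omega_n)| : n\ge1,\ j=0,1\}.$$ Moreover, the conclusion fails if $(t_1-t_0)/T$ is a rational number or $f$ is $(2B-T+\varepsilon)$-separable when $B<T<2B$, where $\varepsilon>0$.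
   Context: Signals are complex-valued locally integrable functions on $\mathbb R$. $\mathbb T=\{z\in\mathbb C:|z|=1\}$. For $T>0$ and $\mu\in\mathbb T$, $\tilde L_\mu(T)$ denotes the space of all (locally integrable) functions $f$ with $f(x)=\mu f(x+T)$ for a.e. $x\in\mathbb R$, and $\tilde L(T)=\bigcup_{\mu\in\mathbb T}\tilde L_\mu(T)$ is the set of quasi-periodic functions with period $T$. The short-time Fourier transform is $\mathcal V_\phi f(t,\omega)=\int_{\mathbb R} f(x)\overline{\phi(x-t)}e^{-2\pi i x\omega}\,dx$, defined when $f\phi(\cdot-t)$ is integrable. A function $f$ is called $L$-separable if there exists an interval of length $L$ on which $f$ vanishes, and $L$-nonseparable if there is no such interval. That $f$ is determined up to a global phase by the measurements means that every $g\in\tilde L(T)$ whose measurements are defined and equal to those of $f$ satisfies $f=\lambda g$ a.e. for some constant $\lambda\in\mathbb T$.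
   Formalization: In the second case the positive frequencies are assumed listed in strictly increasing order; without this the claim is false, since a constant sequence has limsup n/ω_n = ∞ but gives only finitely many measurements. *)

(* Defs.v *)
From mathcomp Require Export all_boot all_order all_algebra.
From mathcomp Require Export all_classical all_reals all_analysis.
From mathcomp Require Export complex.

Set Implicit Arguments.
Unset Strict Implicit.
Unset Printing Implicit Defensive.

Import Order.TTheory GRing.Theory Num.Theory.
Import numFieldNormedType.Exports.

Local Open Scope classical_set_scope.
Local Open Scope ring_scope.
Local Open Scope complex_scope.

Local Notation leb := (@lebesgue_measure _) (only parsing).

(* MathComp-Analysis only integrates extended-real-valued functions, so the
   Lebesgue theory of functions R -> R[i] is defined on real and imaginary
   parts. Equations between functions are meant almost everywhere. *)

Definition cintegrable (R : realType) (f : R -> R[i]) : Prop :=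
  leb.-integrable [set: R] (fun x : R => (complex.Re (f x))%:E) /\
  leb.-integrable [set: R] (fun x : R => (complex.Im (f x))%:E).

Definition cintegral (R : realType) (f : R -> R[i]) : R[i] :=
  Rintegral leb [set: R] (fun x : R => complex.Re (f x)) +i*
  Rintegral leb [set: R] (fun x : R => complex.Im (f x)).

Definition clocally_integrable (R : realType) (f : R -> R[i]) : Prop :=
  locally_integrable [set: R] (fun x => complex.Re (f x)) /\
  locally_integrable [set: R] (fun x => complex.Im (f x)).

(* exp (2 pi i x) *)
Definition cis2pi (R : realType) (x : R) : R[i] :=
  cos (2 * pi * x) +i* sin (2 * pi * x).

(* The union over unimodular m of the spaces of locally integrable f with
   f x = m * f (x + T) almost everywhere *)
Definition quasi_periodic (R : realType) (T : R) (f : R -> R[i]) : Prop :=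
  clocally_integrable f /\
  exists2 m : R[i], `|m| = 1 & {ae leb, forall x : R, f x = m * f (x + T)}.

Definition stft_defined (R : realType) (phi f : R -> R[i]) (t : R) : Prop :=
  cintegrable (fun x => f x * phi (x - t)).

Definition stft (R : realType) (phi f : R -> R[i]) (t w : R) : R[i] :=
  cintegral (fun x => f x * conjc (phi (x - t)) * cis2pi (- (x * w))).

Definition separable_by (R : realType) (L : R) (f : R -> R[i]) : Prop :=
  exists a : R, {ae leb, forall x : R, x \in `[a, a + L] -> f x = 0}.

Definition nonseparable_by (R : realType) (L : R) (f : R -> R[i]) : Prop :=
  ~ separable_by L f.

Definition modulated_window (R : realType) (phi : R -> R[i]) (b : R) :
    R -> R[i] :=
  fun x => phi x * (cis2pi (x * b) - 1).

Definition admissible_window (R : realType) (B : R) (phi : R -> R[i]) : Prop :=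
  [/\ cintegrable phi,
      {ae leb, forall x : R, x \notin `[- B, B] -> phi x = 0},
      {ae leb, forall x : R, conjc (phi (- x)) = phi x} &
      {ae leb, forall x : R, x \in `[- B, B] -> phi x != 0}].

(* Frequencies are indexed by n >= 1; omega 0 is never used (the term n = 0
   does not affect the limsup, whose value may be +oo). In the second case the
   frequencies are listed in increasing order: only then does n / omega_n
   measure the density of the set of frequencies (a constant sequence would
   also make the limsup infinite). *)
Definition admissible_frequencies (R : realType) (B : R) (omega : nat -> R) :
    Prop :=
  omega @` [set n | (0 < n)%N] = range (fun k : int => k%:~R / (4 * B)) \/
  [/\ forall n, (0 < n)%N -> 0 < omega n,
      forall m n, (0 < m)%N -> (m < n)%N -> omega m < omega n &
      ((4 * B)%:E < limn_esup (fun n => (n%:R / omega n)%:E))%E].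

Definition same_measurements (R : realType) (phi psi : R -> R[i])
    (omega : nat -> R) (t : R) (f g : R -> R[i]) : Prop :=
  forall n, (0 < n)%N ->
    `|stft phi g t (omega n)| = `|stft phi f t (omega n)| /\
    `|stft psi g t (omega n)| = `|stft psi f t (omega n)|.

Definition determined_up_to_phase (R : realType) (phi psi : R -> R[i])
    (omega : nat -> R) (T t0 t1 : R) (f : R -> R[i]) : Prop :=
  forall g : R -> R[i], quasi_periodic T g ->
    stft_defined phi g t0 -> stft_defined psi g t0 ->
    stft_defined phi g t1 -> stft_defined psi g t1 ->
    same_measurements phi psi omega t0 f g ->
    same_measurements phi psi omega t1 f g ->
  exists2 lam : R[i], `|lam| = 1 & {ae leb, forall x : R, f x = lam * g x}.

(* Main.v *)
(* For a window centred at t, the measurements are moduli of the Fourier transform P of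
   F = f conj(phi(. - t)), supported in [t - B, t + B], and of P(. + b) - P. Sampling at
   the given frequencies determines |P|^2 on the whole line: it extends to an entire
   function of exponential type, so for frequencies of density > 4B this is a uniqueness
   theorem of Levinson type, and for the lattice k/(4B) it holds because exp(i nu theta)
   is a bounded limit of trigonometric polynomials on ]-pi, pi[. Then |P| and
   |P(. + b) - P| determine P(. + b) conj(P) up to conjugation, and the identity theorem
   makes the choice global: a second signal with transform Q has either Q = lam P or
   Q = lam conj(P) along all translates w + b Z, hence, as 1/b >= 2B, it is lam F or
   the reflection lam conj(F(2t - .)).

   Dividing by phi gives g = lam f or g = lam conj(f(2t - .)) on the window, which is
   longer than a period, and nonseparability extends this to the line. If the reflected
   case occurs at both t0 and t1, then f(y) = c f(y + 2(t1 - t0)), and irrationality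
   forces f to be a multiple of one exponential, for which reflection is a phase. *)

Require Import Defs.
From mathcomp Require Import ring lra zify measurable_realfun.
From mathcomp Require finmap.

Set Implicit Arguments.
Unset Strict Implicit.
Unset Printing Implicit Defensive.

Import Order.TTheory GRing.Theory Num.Theory.
Import numFieldNormedType.Exports.

Local Open Scope classical_set_scope.
Local Open Scope ring_scope.
Local Open Scope complex_scope.

(** For frequencies given by a limsup, zeros are counted on the positive axis and only at
    arbitrarily large radii. Suppose the squared modulus grows at most like exp(2 a |Im z|) and the
    zeros have density D. Multiplication by exp(i a z) gives boundedness in the upper half-plane.
    Through their Blaschke factors, at a height that is a small fraction of r, the zeros in [0, r]
    contribute a Poisson sum close to pi D to the exponent, while lowering the boundary below the
    real axis costs a; pi D > a leaves a net decay. It is known only near a point tied to the scale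
    r, but a power of one Blaschke factor centred there carries a decay rate to every fixed point,
    and this rate can be chosen from a and D alone. With the decay divided out, the function
    satisfies the same hypotheses, so the step repeats forever and the function vanishes. With a = 4
    pi B the condition reads D > 4 B. The identity theorem follows from the same Blaschke estimate,
    with arbitrarily many zeros in [0, 1]. Choosing between a product and its conjugate means
    choosing between two entire functions of which one vanishes at each real point. *)

Local Notation Re := complex.Re.
Local Notation Im := complex.Im.

(** * The complex exponential *)

Section ComplexNorms.
Variable R : realType.
Implicit Types (z w : R[i]) (a b x : R).

Lemma le_of_eq (x y : R) : x = y -> x <= y. Proof. by move=> ->. Qed.

Lemma cReD z w : Re (z + w) = Re z + Re w. Proof. by case: z w => [a b] [c d]. Qed.
Lemma cImD z w : Im (z + w) = Im z + Im w. Proof. by case: z w => [a b] [c d]. Qed.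
Lemma cReN z : Re (- z) = - Re z. Proof. by case: z. Qed.
Lemma cImN z : Im (- z) = - Im z. Proof. by case: z. Qed.
Lemma cReB z w : Re (z - w) = Re z - Re w. Proof. by rewrite cReD cReN. Qed.
Lemma cImB z w : Im (z - w) = Im z - Im w. Proof. by rewrite cImD cImN. Qed.
Lemma cReM z w : Re (z * w) = Re z * Re w - Im z * Im w.
Proof. by case: z w => [a b] [c d]. Qed.
Lemma cImM z w : Im (z * w) = Re z * Im w + Im z * Re w.
Proof. by case: z w => [a b] [c d]. Qed.
Lemma cReJ z : Re (conjc z) = Re z. Proof. by case: z. Qed.
Lemma cImJ z : Im (conjc z) = - Im z. Proof. by case: z. Qed.
Lemma cRe0 : Re (0 : R[i]) = 0. Proof. by []. Qed.
Lemma cIm0 : Im (0 : R[i]) = 0. Proof. by []. Qed.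
Lemma cRe1 : Re (1 : R[i]) = 1. Proof. by []. Qed.
Lemma cIm1 : Im (1 : R[i]) = 0. Proof. by []. Qed.
Definition ReImE := (cReD, cImD, cReN, cImN, cReM, cImM, cReJ, cImJ, cRe0, cIm0, cRe1, cIm1).

Lemma complex_ext z w : Re z = Re w -> Im z = Im w -> z = w.
Proof. by case: z w => [a b] [c d] /= -> ->. Qed.

(* The norm [`|z|] of R[i] takes its values in R[i]; [n1] is an equivalent
   submultiplicative norm with values in R, and [nsq] is the squared modulus. *)
Definition n1 z : R := `|Re z| + `|Im z|.
Definition nsq z : R := Re z ^+ 2 + Im z ^+ 2.

Lemma n1_ge0 z : 0 <= n1 z. Proof. by rewrite addr_ge0. Qed.
Lemma n10 : n1 0 = 0. Proof. by rewrite /n1 /= normr0 addr0. Qed.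
Lemma n1_1 : n1 1 = 1. Proof. by rewrite /n1 /= normr0 normr1 addr0. Qed.
Lemma n1N z : n1 (- z) = n1 z. Proof. by rewrite /n1 !ReImE !normrN. Qed.
Lemma n1J z : n1 (conjc z) = n1 z. Proof. by rewrite /n1 !ReImE normrN. Qed.
Lemma n1D z w : n1 (z + w) <= n1 z + n1 w.
Proof. by rewrite /n1 !ReImE addrACA lerD // ler_normD. Qed.
Lemma n1B z w : n1 (z - w) <= n1 z + n1 w.
Proof. by rewrite -(n1N w) n1D. Qed.
Lemma n1M z w : n1 (z * w) <= n1 z * n1 w.
Proof.
rewrite /n1 !ReImE.
apply: (@le_trans _ _ ((`|Re z * Re w| + `|Im z * Im w|) +
  (`|Re z * Im w| + `|Im z * Re w|))).
  by rewrite lerD ?ler_normD // ler_normB.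
by rewrite !normrM; apply: le_of_eq; ring.
Qed.
Lemma n1_sum (I : Type) (r : seq I) (P : pred I) (F : I -> R[i]) :
  n1 (\sum_(i <- r | P i) F i) <= \sum_(i <- r | P i) n1 (F i).
Proof.
elim/big_ind2: _ => //; first by rewrite n10.
by move=> *; apply: (le_trans (n1D _ _)); rewrite lerD.
Qed.
Lemma n1X z k : n1 (z ^+ k) <= n1 z ^+ k.
Proof.
elim: k => [|k IH]; first by rewrite !expr0 n1_1.
rewrite !exprS; apply: (le_trans (n1M _ _)).
by rewrite ler_wpM2l ?n1_ge0.
Qed.
Lemma n1C x : n1 x%:C = `|x|. Proof. by rewrite /n1 /= normr0 addr0. Qed.
Lemma n1Cl x z : n1 (x%:C * z) = `|x| * n1 z.
Proof. by rewrite /n1 !ReImE /= !mul0r subr0 addr0 !normrM mulrDr. Qed.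
Lemma Re_le_n1 z : `|Re z| <= n1 z. Proof. by rewrite /n1 lerDl. Qed.
Lemma Im_le_n1 z : `|Im z| <= n1 z. Proof. by rewrite /n1 lerDr. Qed.
Lemma n1_eq0 z : (n1 z == 0) = (z == 0).
Proof.
by rewrite /n1 paddr_eq0 // !normr_eq0 eq_complex.
Qed.

Lemma nsq_ge0 z : 0 <= nsq z. Proof. by rewrite addr_ge0 ?sqr_ge0. Qed.
Lemma nsq0 : nsq 0 = 0. Proof. by rewrite /nsq /= expr0n addr0. Qed.
Lemma nsq1 : nsq 1 = 1. Proof. by rewrite /nsq /= expr1n expr0n addr0. Qed.
Lemma nsqM z w : nsq (z * w) = nsq z * nsq w.
Proof. by rewrite /nsq !ReImE; ring. Qed.
Lemma nsqN z : nsq (- z) = nsq z. Proof. by rewrite /nsq !ReImE !sqrrN. Qed.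
Lemma nsqJ z : nsq (conjc z) = nsq z. Proof. by rewrite /nsq !ReImE sqrrN. Qed.
Lemma nsqX z k : nsq (z ^+ k) = nsq z ^+ k.
Proof. by elim: k => [|k IH]; rewrite ?expr0 ?nsq1 // !exprS nsqM IH. Qed.
Lemma nsq_eq0 z : (nsq z == 0) = (z == 0).
Proof. by rewrite /nsq paddr_eq0 ?sqr_ge0 // !sqrf_eq0 eq_complex. Qed.
Lemma nsq_gt0 z : z != 0 -> 0 < nsq z.
Proof. by move=> z0; rewrite lt_neqAle nsq_ge0 andbT eq_sym nsq_eq0. Qed.
Lemma nsqV z : nsq z^-1 = (nsq z)^-1.
Proof.
have [->|z0] := eqVneq z 0; first by rewrite invr0 nsq0 invr0.
apply: (@mulfI _ (nsq z)); first by rewrite nsq_eq0.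
by rewrite -nsqM !divff ?nsq_eq0 // nsq1.
Qed.
Lemma nsq_le z : nsq z <= n1 z ^+ 2.
Proof.
rewrite /nsq /n1 -(real_normK (num_real (Re z))) -(real_normK (num_real (Im z))).
have : 0 <= `|Re z| * `|Im z| by rewrite mulr_ge0.
by rewrite sqrrD; lra.
Qed.
Lemma n1_sq_le z : n1 z ^+ 2 <= 2 * nsq z.
Proof.
rewrite /nsq /n1 -(real_normK (num_real (Re z))) -(real_normK (num_real (Im z))).
have := sqr_ge0 (`|Re z| - `|Im z|); lra.
Qed.
Lemma nsqJE z : z * conjc z = (nsq z)%:C.
Proof. by case: z => a b; apply: complex_ext; rewrite /nsq /=; ring. Qed.

Lemma normc_nsq z : `|z| = (Num.sqrt (nsq z))%:C.
Proof. by rewrite normc_def. Qed.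
Lemma norm_eq_nsq z w : `|z| = `|w| <-> nsq z = nsq w.
Proof.
rewrite !normc_nsq; split=> [|->//].
by move=> /complexI /eqP; rewrite eqr_sqrt ?nsq_ge0 // => /eqP.
Qed.
Lemma norm_eq1_nsq z : `|z| = 1 <-> nsq z = 1.
Proof. by rewrite -[X in _ = X](normr1 (R[i])) norm_eq_nsq nsq1. Qed.

Definition cexp z : R[i] := (expR (Re z) * cos (Im z)) +i* (expR (Re z) * sin (Im z)).

Lemma cexpD z w : cexp (z + w) = cexp z * cexp w.
Proof.
by apply: complex_ext; rewrite /cexp /= !ReImE expRD ?cosD ?sinD /=; ring.
Qed.
Lemma cexp0 : cexp 0 = 1.
Proof. by rewrite /cexp /= expR0 cos0 sin0 mulr1 mulr0. Qed.
Lemma nsq_cexp z : nsq (cexp z) = expR (2 * Re z).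
Proof.
rewrite /nsq /= !exprMn -mulrDr cos2Dsin2 mulr1 expRM_natl //.
Qed.
Lemma n1_cexp z : n1 (cexp z) <= 2 * expR (Re z).
Proof.
rewrite /n1 /= !normrM (ger0_norm (expR_ge0 _)) -mulrDr mulrC ler_wpM2r ?expR_ge0 //.
have := cos_geN1 (Im z); have := cos_le1 (Im z).
have := sin_geN1 (Im z); have := sin_le1 (Im z) => *.
have : `|cos (Im z)| <= 1 by rewrite ler_norml; apply/andP.
have : `|sin (Im z)| <= 1 by rewrite ler_norml; apply/andP.
lra.
Qed.
Lemma cexpJ z : conjc (cexp z) = cexp (conjc z).
Proof. by apply: complex_ext; rewrite !ReImE /= !ReImE ?cosN ?sinN //; ring. Qed.
Lemma cexp_neq0 z : cexp z != 0.
Proof. by rewrite -nsq_eq0 nsq_cexp gt_eqF // expR_gt0. Qed.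
Lemma cis2piE x : cis2pi x = cexp (0 +i* (2 * pi * x)).
Proof. by rewrite /cexp /= expR0 !mul1r. Qed.
Lemma cexpMn z k : cexp (z *+ k) = cexp z ^+ k.
Proof.
by elim: k => [|k IH]; rewrite ?mulr0n ?expr0 ?cexp0 // mulrS exprS cexpD IH.
Qed.
Lemma conjcM z w : conjc (z * w) = conjc z * conjc w.
Proof. by apply: complex_ext; rewrite !ReImE; ring. Qed.
Lemma conjcD z w : conjc (z + w) = conjc z + conjc w.
Proof. by apply: complex_ext; rewrite !ReImE; ring. Qed.
Lemma conjcN z : conjc (- z) = - conjc z.
Proof. by apply: complex_ext; rewrite !ReImE. Qed.

End ComplexNorms.

Section ComplexExpTaylor.
Variable R : realType.
Implicit Types (z w : R[i]) (a b x s : R).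

Lemma is_derive_Re_cexp w s :
  is_derive s 1 (fun s => Re (cexp (s%:C * w))) (Re (w * cexp (s%:C * w))).
Proof.
case: w => a b /=.
rewrite (_ : (fun s => _) = (fun s => expR (s * a) * cos (s * b))); last first.
  by apply/funext => t; rewrite !mul0r subr0 addr0.
apply: is_derive_eq; rewrite /GRing.scale /= !mul0r subr0 addr0; ring.
Qed.

Lemma is_derive_Im_cexp w s :
  is_derive s 1 (fun s => Im (cexp (s%:C * w))) (Im (w * cexp (s%:C * w))).
Proof.
case: w => a b /=.
rewrite (_ : (fun s => _) = (fun s => expR (s * a) * sin (s * b))); last first.
  by apply/funext => t; rewrite !mul0r subr0 addr0.
apply: is_derive_eq; rewrite /GRing.scale /= !mul0r subr0 addr0; ring.
Qed.

Lemma is_derive_tsum (c : nat -> R) m s :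
  is_derive s 1 (fun s => \sum_(k < m.+1) s ^+ k * (c k / k`!%:R))
    (\sum_(k < m) s ^+ k * (c k.+1 / k`!%:R)).
Proof.
rewrite (_ : (fun s => _) = \sum_(k < m.+1) (fun s => s ^+ k * (c k / k`!%:R))); last first.
  by apply/funext => t; rewrite fct_sumE.
have H (k : 'I_m.+1) : is_derive s 1 (fun s => s ^+ k * (c k / k`!%:R))
    (k%:R * s ^+ k.-1 * (c k / k`!%:R)).
  rewrite (_ : (fun s => _) = (id ^+ k) * cst (c k / k`!%:R)); last first.
    by apply/funext => t; rewrite /GRing.mul /= exprfctE.
  apply: is_derive_eq (is_deriveM (is_deriveX k (is_derive_id s 1)) (is_derive_cst (c k / k`!%:R) s 1)) _.
  by rewrite /GRing.scale /= mulr0 add0r mulr1 mulrC.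
apply: is_derive_eq (is_derive_sum H) _.
rewrite big_ord_recl /= !mul0r add0r.
apply: eq_bigr => k _; rewrite /bump /= add1n /=.
rewrite factS natrM.
have k0 : (k`!%:R : R) != 0 by rewrite pnatr_eq0 -lt0n fact_gt0.
have k1 : (k.+1%:R : R) != 0 by rewrite pnatr_eq0.
by field; rewrite k0 nat1r k1.
Qed.

Definition csum m w : R[i] := \sum_(k < m) w ^+ k / k`!%:R.


Lemma natCV n : (n%:R : R[i])^-1 = (n%:R^-1)%:C.
Proof. by rewrite fmorphV rmorph_nat. Qed.

Lemma Re_csum m w s :
  Re (csum m (s%:C * w)) = \sum_(k < m) s ^+ k * (Re (w ^+ k) / k`!%:R).
Proof.
rewrite (big_morph _ (@cReD R) (@cRe0 R)); apply: eq_bigr => k _.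
rewrite exprMn -rmorphXn -mulrA. rewrite cReM /= mul0r subr0; congr (_ * _).
by rewrite natCV cReM /= mulr0 subr0.
Qed.

Lemma Im_csum m w s :
  Im (csum m (s%:C * w)) = \sum_(k < m) s ^+ k * (Im (w ^+ k) / k`!%:R).
Proof.
rewrite (big_morph _ (@cImD R) (@cIm0 R)); apply: eq_bigr => k _.
rewrite exprMn -rmorphXn -mulrA cImM /= mul0r addr0; congr (_ * _).
by rewrite natCV cImM /= mulr0 add0r.
Qed.

Lemma csum0 m : csum m.+1 (0 : R[i]) = 1.
Proof.
rewrite /csum big_ord_recl expr0 fact0 divr1 big1 ?addr0 // => i _.
by rewrite exprS mul0r mul0r.
Qed.

(** By induction on [m]: along the segment [s w] the remainder of order [m + 1] vanishes at 0 and
    has derivative [w] times the remainder of order [m]. The mean value theorem is applied to real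
    and imaginary parts separately, which doubles the bound each time; hence the power of 2. *)
Lemma cexp_taylor m w s : 0 <= s <= 1 ->
  n1 (cexp (s%:C * w) - csum m (s%:C * w)) <= 2 ^+ m.+1 * n1 w ^+ m * expR (n1 w).
Proof.
elim: m s => [|m IH] s s01.
  rewrite /csum big_ord0 subr0 expr1 expr0 mulr1.
  apply: (le_trans (n1_cexp _)); rewrite ler_pM2l // ler_expR.
  apply: (le_trans (ler_norm _)); apply: (le_trans (Re_le_n1 _)).
  by rewrite n1Cl ler_piMl ?n1_ge0 //; case/andP: s01 => s0 s1; rewrite ger0_norm.
set M := 2 ^+ m.+1 * n1 w ^+ m * expR (n1 w) in IH.
have wM t : 0 <= t <= 1 -> n1 (w * (cexp (t%:C * w) - csum m (t%:C * w))) <= n1 w * M.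
  by move=> t01; apply: (le_trans (n1M _ _)); rewrite ler_wpM2l ?n1_ge0 ?IH.
case/andP: s01 => s0 s1.
have key (f df : R -> R) : f 0 = 0 -> (forall t : R, is_derive t (1 : R) f (df t)) ->
    (forall t, 0 <= t <= 1 -> `|df t| <= n1 w * M) -> `|f s| <= n1 w * M.
  move=> f0 fd fb.
  have fc : {within `[0, s], continuous f}.
    by apply: derivable_within_continuous => t _; case: (fd t).
  have [c cs fE] := MVT_segment s0 (fun t _ => fd t) fc.
  rewrite f0 subr0 in fE; rewrite fE subr0 normrM.
  move: cs; rewrite in_itv /= => /andP[c0 cs].
  have ->: n1 w * M = n1 w * M * 1 by rewrite mulr1.
  by rewrite ler_pM // ?fb ?c0 ?(le_trans cs) // ger0_norm.
have KR : `|Re (cexp (s%:C * w) - csum m.+1 (s%:C * w))| <= n1 w * M.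
  apply: (key (fun s => Re (cexp (s%:C * w) - csum m.+1 (s%:C * w)))
    (fun t => Re (w * (cexp (t%:C * w) - csum m (t%:C * w))))).
  - by rewrite mul0r cexp0 csum0 subrr.
  - move=> t.
    rewrite (_ : (fun s => _) = (fun s => Re (cexp (s%:C * w))) -
       (fun s => \sum_(k < m.+1) s ^+ k * (Re (w ^+ k) / k`!%:R))); last first.
      by apply/funext => u; rewrite cReB Re_csum.
    apply: is_derive_eq (is_deriveB (is_derive_Re_cexp _ _) (is_derive_tsum (fun k => Re (w ^+ k)) _ _)) _.
    rewrite mulrBr cReB; congr (_ - _).
    rewrite cReM Re_csum Im_csum !mulr_sumr -sumrB; apply: eq_bigr => k _.
    by rewrite exprS cReM; ring.
  - by move=> t t01; apply: (le_trans (Re_le_n1 _)); exact: wM.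
have KI : `|Im (cexp (s%:C * w) - csum m.+1 (s%:C * w))| <= n1 w * M.
  apply: (key (fun s => Im (cexp (s%:C * w) - csum m.+1 (s%:C * w)))
    (fun t => Im (w * (cexp (t%:C * w) - csum m (t%:C * w))))).
  - by rewrite mul0r cexp0 csum0 subrr.
  - move=> t.
    rewrite (_ : (fun s => _) = (fun s => Im (cexp (s%:C * w))) -
       (fun s => \sum_(k < m.+1) s ^+ k * (Im (w ^+ k) / k`!%:R))); last first.
      by apply/funext => u; rewrite cImB Im_csum.
    apply: is_derive_eq (is_deriveB (is_derive_Im_cexp _ _) (is_derive_tsum (fun k => Im (w ^+ k)) _ _)) _.
    rewrite mulrBr cImB; congr (_ - _).
    rewrite cImM Re_csum Im_csum !mulr_sumr -big_split; apply: eq_bigr => k _ /=.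
    by rewrite exprS cImM; ring.
  - by move=> t t01; apply: (le_trans (Im_le_n1 _)); exact: wM.
apply: (le_trans (lerD KR KI)); apply: le_of_eq; rewrite /M !exprS; ring.
Qed.

Lemma cexp_taylor1 m w :
  n1 (cexp w - csum m w) <= 2 ^+ m.+1 * n1 w ^+ m * expR (n1 w).
Proof. by have := @cexp_taylor m w 1; rewrite !mul1r; apply; rewrite ler01 lexx. Qed.

End ComplexExpTaylor.

(** * Analytic functions and the maximum principle *)

Section Analytic.
Variable R : realType.
Implicit Types (z w h : R[i]) (F G : R[i] -> R[i]) (p q : {poly R[i]}).

(* Approximation to every order by polynomials stands in for holomorphy: it is
   preserved by products and by division by [z - w], and it gives both the
   sub-mean value inequality and the Lipschitz bounds needed below. *)
Definition jet (m : nat) F z (p : {poly R[i]}) (K d : R) : Prop :=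
  [/\ 0 <= K, 0 < d & forall h, n1 h < d -> n1 (F (z + h) - p.[h]) <= K * n1 h ^+ m].

Definition analytic_at F z : Prop := forall m, exists p K d, jet m F z p K d.

Lemma jet_shrink m F z p K d d' : 0 < d' -> jet m F z p K d ->
  jet m F z p K (Num.min d d').
Proof.
move=> d'0 [K0 d0 H]; split=> //; first by rewrite lt_min d0.
by move=> h; rewrite lt_min => /andP[hd _]; exact: H.
Qed.

Lemma poly_bound p : exists2 K, 0 <= K & forall h, n1 h <= 1 -> n1 p.[h] <= K.
Proof.
exists (\sum_(i < size p) n1 p`_i); first by rewrite sumr_ge0 // => i _; exact: n1_ge0.
move=> h h1; rewrite horner_coef; apply: (le_trans (n1_sum _ _ _)).
apply: ler_sum => i _; apply: (le_trans (n1M _ _)).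
rewrite ler_piMr ?n1_ge0 //; apply: (le_trans (n1X _ _)).
by rewrite exprn_ile1 ?n1_ge0.
Qed.

Lemma poly_lip p : exists2 K, 0 <= K &
  forall h, n1 h <= 1 -> n1 (p.[h] - p.[0]) <= K * n1 h.
Proof.
have [q pE] : exists q, p = q * 'X + p.[0]%:P.
  exists (drop_poly 1 p); rewrite -[LHS](poly_take_drop 1) addrC expr1; congr (_ + _).
  apply/polyP => i; rewrite coef_take_poly coefC horner_coef0.
  by case: i.
have [K K0 HK] := poly_bound q; exists K => // h h1.
rewrite {1}pE !hornerE addrK; apply: (le_trans (n1M _ _)).
by rewrite ler_wpM2r ?n1_ge0 ?HK.
Qed.

Lemma analytic_ext F G z (d : R) : 0 < d ->
  (forall h, n1 h < d -> F (z + h) = G (z + h)) -> analytic_at F z -> analytic_at G z.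
Proof.
move=> d0 FG HF m; have [p [K [d1 H]]] := HF m.
exists p, K, (Num.min d1 d); have [K0 dd H'] := jet_shrink d0 H; split=> // h hd.
rewrite -FG ?H' //; apply: lt_le_trans hd _; by rewrite ge_min lexx orbT.
Qed.

(** Where [n1 h < 1], a jet of large order is also a jet of every smaller order. Order 0 can thus be
    skipped for quotients, where the value at the centre has to be controlled. *)
Lemma analytic_ge F z (m0 : nat) :
  (forall m, (m0 <= m)%N -> exists p K d, jet m F z p K d) -> analytic_at F z.
Proof.
move=> H m; have [p [K [d Hj]]] := H (maxn m0 m) (leq_maxl _ _).
have [K0 d0 H'] := jet_shrink ltr01 Hj.
exists p, K, (Num.min d 1); split=> // h hd; apply: (le_trans (H' _ hd)).
rewrite ler_wpM2l // ler_wiXn2l ?n1_ge0 ?leq_maxr //.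
by apply: ltW; apply: lt_le_trans hd _; rewrite ge_min lexx orbT.
Qed.

Lemma analytic_cst c z : analytic_at (fun _ => c) z.
Proof.
move=> m; exists c%:P, 0, 1; split=> // h _.
by rewrite hornerC subrr n10 mul0r.
Qed.

Lemma analytic_id z : analytic_at id z.
Proof.
move=> m; exists ('X + z%:P), 0, 1; split=> // h _.
by rewrite !hornerE [h + z]addrC subrr n10.
Qed.

Lemma analyticD F G z : analytic_at F z -> analytic_at G z ->
  analytic_at (fun z => F z + G z) z.
Proof.
move=> HF HG m; have [p [K [d Hp]]] := HF m; have [q [L [e Hq]]] := HG m.
exists (p + q), (K + L), (Num.min d e).
case: Hp Hq => K0 d0 Hp [L0 e0 Hq]; split; rewrite ?addr_ge0 ?lt_min ?d0 //.
move=> h; rewrite lt_min => /andP[hd he].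
rewrite hornerD opprD addrACA mulrDl; apply: (le_trans (n1D _ _)).
by rewrite lerD ?Hp ?Hq.
Qed.

Lemma analyticM F G z : analytic_at F z -> analytic_at G z ->
  analytic_at (fun z => F z * G z) z.
Proof.
move=> HF HG m; have [p [K [d Hp]]] := HF m; have [q [L [e Hq]]] := HG m.
have [P P0 HP] := poly_bound p; have [Q Q0 HQ] := poly_bound q.
exists (p * q), (K * (Q + L) + P * L), (Num.min (Num.min d e) 1).
case: Hp Hq => K0 d0 Hp [L0 e0 Hq].
split; rewrite ?addr_ge0 ?mulr_ge0 ?addr_ge0 // ?lt_min ?d0 ?e0 ?ltr01 //.
move=> h; rewrite !lt_min => /andP[/andP[hd he] h1].
have {}Hp := Hp _ hd; have {}Hq := Hq _ he.
have {}HP := HP _ (ltW h1); have {}HQ := HQ _ (ltW h1).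
have hm0 : 0 <= n1 h ^+ m by rewrite exprn_ge0 ?n1_ge0.
have hm1 : n1 h ^+ m <= 1 by rewrite exprn_ile1 ?n1_ge0 ?ltW.
have HG' : n1 (G (z + h)) <= Q + L.
  rewrite -(subrK q.[h] (G _)) addrC; apply: (le_trans (n1D _ _)); rewrite lerD //.
  by apply: (le_trans Hq); rewrite ler_piMr.
rewrite hornerM (_ : _ - _ = (F (z + h) - p.[h]) * G (z + h) + p.[h] * (G (z + h) - q.[h])); last by ring.
apply: (le_trans (n1D _ _)); rewrite [leRHS]mulrDl lerD //.
  apply: (le_trans (n1M _ _)); rewrite [leRHS]mulrAC ler_pM ?n1_ge0 //.
by apply: (le_trans (n1M _ _)); rewrite -[leRHS]mulrA ler_pM ?n1_ge0.
Qed.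

Lemma analyticN F z : analytic_at F z -> analytic_at (fun z => - F z) z.
Proof.
move=> HF; have := analyticM (analytic_cst (-1) z) HF.
by congr analytic_at; apply/funext => w; rewrite mulN1r.
Qed.

Lemma analyticB F G z : analytic_at F z -> analytic_at G z ->
  analytic_at (fun z => F z - G z) z.
Proof. by move=> HF HG; apply: analyticD => //; exact: analyticN. Qed.

Lemma analyticX F n z : analytic_at F z -> analytic_at (fun z => F z ^+ n) z.
Proof.
move=> HF; elim: n => [|n IH]; first exact: analytic_cst.
have := analyticM HF IH.
by congr analytic_at; apply/funext => w; rewrite exprS.
Qed.

Lemma n1V_le h : n1 h^-1 <= 2 / n1 h.
Proof.
have [->|h0] := eqVneq h 0; first by rewrite invr0 n10 invr0 mulr0.
have h1 : 0 < n1 h by rewrite lt_neqAle eq_sym n1_eq0 h0 n1_ge0.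
have nh := nsq_gt0 h0.
have -> : h^-1 = (nsq h)^-1%:C * conjc h.
  apply: (@mulfI _ h) => //; rewrite divff // mulrCA nsqJE -rmorphM mulVf ?rmorph1 //.
  by rewrite gt_eqF.
rewrite n1Cl n1J ger0_norm ?invr_ge0 ?nsq_ge0 //.
rewrite ler_pdivlMr // -mulrA -expr2 mulrC ler_pdivrMr //.
exact: n1_sq_le.
Qed.

Lemma analytic_inv w z : z != w -> analytic_at (fun z => (z - w)^-1) z.
Proof.
move=> zw m; set c := z - w.
have c0 : c != 0 by rewrite subr_eq0.
have nc : 0 < n1 c by rewrite lt_neqAle eq_sym n1_eq0 c0 n1_ge0.
(* A truncated geometric series in [- h / c]: its remainder is exactly [(- h / c) ^+ m / (c + h)],
   and the radius [n1 c / 2] keeps [c + h] away from 0. *)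
exists (\sum_(k < m) (- c^-1) ^+ k *: (c^-1 *: 'X^k)), (n1 (c^-1) ^+ m * (4 / n1 c)), (n1 c / 2).
split; rewrite ?divr_gt0 // ?mulr_ge0 ?exprn_ge0 ?n1_ge0 ?invr_ge0 ?n1_ge0 //.
move=> h hc.
have hch : n1 c / 2 <= n1 (c + h).
  have : n1 c <= n1 (c + h) + n1 h by rewrite -{1}(addrK h c) n1B.
  by move: hc; lra.
have ch0 : c + h != 0.
  by rewrite -n1_eq0 gt_eqF //; apply: lt_le_trans hch; rewrite divr_gt0.
have -> : z + h - w = c + h by rewrite /c addrAC.
have -> : (c + h)^-1 - (\sum_(k < m) (- c^-1) ^+ k *: (c^-1 *: 'X^k)).[h] =
   (- c^-1) ^+ m * h ^+ m * (c + h)^-1.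
  rewrite horner_sum.
  elim: m => [|m IH]; first by rewrite big_ord0 subr0 expr0 mulr1 mul1r.
  rewrite big_ord_recr /= opprD addrA IH !hornerE.
  rewrite !exprS; move: (_ ^+ m) (_ ^+ m) => u v /=; field; rewrite ch0 c0 //.
apply: (le_trans (n1M _ _)).
have H1 : n1 ((- c^-1) ^+ m * h ^+ m) <= n1 (c^-1) ^+ m * n1 h ^+ m.
  apply: (le_trans (n1M _ _)); rewrite ler_pM ?n1_ge0 //; last exact: n1X.
  by apply: (le_trans (n1X _ _)); rewrite n1N.
have H2 : n1 ((c + h)^-1) <= 4 / n1 c.
  apply: (le_trans (n1V_le _)); rewrite (_ : 4 / n1 c = 2 / (n1 c / 2)); last by field; rewrite gt_eqF.
  by rewrite ler_wpM2l // lef_pV2 ?posrE ?divr_gt0 // (lt_le_trans _ hch) // divr_gt0.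
apply: (le_trans (ler_pM (n1_ge0 _) (n1_ge0 _) H1 H2)).
by apply: le_of_eq; ring.
Qed.

Lemma analytic_cexp c z : analytic_at (fun z => cexp (c * z)) z.
Proof.
move=> m.
exists (\sum_(k < m) (cexp (c * z) * c ^+ k / k`!%:R) *: 'X^k),
  (n1 (cexp (c * z)) * (2 ^+ m.+1 * n1 c ^+ m * expR (n1 c))), 1.
split=> //.
  by rewrite !mulr_ge0 ?exprn_ge0 ?n1_ge0 ?expR_ge0.
move=> h h1.
have -> : cexp (c * (z + h)) - (\sum_(k < m) (cexp (c * z) * c ^+ k / k`!%:R) *: 'X^k).[h]
   = cexp (c * z) * (cexp (c * h) - csum m (c * h)).
  rewrite mulrDr cexpD mulrBr; congr (_ - _).
  rewrite horner_sum mulr_sumr; apply: eq_bigr => k _.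
  by rewrite hornerZ hornerXn exprMn; ring.
apply: (le_trans (n1M _ _)); rewrite -mulrA ler_wpM2l ?n1_ge0 //.
apply: (le_trans (cexp_taylor1 _ _)).
have ch : n1 (c * h) <= n1 c * n1 h := n1M _ _.
rewrite -!mulrA ler_wpM2l ?exprn_ge0 //.
rewrite (_ : _ ^+ m * (_ * _) = (n1 c * n1 h) ^+ m * expR (n1 c)); last by rewrite exprMn; ring.
rewrite ler_pM ?exprn_ge0 ?n1_ge0 ?expR_ge0 //.
  by rewrite lerXn2r ?nnegrE ?mulr_ge0 ?n1_ge0.
rewrite ler_expR; apply: (le_trans ch); by rewrite ler_piMr ?n1_ge0 // ltW.
Qed.

Lemma jet_value m F z p K d : (0 < m)%N -> jet m F z p K d -> p.[0] = F z.
Proof.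
move=> m0 [K0 d0 H]; have := H 0; rewrite n10 expr0n gtn_eqF // mulr0 addr0.
move=> /(_ d0) H0; have : n1 (F z - p.[0]) == 0 by rewrite eq_le H0 n1_ge0.
by rewrite n1_eq0 subr_eq0 => /eqP.
Qed.

End Analytic.

Section AnalyticQuotient.
Variable R : realType.
Implicit Types (z w h : R[i]) (F G : R[i] -> R[i]) (p q : {poly R[i]}).

(* The quotient of a jet of order [m + 1] is a jet of order [m]; the value at [w]
   of the quotient is independent of [m] because all its jets agree near 0. *)
Lemma analytic_div F w : (forall z, analytic_at F z) -> F w = 0 ->
  exists2 G, forall z, analytic_at G z & forall z, F z = (z - w) * G z.
Proof.
move=> HF Fw.
have quot m : exists q K d, [/\ 0 <= K, 0 < d & forall h, h != 0 -> n1 h < d ->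
    n1 (F (w + h) / h - q.[h]) <= K * n1 h ^+ m].
  have [p [K [d Hj]]] := HF w m.+1.
  have p0 := jet_value (ltn0Sn _) Hj; case: Hj => K0 d0 H.
  have [q pE] : exists q, p = q * 'X.
    have /factor_theorem[q qE] : root p 0 by rewrite /root p0 Fw.
    by exists q; rewrite qE polyC0 subr0.
  exists q, (K * 2), d; split; rewrite ?mulr_ge0 // => h h0 hd.
  have nh : 0 < n1 h by rewrite lt_neqAle eq_sym n1_eq0 h0 n1_ge0.
  have -> : F (w + h) / h - q.[h] = (F (w + h) - p.[h]) * h^-1.
    by rewrite pE hornerMX; field.
  apply: (le_trans (n1M _ _)).
  apply: (le_trans (ler_pM (n1_ge0 _) (n1_ge0 _) (H _ hd) (n1V_le _))).
  by rewrite exprS; apply: le_of_eq; field; rewrite gt_eqF.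
have [q1 [K1 [d1 [K10 d10 H1]]]] := quot 1%N.
exists (fun z => if z == w then q1.[0] else F z / (z - w)); last first.
  move=> z; have [->|zw] := eqVneq z w; first by rewrite subrr mul0r.
  by rewrite mulrCA divff ?mulr1 // subr_eq0.
move=> z; have [->|zw] := eqVneq z w; last first.
  have nz : 0 < n1 (z - w) by rewrite lt_neqAle eq_sym n1_eq0 subr_eq0 zw n1_ge0.
  apply: (@analytic_ext _ (fun z => F z * (z - w)^-1) _ _ (n1 (z - w)) nz); last first.
    by apply: analyticM; [exact: HF|exact: analytic_inv].
  move=> h hz; case: eqVneq => // zhw.
  by move: hz; rewrite -zhw opprD addrA subrr sub0r n1N ltxx.
apply: (@analytic_ge _ _ _ 1%N) => m m1.
have [q [K [d [K0 d0 H]]]] := quot m.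
exists q, K, d; split=> // h hd; have [h0|h0] := eqVneq h 0; last first.
  have /negbTE -> : w + h != w by rewrite -subr_eq0 addrAC subrr add0r.
  by rewrite [w + h - w]addrAC subrr add0r; exact: H.
rewrite h0 addr0 eqxx n10 expr0n gtn_eqF // mulr0.
suff -> : q1.[0] = q.[0] by rewrite subrr n10.
apply/eqP; rewrite -subr_eq0 -n1_eq0 eq_le n1_ge0 andbT.
have [L1 L10 HL1] := poly_lip q1; have [L L0 HL] := poly_lip q.
apply/ler_addgt0Pr => e e0; rewrite add0r.
pose S := K + K1 + L1 + L + 1.
have S0 : 0 < S by rewrite /S; lra.
(* The two jets are compared at the nonzero real point [t]; the four errors are multiples of [t]
   whose constants sum to less than [S]. *)
pose t := Num.min (Num.min (d / 2) (d1 / 2)) (Num.min 1 (e / S)).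
have t0 : 0 < t by rewrite /t !lt_min ltr01 !divr_gt0.
have [td td1 t1 te] : [/\ t < d, t < d1, t <= 1 & t <= e / S].
  have : t <= t by []; rewrite {2}/t !le_min => /andP[/andP[td td1] /andP[t1 te]].
  by split=> //; [apply: (le_lt_trans td)|apply: (le_lt_trans td1)]; lra.
have nt : n1 (t%:C) = t by rewrite n1C ger0_norm // ltW.
have tn0 : t%:C != 0 by rewrite -n1_eq0 nt gt_eqF.
have := H1 t%:C tn0; have := H t%:C tn0; rewrite !nt => /(_ td) A /(_ td1) B.
have := HL1 t%:C; have := HL t%:C; rewrite nt => /(_ t1) C /(_ t1) D.
rewrite expr1 in B.
have A' : n1 (F (w + t%:C) / t%:C - q.[t%:C]) <= K * t.
  apply: (le_trans A); rewrite ler_wpM2l // -{2}(expr1 t) ler_wiXn2l // ltW //.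
have -> : q1.[0] - q.[0] = - (q1.[t%:C] - q1.[0]) + - (F (w + t%:C) / t%:C - q1.[t%:C]) +
   (F (w + t%:C) / t%:C - q.[t%:C]) + (q.[t%:C] - q.[0]) by ring.
have le4 a b c d' : n1 (- a + - b + c + d') <= n1 a + n1 b + n1 c + n1 d' :> R.
  apply: (le_trans (n1D _ _)); rewrite lerD2r; apply: (le_trans (n1D _ _)); rewrite lerD2r.
  by apply: (le_trans (n1D _ _)); rewrite !n1N.
apply: (le_trans (le4 _ _ _ _)).
have tS : t * S <= e by rewrite -ler_pdivlMr.
have : t * S = K * t + K1 * t + L1 * t + L * t + t by rewrite /S; ring.
by move: A' B C D; lra.
Qed.

Lemma analytic_lip F z : analytic_at F z -> exists L d, [/\ 0 <= L, 0 < d & forall h, n1 h < d ->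
  n1 (F (z + h) - F z) <= L * n1 h].
Proof.
move=> HF; have [p [K [d Hj]]] := HF 1%N.
have p0 := jet_value (ltn0Sn _) Hj; have [K0 d0 H] := jet_shrink ltr01 Hj.
have [L L0 HL] := poly_lip p.
exists (K + L), (Num.min d 1); split; rewrite ?addr_ge0 // => h hd.
have h1 : n1 h <= 1 by move: hd; rewrite lt_min => /andP[_ /ltW].
rewrite -p0 -(subrKA p.[h]) [leRHS]mulrDl; apply: (le_trans (n1D _ _)); rewrite lerD ?HL //.
by have := H _ hd; rewrite expr1.
Qed.

Lemma nsqD z w : nsq (z + w) = nsq z + 2 * (Re z * Re w + Im z * Im w) + nsq w.
Proof. by rewrite /nsq !ReImE; ring. Qed.

Lemma cross_le z w : `|Re z * Re w + Im z * Im w| <= n1 z * n1 w.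
Proof.
apply: (le_trans (ler_normD _ _)); rewrite !normrM /n1 mulrDl !mulrDr.
have : 0 <= `|Re z| * `|Im w| by rewrite mulr_ge0.
have : 0 <= `|Im z| * `|Re w| by rewrite mulr_ge0.
lra.
Qed.

Lemma nsq_lip F z : analytic_at F z -> exists L d, [/\ 0 <= L, 0 < d & forall h, n1 h < d ->
  `|nsq (F (z + h)) - nsq (F z)| <= L * n1 h].
Proof.
move=> /analytic_lip[L [d [L0 d0 H]]].
exists (2 * n1 (F z) * L + L * L), (Num.min d 1); split.
- by rewrite addr_ge0 ?mulr_ge0 ?n1_ge0.
- by rewrite lt_min d0 ltr01.
move=> h; rewrite lt_min => /andP[hd h1].
have e := H _ hd; set e1 := F (z + h) - F z in e.
have -> : F (z + h) = F z + e1 by rewrite /e1; ring.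
rewrite nsqD addrAC [_ - nsq (F z)]addrAC subrr add0r.
apply: (le_trans (ler_normD _ _)); rewrite [leRHS]mulrDl lerD //.
  rewrite normrM ger0_norm // -!mulrA ler_wpM2l //.
  by apply: (le_trans (cross_le _ _)); rewrite ler_wpM2l ?n1_ge0.
rewrite ger0_norm ?nsq_ge0 //; apply: (le_trans (nsq_le _)).
apply: (@le_trans _ _ ((L * n1 h) ^+ 2)); first by rewrite lerXn2r ?nnegrE ?mulr_ge0 ?n1_ge0.
have h1' : n1 h * n1 h <= n1 h by rewrite ler_piMl ?n1_ge0 // ltW.
rewrite exprMn !expr2 ler_wpM2l ?mulr_ge0 //.
Qed.

(* Averaging over the four points [z +/- t], [z +/- i t] cancels the linear terms and
   the real part of the quadratic ones. *)
Lemma submean F z : analytic_at F z -> exists K d, [/\ 0 <= K, 0 < d & forall t, 0 < t < d ->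
  4 * nsq (F z) - K * t ^+ 3 <= nsq (F (z + t%:C)) + nsq (F (z - t%:C)) +
     nsq (F (z + 'i * t%:C)) + nsq (F (z - 'i * t%:C))].
Proof.
move=> HF; have [p [K [d Hj]]] := HF 3%N.
have p0 := jet_value (ltn0Sn _) Hj; have [K0 d0 H] := jet_shrink ltr01 Hj.
set q := drop_poly 3 p.
have [Q Q0 HQ] := poly_bound q.
pose A := F z; pose B := p`_1; pose C := p`_2.
have pE h : p.[h] = A + B * h + C * h ^+ 2 + q.[h] * h ^+ 3.
  rewrite /A -p0 horner_coef0 -{1}(poly_take_drop 3 p) hornerD hornerM hornerXn; congr (_ + _).
  rewrite (@horner_coef_wide _ 3); last exact: size_take_poly.
  rewrite !big_ord_recr big_ord0 /= !coef_take_poly /= add0r expr0 mulr1 expr1 //.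
pose a := n1 A + n1 B + n1 C.
have a0 : 0 <= a by rewrite !addr_ge0 ?n1_ge0.
have est t e : 0 < t < Num.min d 1 -> n1 e = 1 ->
   nsq (A + B * (e * t%:C) + C * (e * t%:C) ^+ 2) - 2 * a * (K + Q) * t ^+ 3 <= nsq (F (z + e * t%:C)).
  move=> /andP[t0 td] e1.
  have ht : n1 (e * t%:C) = t by rewrite mulrC n1Cl e1 mulr1 gtr0_norm.
  have t1 : t <= 1 by move: td; rewrite lt_min => /andP[_ /ltW].
  have := H (e * t%:C); rewrite ht => /(_ td) Hr.
  set h := e * t%:C in ht Hr *.
  set U := A + B * h + C * h ^+ 2; set V := F (z + h) - U.
  have VE : n1 V <= (K + Q) * t ^+ 3.
    rewrite (_ : V = (F (z + h) - p.[h]) + q.[h] * h ^+ 3); last by rewrite /V pE /U; ring.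
    apply: (le_trans (n1D _ _)); rewrite [leRHS]mulrDl lerD //.
    apply: (le_trans (n1M _ _)); rewrite ler_pM ?n1_ge0 ?HQ ?ht //.
    by rewrite -[in leRHS]ht; exact: n1X.
  have UE : n1 U <= a.
    apply: (le_trans (n1D _ _)); rewrite lerD //.
      apply: (le_trans (n1D _ _)); rewrite lerD2l.
      by apply: (le_trans (n1M _ _)); rewrite ht ler_piMr ?n1_ge0.
    apply: (le_trans (n1M _ _)); rewrite ler_piMr ?n1_ge0 //.
    apply: (le_trans (n1X _ _)); rewrite ht expr_le1 // ltW //.
  have -> : F (z + h) = U + V by rewrite /V; ring.
  rewrite nsqD.
  have := cross_le U V; have := nsq_ge0 V.
  have : n1 U * n1 V <= a * ((K + Q) * t ^+ 3) by rewrite ler_pM ?n1_ge0.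
  move=> h1 h2; rewrite ler_norml => /andP[h3 _].
  have -> : 2 * a * (K + Q) * t ^+ 3 = 2 * (a * ((K + Q) * t ^+ 3)) by ring.
  lra.
exists (4 * (2 * a * (K + Q))), (Num.min d 1); split=> //.
  by rewrite !mulr_ge0 ?addr_ge0.
move=> t td.
have := est t 1 td; have := est t (-1) td; have := est t 'i td; have := est t (- 'i) td.
rewrite !n1N n1_1 (_ : n1 'i = 1); last by rewrite /n1 /= normr0 normr1 add0r.
rewrite !mulN1r !mul1r !mulNr => /(_ erefl) E1 /(_ erefl) E2 /(_ erefl) E3 /(_ erefl) E4.
apply: le_trans (lerD (lerD (lerD E4 E3) E2) E1).
have : 4 * nsq A <= nsq (A + B * t%:C + C * t%:C ^+ 2) + nsq (A + B * - t%:C + C * (- t%:C) ^+ 2)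
   + nsq (A + B * ('i * t%:C) + C * ('i * t%:C) ^+ 2) + nsq (A + B * - ('i * t%:C) + C * (- ('i * t%:C)) ^+ 2).
  rewrite -/(nsq A).
  clearbody A B C; case: A B C {pE a a0 est E1 E2 E3 E4} => [a1 a2] [b1 b2] [c1 c2].
  rewrite [X in _ <= X](_ : _ = 4 * (a1 ^+ 2 + a2 ^+ 2) + 4 * t ^+ 2 * (b1 ^+ 2 + b2 ^+ 2) + 4 * t ^+ 4 * (c1 ^+ 2 + c2 ^+ 2)); last first.
    by rewrite /nsq !sqrrN !expr2 !ReImE /=; ring.
  have : 0 <= t ^+ 2 * (b1 ^+ 2 + b2 ^+ 2) by rewrite mulr_ge0 ?addr_ge0 ?sqr_ge0.
  have : 0 <= t ^+ 4 * (c1 ^+ 2 + c2 ^+ 2) by rewrite mulr_ge0 ?addr_ge0 ?sqr_ge0 // exprn_even_ge0.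
  rewrite /nsq /=; lra.
lra.
Qed.

End AnalyticQuotient.

(** * Maximum principle on compact sets *)

Section MaxPrinciple.
Variable R : realType.
Implicit Types (z w h : R[i]) (F G : R[i] -> R[i]).

Definition pt (p : R * R) : R[i] := p.1 +i* p.2.

Lemma nsq_continuous F (c : R * R) (k : R) : analytic_at F (pt c) ->
  {for c, continuous (fun p : R * R => nsq (F (pt p)) + k * nsq (pt p))}.
Proof.
move=> HF; apply/cvgrPdist_le => e e0.
have [L [d [L0 d0 H]]] := nsq_lip HF.
have [L' [d' [L'0 d'0 H']]] := nsq_lip (@analytic_id R (pt c)).
pose S := L + `|k| * L' + 1.
have S0 : 0 < S by rewrite /S ltr_wpDl // addr_ge0 // mulr_ge0.
pose t := Num.min (Num.min d d') (e / S).
have t0 : 0 < t by rewrite !lt_min d0 d'0 divr_gt0.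
near=> p.
pose h := (p.1 - c.1) +i* (p.2 - c.2).
have ph : pt p = pt c + h by apply: complex_ext; rewrite !ReImE /=; ring.
have ht : n1 h < t.
  rewrite /n1 /= [t]splitr ltrD //.
    rewrite distrC; near: p.
    exact: (@cvgr_dist_lt _ _ _ (nbhs c) _ fst c.1 cvg_fst (t / 2) (divr_gt0 t0 (ltr0Sn _ 1))).
  rewrite distrC; near: p.
  exact: (@cvgr_dist_lt _ _ _ (nbhs c) _ snd c.2 cvg_snd (t / 2) (divr_gt0 t0 (ltr0Sn _ 1))).
have := ht; rewrite !lt_min => /andP[/andP[hd hd'] he].
rewrite ph opprD addrACA -mulrBr.
apply: (le_trans (ler_normD _ _)); rewrite normrM distrC [`|nsq (pt c) - _|]distrC.
have A := H _ hd; have B := H' _ hd'.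
have : `|k| * `|nsq (pt c + h) - nsq (pt c)| <= `|k| * (L' * n1 h) by rewrite ler_wpM2l.
have : n1 h * S <= e by rewrite -ler_pdivlMr // ltW.
have -> : n1 h * S = L * n1 h + `|k| * (L' * n1 h) + n1 h by rewrite /S; ring.
have := n1_ge0 h; lra.
Unshelve. all: by end_near. Qed.

(* [V] is the part of the boundary of [A] where the bound is known. Adding a small
   multiple of [nsq z] makes the sub-mean inequality strict, so that the
   maximum over [A] is attained on [V]. *)
Lemma max_principle (A V : set (R * R)) F (M X : R) : compact A ->
  (forall p, A p -> nsq (pt p) <= X) ->
  (forall p, A p -> analytic_at F (pt p)) ->
  (forall p, A p -> ~ V p -> exists2 d : R, 0 < d & forall q, n1 (pt q - pt p) < d -> A q) ->
  (forall p, A p -> V p -> nsq (F (pt p)) <= M) ->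
  forall p, A p -> nsq (F (pt p)) <= M.
Proof.
move=> cA AX HF Aint AV p Ap; rewrite leNgt; apply/negP => Mp.
have X0 : 0 <= X by apply: le_trans (AX _ Ap); exact: nsq_ge0.
(* So small that on [A] the perturbation [k * nsq] stays below the assumed excess of [nsq (F p)]
   over [M]; the maximum then cannot lie in [V]. *)
pose k := (nsq (F (pt p)) - M) / (X + 1) / 2.
have X1 : 0 < X + 1 by lra.
have k0 : 0 < k by rewrite /k !divr_gt0 ?subr_gt0.
have kX : k * X < nsq (F (pt p)) - M.
  have -> : nsq (F (pt p)) - M = k * (X + 1) * 2 by rewrite /k; field; rewrite gt_eqF.
  have := mulr_ge0 (ltW k0) X0; lra.
have [|c /[!inE] Ac Hc] := @compact_EVT_max _ _ (fun p : R * R => nsq (F (pt p)) + k * nsq (pt p)) A (ex_intro _ p Ap) cA.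
  by apply: continuous_in_subspaceT => x /[!inE] Ax; apply: nsq_continuous; exact: HF.
have pc : nsq (F (pt p)) + k * nsq (pt p) <= nsq (F (pt c)) + k * nsq (pt c) by apply: Hc; rewrite inE.
have kc : k * nsq (pt c) <= k * X by rewrite ler_wpM2l ?(ltW k0) ?AX.
have kp : 0 <= k * nsq (pt p) by rewrite mulr_ge0 ?(ltW k0) ?nsq_ge0.
have [Vc|nVc] := pselect (V c); first by have := AV _ Ac Vc; lra.
have [d d0 Hd] := Aint _ Ac nVc.
have [K [d' [K0 d'0 Hm]]] := submean (HF _ Ac).
(* Over the four points around the maximum, [k * nsq] gains [4 k t ^+ 2] in total, which beats the
   cubic error once [K t <= k]. *)
pose t := Num.min (Num.min (d / 2) (d' / 2)) (k / (K + 1)).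
have K1 : 0 < K + 1 by rewrite ltr_wpDl.
have t0 : 0 < t.
  by rewrite /t !lt_min; apply/andP; split; [apply/andP; split|]; rewrite divr_gt0.
have [td td' tk] : [/\ t < d, t < d' & t <= k / (K + 1)].
  have : t <= t by []; rewrite {2}/t !le_min => /andP[/andP[h1 h2] h3].
  by split=> //; [apply: (le_lt_trans h1)|apply: (le_lt_trans h2)]; lra.
have nb q : n1 (pt q - pt c) = t -> nsq (F (pt q)) + k * nsq (pt q) <= nsq (F (pt c)) + k * nsq (pt c).
  by move=> qt; apply: Hc; rewrite inE; apply: Hd; rewrite qt.
have tn : `|t| = t by rewrite gtr0_norm.
have E1 : pt (c.1 + t, c.2) = pt c + t%:C by apply: complex_ext; rewrite !ReImE /=; ring.
have E2 : pt (c.1 - t, c.2) = pt c - t%:C by apply: complex_ext; rewrite !ReImE /=; ring.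
have E3 : pt (c.1, c.2 + t) = pt c + 'i * t%:C by apply: complex_ext; rewrite !ReImE /=; ring.
have E4 : pt (c.1, c.2 - t) = pt c - 'i * t%:C by apply: complex_ext; rewrite !ReImE /=; ring.
have T1 : n1 (t%:C : R[i]) = t by rewrite n1C.
have T2 : n1 ('i * t%:C : R[i]) = t by rewrite mulrC n1Cl /n1 /= normr0 normr1 add0r mulr1.
have := nb (c.1 + t, c.2); rewrite E1 [pt c + _]addrC addrK => /(_ T1) N1.
have := nb (c.1 - t, c.2); rewrite E2 [pt c - t%:C - _]addrAC subrr sub0r n1N => /(_ T1) N2.
have := nb (c.1, c.2 + t); rewrite E3 [pt c + _ * _]addrC addrK => /(_ T2) N3.
have := nb (c.1, c.2 - t); rewrite E4 [pt c - 'i * t%:C - _]addrAC subrr sub0r n1N => /(_ T2) N4.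
have := Hm t; rewrite t0 td' => /(_ erefl) Hs.
have sq : nsq (t%:C + pt c) + nsq (pt c - t%:C) + nsq ('i * t%:C + pt c) + nsq (pt c - 'i * t%:C)
    = 4 * nsq (pt c) + 4 * t ^+ 2.
  by rewrite /nsq !ReImE /=; ring.
have Kt : K * t <= k.
  have : t * (K + 1) <= k by rewrite -ler_pdivlMr.
  have -> : t * (K + 1) = K * t + t by ring.
  lra.
have sqk : k * nsq (t%:C + pt c) + k * nsq (pt c - t%:C) + k * nsq ('i * t%:C + pt c) + k * nsq (pt c - 'i * t%:C) = 4 * (k * nsq (pt c)) + 4 * (k * t ^+ 2).
  by rewrite -!mulrDr sq; ring.
have : K * t ^+ 3 <= k * t ^+ 2.
  have -> : K * t ^+ 3 = K * t * t ^+ 2 by ring.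
  by rewrite ler_wpM2r ?sqr_ge0.
have : 0 < k * t ^+ 2 by rewrite mulr_gt0 ?exprn_gt0.
rewrite [pt c + t%:C]addrC [pt c + 'i * t%:C]addrC in Hs.
by move: Hs N1 N2 N3 N4 sqk; lra.
Qed.

End MaxPrinciple.

(** * Maximum principle in a half-plane *)

Section HalfPlane.
Variable R : realType.
Implicit Types (z w h q : R[i]) (F G : R[i] -> R[i]) (rho : R).

(** The half-plane minus the disc of squared radius [r2] about [q] is cut off by a box of size [X];
    a point off the four boundary pieces satisfies all constraints strictly, hence is interior. A
    negative [r2] removes no disc. *)
Lemma half_plane_max_compact F rho q (r2 M X : R) :
  let reg z := - rho <= Im z /\ r2 <= nsq (z - q) in
  (forall z, reg z -> analytic_at F z) ->
  (forall z, reg z -> [\/ Im z = - rho, nsq (z - q) = r2, X <= `|Re z| | X <= Im z] -> nsq (F z) <= M) ->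
  forall z, reg z -> `|Re z| <= X -> Im z <= X -> nsq (F z) <= M.
Proof.
move=> reg Fan FV z0 rz0 z0X z0Y.
pose A := (`[- X, X] `*` `[- rho, X]) `&` (fun p : R * R => nsq (pt p - q)) @^-1` [set x | r2 <= x].
pose V (p : R * R) := [\/ p.2 = - rho, nsq (pt p - q) = r2, X <= `|p.1| | X <= p.2].
have Aq z : `|Re z| <= X -> - rho <= Im z <= X -> r2 <= nsq (z - q) -> A (Re z, Im z).
  move=> h1 h2 h3; split; last by rewrite /pt /=; case: z h1 h2 h3.
  by split; rewrite /= in_itv //= -ler_norml.
have AE p : A p -> [/\ `|p.1| <= X, - rho <= p.2, p.2 <= X & r2 <= nsq (pt p - q)].
  by case=> -[/= h1 h2] h3; move: h1 h2; rewrite !in_itv /= -ler_norml => -> /andP[-> ->].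
have := @max_principle R A V F M (X ^+ 2 + (`|rho| + `|X|) ^+ 2).
have zE : pt (Re z0, Im z0) = z0 by case: (z0).
move=> /(_ _ _ _ _ _ (Re z0, Im z0)); rewrite zE; apply.
- apply: compact_closedI; first by apply: compact_setX; exact: segment_compact.
  apply: preimage_closed; last exact: closed_ge.
  move=> p _; have := @nsq_continuous R (fun z => z - q) p 0 _.
  move=> /(_ (analyticB (analytic_id _) (analytic_cst _ _))).
  by under [X in continuous_at _ X -> _]eq_fun do rewrite mul0r addr0.
- move=> p /AE[h1 h2 h3 _]; rewrite /nsq /pt /= lerD //.
    by rewrite -[p.1 ^+ 2]real_normK ?num_real // lerXn2r ?nnegrE // (le_trans _ h1).
  rewrite -[p.2 ^+ 2]real_normK ?num_real // lerXn2r ?nnegrE ?addr_ge0 //.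
  rewrite ler_norml; have := ler_norm rho; have := ler_norm X.
  have := normr_ge0 rho; have := normr_ge0 X => *; apply/andP; split; lra.
- by move=> p /AE[_ h2 _ h4]; apply: Fan.
- move=> p Ap nV; have [h1 h2 h3 h4] := AE _ Ap.
  have n1' : `|p.1| < X by rewrite ltNge; apply/negP => h; apply: nV; constructor 3.
  have n2' : - rho < p.2.
    by rewrite lt_neqAle h2 andbT; apply/eqP => h; apply: nV; constructor 1.
  have n3' : p.2 < X by rewrite ltNge; apply/negP => h; apply: nV; constructor 4.
  have n4' : r2 < nsq (pt p - q).
    by rewrite lt_neqAle h4 andbT; apply/eqP => h; apply: nV; constructor 2.
  have [L [d [L0 d0 HL]]] := nsq_lip (analyticB (analytic_id (pt p)) (analytic_cst q (pt p))).
  pose e1 := X - `|p.1|; pose e2 := p.2 + rho; pose e3 := X - p.2.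
  pose e4 := (nsq (pt p - q) - r2) / (L + 1).
  have L1 : 0 < L + 1 by rewrite ltr_wpDl.
  have e40 : 0 < e4 by apply: divr_gt0 => //; rewrite subr_gt0.
  exists (Num.min (Num.min (Num.min e1 e2) (Num.min e3 e4)) d).
    rewrite !lt_min d0 e40 /e1 /e2 /e3 !subr_gt0 n1' n3' /= !andbT.
    by move: n2'; lra.
  move=> p' ; rewrite !lt_min => /andP[/andP[/andP[l1 l2] /andP[l3 l4]] l5].
  have p1 := Re_le_n1 (pt p' - pt p); have p2 := Im_le_n1 (pt p' - pt p).
  rewrite cReB /= in p1; rewrite cImB /= in p2.
  have -> : p' = (Re (pt p'), Im (pt p')) by case: (p').
  apply: Aq => /=.
  - have -> : p'.1 = p.1 + (p'.1 - p.1) by ring.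
    by apply: (le_trans (ler_normD _ _)); move: l1; rewrite /e1; lra.
  - move: p2; rewrite ler_norml => /andP[]; move: l2 l3; rewrite /e2 /e3 => *.
    by apply/andP; split; lra.
  - have := HL _ l5; rewrite (_ : pt p + (pt p' - pt p) - q = pt p' - q); last by ring.
    rewrite ler_norml => /andP[hl _].
    have : n1 (pt p' - pt p) * (L + 1) <= nsq (pt p - q) - r2.
      by rewrite -ler_pdivlMr // ltW.
    have := n1_ge0 (pt p' - pt p); move: hl; lra.
- move=> p /AE[_ h2 _ h4] [] h; apply: FV; rewrite ?/reg //=; try by [].
  + by constructor 1.
  + by constructor 2.
  + by constructor 3.
  + by constructor 4.
- by case: rz0 => *; apply: Aq => //; apply/andP.
Qed.

(* Phragmen-Lindelof: the decaying factor [i L / (z + i rho + i L)] reduces the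
   unbounded region to a compact one. *)
Lemma half_plane_max F rho q (r2 M S : R) :
  let reg z := - rho <= Im z /\ r2 <= nsq (z - q) in
  0 <= M ->
  (forall z, reg z -> analytic_at F z) ->
  (forall z, reg z -> nsq (F z) <= S) ->
  (forall z, reg z -> Im z = - rho \/ nsq (z - q) = r2 -> nsq (F z) <= M) ->
  forall z, reg z -> nsq (F z) <= M.
Proof.
move=> reg M0 Fan FS FM z0 rz0.
have S0 : 0 <= S := le_trans (nsq_ge0 _) (FS _ rz0).
rewrite leNgt; apply/negP => Mz0.
set P := nsq (F z0) in Mz0.
pose M1 := (P + M) / 2.
have M1P : M < M1 < P by apply/andP; rewrite /M1; split; lra.
case/andP: M1P => MM1 M1P.
have M10 : 0 < M1 by apply: le_lt_trans MM1.
pose s := Im z0 + rho.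
have s0 : 0 <= s by rewrite /s; case: rz0; lra.
pose W := 2 * s + s ^+ 2 + Re z0 ^+ 2.
have W0 : 0 <= W.
  by rewrite /W; have := sqr_ge0 s; have := sqr_ge0 (Re z0); move: s0; lra.
(* The squared modulus of the factor at [z0] tends to 1 as [L] grows; for this [L] it keeps
   [nsq (G z0)] above [M1], which is [HM]. *)
pose L := 1 + M1 * W / (P - M1).
have PM1 : 0 < P - M1 by lra.
have L1 : 1 <= L.
  by rewrite /L lerDl; apply: divr_ge0; [apply: mulr_ge0 => //|]; exact: ltW.
have L0 : 0 < L by apply: lt_le_trans L1.
pose w : R[i] := - ('i * (rho + L)%:C).
pose G z := F z * (('i * L%:C) * (z - w)^-1).
have zw z : - rho <= Im z -> z != w.
  move=> hz; apply/eqP => /(congr1 (@complex.Im R)); rewrite /w !ReImE /=; lra.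
have nG z : nsq (G z) = nsq (F z) * (L ^+ 2 / (Re z ^+ 2 + (Im z + rho + L) ^+ 2)).
  rewrite /G !nsqM nsqV; congr (_ * _); congr (_ / _).
    by rewrite /nsq /=; ring.
  by rewrite /nsq /w !ReImE /=; ring.
have den z : - rho <= Im z -> L ^+ 2 <= Re z ^+ 2 + (Im z + rho + L) ^+ 2.
  move=> hz; have : 0 <= Re z ^+ 2 by rewrite sqr_ge0.
  have : L ^+ 2 <= (Im z + rho + L) ^+ 2 by rewrite lerXn2r ?nnegrE //; move: L0; lra.
  lra.
have L20 : 0 < L ^+ 2 by rewrite exprn_gt0.
have nGle z : - rho <= Im z -> nsq (G z) <= nsq (F z).
  move=> hz; rewrite nG ler_piMr ?nsq_ge0 // ler_pdivrMr ?mul1r ?den //.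
  exact: lt_le_trans (den _ hz).
(* Beyond this size the decay of the factor alone brings the crude bound [S] down to [M1]. *)
pose X := Num.max (Num.max (`|Re z0|) (Im z0)) (Num.max (S * L ^+ 2 / M + `|rho|) (S * L ^+ 2 / M1 + `|rho| + 1)).
have := @half_plane_max_compact G rho q r2 M1 X _ _ z0 rz0.
suff HM : P * (L ^+ 2) > M1 * (Re z0 ^+ 2 + (Im z0 + rho + L) ^+ 2).
  move=> H; have : nsq (G z0) <= M1.
    apply: H; rewrite /X ?le_max ?lexx ?orbT //.
    - move=> z rz; apply: analyticM; first exact: Fan.
      apply: analyticM; first exact: analytic_cst.
      by apply: analytic_inv; apply: zw; case: rz.
    - move=> z rz [h|h|h|h].
      + by apply: le_trans (ltW MM1); apply: (le_trans (nGle _ _)); [case: rz|apply: FM => //; left].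
      + by apply: le_trans (ltW MM1); apply: (le_trans (nGle _ _)); [case: rz|apply: FM => //; right].
      + have hX : S * L ^+ 2 / M1 + 1 <= `|Re z|.
          apply: le_trans h; rewrite /X !le_max; do 2 (apply/orP; right).
          by have := normr_ge0 rho; lra.
        have XX : 0 <= S * L ^+ 2 / M1.
          by apply: divr_ge0; [apply: mulr_ge0 => //|]; exact: ltW.
        rewrite nG mulrA ler_pdivrMr; last by apply: lt_le_trans (den _ _) => //; case: rz.
        apply: (@le_trans _ _ (S * L ^+ 2)); first by rewrite ler_wpM2r ?(ltW L20) ?FS.
        rewrite [leRHS]mulrC -ler_pdivrMr //.
        have : S * L ^+ 2 / M1 <= `|Re z| ^+ 2.
          have h1 : 1 <= `|Re z| by lra.
          apply: (@le_trans _ _ `|Re z|); first by lra.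
          by rewrite expr2 ler_peMr.
        rewrite real_normK ?num_real //.
        have : 0 <= (Im z + rho + L) ^+ 2 by rewrite sqr_ge0.
        lra.
      + have hX : S * L ^+ 2 / M1 + `|rho| + 1 <= Im z.
          by apply: le_trans h; rewrite /X !le_max lexx !orbT.
        have XX : 0 <= S * L ^+ 2 / M1.
          by apply: divr_ge0; [apply: mulr_ge0 => //|]; exact: ltW.
        rewrite nG mulrA ler_pdivrMr; last by apply: lt_le_trans (den _ _) => //; case: rz.
        apply: (@le_trans _ _ (S * L ^+ 2)); first by rewrite ler_wpM2r ?(ltW L20) ?FS.
        rewrite [leRHS]mulrC -ler_pdivrMr //.
        have hr : - `|rho| <= rho by rewrite lerNl ler_normr lexx orbT.
        have h1 : 1 <= Im z + rho + L by lra.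
        have : Im z + rho + L <= (Im z + rho + L) ^+ 2.
          by rewrite expr2 ler_peMr //; lra.
        have : 0 <= Re z ^+ 2 by rewrite sqr_ge0.
        by move: h1 hX hr L1; lra.
  rewrite nG mulrA ler_pdivrMr; last by apply: lt_le_trans (den _ _) => //; case: rz0.
  by rewrite leNgt HM.
have LW : M1 * W < (P - M1) * L.
  by rewrite [ltRHS]mulrC -ltr_pdivrMr // /L ltrDr.
have -> : Re z0 ^+ 2 + (Im z0 + rho + L) ^+ 2 = L ^+ 2 + (s ^+ 2 + Re z0 ^+ 2) * 1 + 2 * s * L by rewrite /s; ring.
have : (s ^+ 2 + Re z0 ^+ 2) * 1 <= (s ^+ 2 + Re z0 ^+ 2) * L by rewrite ler_wpM2l // addr_ge0 ?sqr_ge0.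
move=> h; apply: (@le_lt_trans _ _ (M1 * (L ^+ 2 + W * L))).
  by rewrite ler_pM2l // /W; lra.
have : M1 * W * L < (P - M1) * L * L by rewrite ltr_pM2r.
by clear -M1P; lra.
Qed.

End HalfPlane.

(** * Zeros of entire functions bounded in a half-plane *)

Section Blaschke.
Variable R : realType.
Implicit Types (z h q : R[i]) (F G : R[i] -> R[i]) (rho : R).

Definition entire F := forall z, analytic_at F z.

Lemma nsqD_le z w (t : R) : 0 < t -> nsq (z + w) <= (1 + t) * nsq z + (1 + t^-1) * nsq w.
Proof.
move=> t0; rewrite nsqD.
have key a b : 2 * (a * b) <= t * a ^+ 2 + t^-1 * b ^+ 2.
  have : 0 <= t^-1 * (t * a - b) ^+ 2 by rewrite mulr_ge0 ?invr_ge0 ?sqr_ge0 // ltW.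
  have -> : t^-1 * (t * a - b) ^+ 2 = t * a ^+ 2 - 2 * (a * b) + t^-1 * b ^+ 2.
    by field; rewrite gt_eqF.
  lra.
have := key (Re z) (Re w); have := key (Im z) (Im w); rewrite /nsq; lra.
Qed.

Lemma nsqD2 z w : nsq (z + w) <= 2 * nsq z + 2 * nsq w.
Proof. by apply: (le_trans (nsqD_le z w ltr01)); rewrite invr1. Qed.

Lemma nsq_shift z (s : R) : nsq (z + 0 +i* s) = nsq z + 2 * s * Im z + s ^+ 2.
Proof. by rewrite nsqD /nsq /=; ring. Qed.

(* [G] is [F] divided by the Blaschke factor of the half-plane [Im z >= - rho]
   at [w]; the factor has modulus 1 on the boundary line. *)
Lemma remove_zero F rho (M w : R) : entire F -> 0 < rho -> 0 <= M ->
  (forall z, - rho <= Im z -> nsq (F z) <= M) -> F w%:C = 0 ->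
  exists G, [/\ entire G,
    forall z, F z * (z - w%:C + 0 +i* (2 * rho)) = (z - w%:C) * G z,
    forall z, - rho <= Im z -> nsq (G z) <= M &
    forall v : R, v != w -> F v%:C = 0 -> G v%:C = 0].
Proof.
move=> HF r0 M0 FM Fw; have [H HH FH] := analytic_div HF Fw.
pose G z := H z * (z - w%:C + 0 +i* (2 * rho)).
have GE z : F z * (z - w%:C + 0 +i* (2 * rho)) = (z - w%:C) * G z.
  by rewrite FH /G; ring.
have HG : entire G.
  move=> z; apply: analyticM => //; apply: analyticD; last exact: analytic_cst.
  by apply: analyticB; [exact: analytic_id|exact: analytic_cst].
exists G; split=> //; last first.
  move=> v vw Fv; rewrite /G; suff -> : H v%:C = 0 by rewrite mul0r.
  apply/eqP; move/eqP: Fv; rewrite FH mulf_eq0 => /orP[|//].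
  by rewrite subr_eq0 => /eqP/complexI/eqP; rewrite (negbTE vw).
have [L [d [L0 d0 HL]]] := nsq_lip (HG w%:C).
(* [half_plane_max] requires some finite bound on [G] in advance: [S1] near [w], by the Lipschitz
   estimate, and [S2] away from [w], where the inverse of the Blaschke factor is bounded. *)
pose S1 := nsq (G w%:C) + L * d.
pose S2 := M * (2 + 2 * (4 * rho ^+ 2 / (d ^+ 2 / 2))).
have S10 : 0 <= S1 by rewrite addr_ge0 ?nsq_ge0 ?mulr_ge0 // ltW.
have S20 : 0 <= S2.
  apply: mulr_ge0 => //; apply: addr_ge0 => //; apply: mulr_ge0 => //.
  by apply: divr_ge0; [apply: mulr_ge0|apply: divr_ge0]; rewrite ?sqr_ge0.
have zw z : Im z = - rho -> z - w%:C != 0.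
  by move=> hz; apply/eqP => /(congr1 (@complex.Im R)); rewrite !ReImE /=; lra.
have nG z : nsq (F z) * nsq (z - w%:C + 0 +i* (2 * rho)) = nsq (z - w%:C) * nsq (G z).
  by rewrite -!nsqM GE.
move=> z hz; apply: (@half_plane_max _ G rho 0 (-1) M (S1 + S2)) => //.
- move=> u [hu _]; have [ud|ud] := ltP (n1 (u - w%:C)) d.
    have := HL _ ud; rewrite (_ : w%:C + (u - w%:C) = u); last by ring.
    have : L * n1 (u - w%:C) <= L * d by rewrite ler_wpM2l // ltW.
    by rewrite ler_norml /S1; move: S20 => ? ? /andP[]; lra.
  have nu : d ^+ 2 / 2 <= nsq (u - w%:C).
    rewrite ler_pdivrMr // mulrC; apply: le_trans (n1_sq_le _).
    by rewrite lerXn2r ?nnegrE ?n1_ge0 // ltW.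
  have d20 : 0 < d ^+ 2 / 2 by rewrite divr_gt0 ?exprn_gt0.
  have nu0 : 0 < nsq (u - w%:C) by apply: lt_le_trans nu.
  apply: (@le_trans _ _ S2); last by rewrite lerDr.
  rewrite -(ler_pM2l nu0) -nG /S2 mulrCA.
  apply: ler_pM; rewrite ?nsq_ge0 ?FM //.
  apply: (le_trans (nsqD2 _ _)).
  rewrite [leRHS](_ : _ = 2 * nsq (u - w%:C) + 2 * (nsq (u - w%:C) * (4 * rho ^+ 2 / (d ^+ 2 / 2)))); last by ring.
  rewrite lerD2l ler_wpM2l //.
  have -> : nsq (0 +i* (2 * rho)) = 4 * rho ^+ 2 by rewrite /nsq /=; ring.
  have -> : nsq (u - w%:C) * (4 * rho ^+ 2 / (d ^+ 2 / 2)) = 4 * rho ^+ 2 * (nsq (u - w%:C) / (d ^+ 2 / 2)).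
    by ring.
  apply: ler_peMr; first by apply: mulr_ge0; rewrite ?sqr_ge0.
  by rewrite ler_pdivlMr // mul1r.
- move=> u [hu _] [h|]; last by have := nsq_ge0 (u - 0) => + h; rewrite h; lra.
  have := nG u; rewrite nsq_shift.
  rewrite (_ : Im (u - w%:C) = - rho); last by rewrite !ReImE /= subr0.
  have -> : nsq (u - w%:C) + 2 * (2 * rho) * - rho + (2 * rho) ^+ 2 = nsq (u - w%:C) by ring.
  rewrite mulrC => /mulfI <- //; first exact: FM.
  by rewrite nsq_eq0 zw.
- by split=> //; apply: le_trans (nsq_ge0 _); rewrite lerN10.
Qed.

Lemma blaschke_prod (s : seq R) F rho (M : R) : uniq s -> entire F -> 0 < rho -> 0 <= M ->
  (forall z, - rho <= Im z -> nsq (F z) <= M) -> (forall w : R, w \in s -> F w%:C = 0) ->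
  forall z, - rho <= Im z ->
  nsq (F z) * \prod_(w <- s) nsq (z - w%:C + 0 +i* (2 * rho)) <= M * \prod_(w <- s) nsq (z - w%:C).
Proof.
elim: s F => [|w s IH] F /=; first by move=> _ HF r0 M0 FM _ z hz; rewrite !big_nil !mulr1 FM.
move=> /andP[ws us] HF r0 M0 FM Fs z hz.
have [G [HG GE GM Gz]] := remove_zero HF r0 M0 FM (Fs w (mem_head _ _)).
have Gs v : v \in s -> G v%:C = 0.
  move=> vs; apply: Gz; first by apply: contraNneq ws => <-.
  by apply: Fs; rewrite inE vs orbT.
rewrite !big_cons mulrA -nsqM GE nsqM -mulrA [leRHS]mulrCA.
by rewrite ler_wpM2l ?nsq_ge0 // IH.
Qed.

(** The squared modulus of each Blaschke factor is [1 - x] with [x = 4 rho (Im z + rho) / |z - w + 2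
    i rho|^2], and [1 - x <= exp (- x)] turns the product into a sum over the zeros. *)
Lemma blaschke_exp (s : seq R) F rho (M : R) : uniq s -> entire F -> 0 < rho -> 0 <= M ->
  (forall z, - rho <= Im z -> nsq (F z) <= M) -> (forall w : R, w \in s -> F w%:C = 0) ->
  forall z, - rho <= Im z ->
  nsq (F z) <= M * expR (- \sum_(w <- s) 4 * rho * (Im z + rho) / nsq (z - w%:C + 0 +i* (2 * rho))).
Proof.
move=> us HF r0 M0 FM Fs z hz.
have pos (w : R) : 0 < nsq (z - w%:C + 0 +i* (2 * rho)).
  apply: nsq_gt0; apply/eqP => /(congr1 (@complex.Im R)); rewrite !ReImE /=; lra.
have P0 : 0 < \prod_(w <- s) nsq (z - w%:C + 0 +i* (2 * rho)).
  by elim/big_ind: _ => //= *; rewrite mulr_gt0.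
rewrite -(ler_pM2r P0); apply: (le_trans (blaschke_prod us HF r0 M0 FM Fs hz)).
rewrite -[leRHS]mulrA ler_wpM2l // -sumrN (big_morph _ (@expRD R) (@expR0 R)) -big_split /=.
apply: ler_prod => w _; rewrite nsq_ge0 /=.
have {1}-> : nsq (z - w%:C) = nsq (z - w%:C + 0 +i* (2 * rho)) *
     (1 - 4 * rho * (Im z + rho) / nsq (z - w%:C + 0 +i* (2 * rho))).
  rewrite mulrBr mulr1 mulrCA divff ?gt_eqF // mulr1 nsq_shift !ReImE /= subr0; ring.
by rewrite mulrC ler_wpM2r ?nsq_ge0 // expR_ge1Dx.
Qed.

(** At a fixed [z] each zero in [0, 1] contributes at least the same [c > 0] to the exponent in
    [blaschke_exp], so arbitrarily many zeros force the value 0. *)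
Lemma entire_identity F (M : R) : entire F ->
  (forall z, -1 <= Im z -> nsq (F z) <= M) ->
  (forall n : nat, exists s : seq R, [/\ uniq s, size s = n &
     forall w : R, w \in s -> 0 <= w <= 1 /\ F w%:C = 0]) ->
  forall z, 0 <= Im z -> F z = 0.
Proof.
move=> HF FM Fs z hz.
have M0 : 0 <= M by apply: le_trans (FM 0 _); rewrite ?nsq_ge0 //= lerN10.
pose D := (`|Re z| + 1) ^+ 2 + (Im z + 2) ^+ 2.
have D0 : 0 < D by rewrite /D ltr_wpDl ?sqr_ge0 // exprn_gt0 //; lra.
pose c := 4 * (Im z + 1) / D.
have c0 : 0 < c by rewrite /c; apply: divr_gt0 => //; lra.
apply/eqP; rewrite -nsq_eq0 eq_le nsq_ge0 andbT leNgt; apply/negP => F0.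
have Mp : 0 < M by apply: lt_le_trans F0 (FM _ _); lra.
pose n := (Num.truncn (M / nsq (F z) / c)).+1.
have [s [us sn Hs]] := Fs n.
have := @blaschke_exp s F 1 M us HF ltr01 M0 FM (fun w ws => (Hs w ws).2) z.
have -> : -1 <= Im z by lra.
move=> /(_ erefl); apply/negP; rewrite -ltNge.
have sumge : n%:R * c <= \sum_(w <- s) 4 * 1 * (Im z + 1) / nsq (z - w%:C + 0 +i* (2 * 1)).
  have -> : n%:R * c = \sum_(w <- s) c.
    by rewrite big_const_seq count_predT iter_addr_0 mulr_natl sn.
  rewrite big_seq [leRHS]big_seq; apply: ler_sum => w ws.
  have [/andP[w0 w1] _] := Hs w ws.
  have nz : nsq (z - w%:C + 0 +i* (2 * 1)) <= D.
    rewrite /nsq !ReImE /D /= addr0 subr0 mulr1 lerD2r.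
    rewrite -[(_ - w) ^+ 2]real_normK ?num_real // lerXn2r ?nnegrE ?addr_ge0 //.
    apply: (le_trans (ler_normB _ _)); rewrite lerD2l ger0_norm //.
  rewrite !mulr1 in nz *; rewrite /c ler_wpM2l //; first by lra.
  rewrite lef_pV2 // posrE; apply: nsq_gt0; apply/eqP => /(congr1 (@complex.Im R)).
  by rewrite !ReImE /=; lra.
have nb : M / nsq (F z) < n%:R * c by rewrite -ltr_pdivrMr // truncnS_gt.
have MF : M < nsq (F z) * (n%:R * c) by rewrite mulrC -ltr_pdivrMr.
rewrite expRN; set S := \sum_(w <- s) _ in sumge *.
rewrite ltr_pdivrMr ?expR_gt0 //; apply: (lt_le_trans MF).
rewrite ler_pM2l //; apply: (le_trans sumge); apply: le_trans (expR_ge1Dx _); lra.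
Qed.

(* The bound [M * (r2 / nsq (z - conjc q)) ^+ m] is assumed on a circle around [q];
   multiplying [F] by the [m]-th power of [(z - conjc q) / (z - q)], of modulus 1 on
   the real line, spreads it to the whole upper half-plane. *)
Lemma disc_bound F q (eta r2 M : R) (m : nat) : entire F -> 0 <= M -> 0 < r2 ->
  Im q = eta -> 0 <= eta ->
  (forall z, 0 <= Im z -> nsq (F z) <= M) ->
  (forall z, nsq (z - q) = r2 -> 0 <= Im z -> nsq (F z) * (nsq (z - conjc q) / r2) ^+ m <= M) ->
  forall z, 0 <= Im z -> r2 <= nsq (z - q) ->
  nsq (F z) <= M * expR (- (m%:R * (4 * eta * Im z / nsq (z - conjc q)))).
Proof.
move=> HF M0 r20 qe e0 FM Fq z hz zq.
pose G z := F z * ((z - conjc q) * (z - q)^-1) ^+ m.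
have cq u : u - conjc q = u - q + 0 +i* (2 * eta).
  by apply: complex_ext; rewrite !ReImE /= -?qe; ring.
have nr u : nsq (u - conjc q) = nsq (u - q) + 4 * eta * Im u.
  by rewrite cq nsq_shift !ReImE qe; ring.
have nG u : nsq (G u) = nsq (F u) * (nsq (u - conjc q) / nsq (u - q)) ^+ m.
  by rewrite /G nsqM nsqX nsqM nsqV.
(* An a priori bound for [half_plane_max]: outside the disc the multiplier has squared modulus at
   most [Q]. *)
pose Q := 2 * (1 + (2 * eta) ^+ 2 / r2).
have := @half_plane_max _ G 0 q r2 M (M * Q ^+ m) M0.
rewrite oppr0 => /(_ _ _ _ z (conj hz zq)) Gz.
have {}Gz : nsq (G z) <= M.
  apply: Gz => u [hu uq].
  - have u0 : u != q.
      by rewrite -subr_eq0 -nsq_eq0 gt_eqF // (lt_le_trans r20).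
    apply: analyticM => //; apply: analyticX; apply: analyticM; last exact: analytic_inv.
    by apply: analyticB; [exact: analytic_id|exact: analytic_cst].
  - have u0 : 0 < nsq (u - q) by apply: lt_le_trans uq.
    rewrite nG; apply: ler_pM; rewrite ?nsq_ge0 ?FM ?exprn_ge0 ?divr_ge0 ?nsq_ge0 //.
    rewrite lerXn2r ?nnegrE ?divr_ge0 ?nsq_ge0 //.
      by rewrite /Q mulr_ge0 ?addr_ge0 ?divr_ge0 ?sqr_ge0 // ltW.
    rewrite ler_pdivrMr // cq; apply: (le_trans (nsqD2 _ _)).
    rewrite [leRHS](_ : _ = 2 * nsq (u - q) + 2 * ((2 * eta) ^+ 2 * (nsq (u - q) / r2))); last by rewrite /Q; ring.
    rewrite lerD2l ler_wpM2l //.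
    rewrite (_ : nsq (0 +i* (2 * eta)) = (2 * eta) ^+ 2); last by rewrite /nsq /=; ring.
    by apply: ler_peMr; rewrite ?sqr_ge0 // ler_pdivlMr // mul1r.
  - case=> h; last by rewrite nG h; apply: Fq.
    rewrite nG (_ : nsq (u - conjc q) = nsq (u - q)); last by rewrite nr h mulr0 addr0.
    rewrite divff; last by rewrite gt_eqF // (lt_le_trans r20).
    by rewrite expr1n mulr1; apply: FM; rewrite h.
have zp : 0 < nsq (z - q) by apply: lt_le_trans zq.
have zc : 0 < nsq (z - conjc q).
  by rewrite nr ltr_wpDr // !mulr_ge0.
have rat : nsq (z - q) / nsq (z - conjc q) <= expR (- (4 * eta * Im z / nsq (z - conjc q))).
  apply: le_trans (expR_ge1Dx _); apply: le_of_eq.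
  have -> : nsq (z - q) = nsq (z - conjc q) - 4 * eta * Im z by rewrite nr addrK.
  by field; rewrite gt_eqF.
have -> : nsq (F z) = nsq (G z) * (nsq (z - q) / nsq (z - conjc q)) ^+ m.
  rewrite nG -mulrA -exprMn mulrACA [_^-1 * _]mulrC mulrACA !divff ?gt_eqF //.
  by rewrite mulr1 expr1n mulr1.
apply: ler_pM; rewrite ?nsq_ge0 ?exprn_ge0 ?divr_ge0 ?nsq_ge0 //.
rewrite -mulrN expRM_natl lerXn2r ?nnegrE ?divr_ge0 ?nsq_ge0 ?expR_ge0 //.
Qed.

End Blaschke.

(** * Uniqueness from the density of zeros *)

Section Levinson.
Variable R : realType.
Implicit Types (z q : R[i]) (F G : R[i] -> R[i]).

(** The count is required at arbitrarily large [r], not at every large [r]: this is what a limsup of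
    [n / omega n] provides. *)
Definition dense_zeros (D : R) F := forall r0 : R, exists2 r : R, r0 <= r &
  exists s : seq R, [/\ uniq s, D * r <= (size s)%:R &
    forall w : R, w \in s -> 0 <= w <= r /\ F w%:C = 0].

Lemma is_derive_atan_sum (s : seq R) (eta x : R) : 0 < eta ->
  is_derive x (1 : R) (fun x => \sum_(w <- s) atan ((x - w) / eta))
    (\sum_(w <- s) eta / ((x - w) ^+ 2 + eta ^+ 2)).
Proof.
move=> e0; elim: s => [|w s IH].
  rewrite big_nil (_ : (fun _ => _) = cst 0); first exact: is_derive_cst.
  by apply/funext => y; rewrite big_nil.
rewrite big_cons (_ : (fun _ => _) = (fun x => atan ((x - w) / eta)) +
    (fun x => \sum_(w <- s) atan ((x - w) / eta))); last first.
  by apply/funext => y; rewrite big_cons.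
apply: is_deriveD; apply: is_derive_eq.
rewrite /GRing.scale /= mulr0 add0r subr0 mulr1.
have h : (x - w) ^+ 2 + eta ^+ 2 != 0.
  by rewrite gt_eqF // ltr_wpDl ?exprn_gt0 ?sqr_ge0.
have -> : 1 + ((x - w) / eta) ^+ 2 = ((x - w) ^+ 2 + eta ^+ 2) / eta ^+ 2.
  by field; rewrite gt_eqF.
by field; rewrite h gt_eqF.
Qed.

(* The right-hand sum is the derivative of [x |-> \sum atan ((x - w) / eta)], whose
   increment over [- e r, r + e r] is at least the left-hand side. *)
Lemma poisson_mvt (s : seq R) (r e eta : R) : 0 < r -> 0 < e -> 0 < eta ->
  (forall w, w \in s -> 0 <= w <= r) ->
  exists2 x : R, `|x| <= r + e * r & (size s)%:R * (2 * atan (e * r / eta)) <=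
     (r + 2 * (e * r)) * \sum_(w <- s) eta / ((x - w) ^+ 2 + eta ^+ 2).
Proof.
move=> r0 e0 eta0 Hs; pose Th x := \sum_(w <- s) atan ((x - w) / eta).
have er : 0 < e * r by rewrite mulr_gt0.
have ab : - (e * r) <= r + e * r by lra.
have cT : {within `[- (e * r), r + e * r], continuous Th}.
  by apply: derivable_within_continuous => t _; case: (is_derive_atan_sum s t eta0).
have [x xab xE] := MVT_segment ab (fun t _ => is_derive_atan_sum s t eta0) cT.
exists x.
  by move: xab; rewrite in_itv /= ler_norml => /andP[h1 h2]; apply/andP; split; lra.
rewrite (_ : r + 2 * (e * r) = r + e * r - - (e * r)); last by ring.
rewrite [leRHS]mulrC -xE.
have -> : (size s)%:R * (2 * atan (e * r / eta)) = \sum_(w <- s) (2 * atan (e * r / eta)).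
  by rewrite big_const_seq count_predT iter_addr_0 mulr_natl.
rewrite /Th -sumrB big_seq [leRHS]big_seq; apply: ler_sum => w ws.
have /andP[w0 wr] := Hs w ws.
have : atan (e * r / eta) <= atan ((r + e * r - w) / eta).
  by apply: le_atan; rewrite ler_pM2r ?invr_gt0 //; lra.
have : atan ((- (e * r) - w) / eta) <= - atan (e * r / eta).
  by rewrite -atanN; apply: le_atan; rewrite ler_pdivrMr // mulNr divfK ?gt_eqF //; lra.
lra.
Qed.

(** [m] is the integer part of [y / ln Q], and rounding a number that is at least 2 loses at most
    half of it. This is the largest power of the multiplier in [disc_bound] that a decay [exp (- y)]
    on the circle can absorb. *)
Lemma mult_exists (y Q : R) : 1 < Q -> 2 * ln Q <= y -> exists2 m : nat, Q ^+ m <= expR y & y / (2 * ln Q) <= m%:R.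
Proof.
move=> Q1 yQ; have lQ : 0 < ln Q by rewrite ln_gt0.
have y0 : 0 <= y / ln Q by rewrite divr_ge0 ?(ltW lQ) //; move: yQ; lra.
exists (Num.truncn (y / ln Q)).
  have Q0 : 0 < Q by apply: lt_trans Q1.
  have : (Num.truncn (y / ln Q))%:R * ln Q <= y.
    by rewrite -ler_pdivlMr //; case/andP: (truncn_itv y0).
  by rewrite -ler_expR expRM_natl lnK.
have := truncnS_gt (y / ln Q); rewrite -natr1.
have -> : y / (2 * ln Q) = (y / ln Q) / 2 by field; rewrite gt_eqF.
have : 2 <= y / ln Q by rewrite ler_pdivlMr.
lra.
Qed.

Section Gain.
(** For zeros in [0, r], [e] sets the margin [e * r] of [poisson_mvt] and the height [e ^+ 2 * r] of
    the centre of the disc, and [k] is the ratio of its radius to that height. [sigma] is the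
    resulting lower bound of the Poisson sum at the centre, tending to [pi * D] as [e] tends to 0;
    [(1 + 3 k) ^+ 2] is the loss from the centre to the circle, and [g] is what remains after the
    growth [a]. On the circle, [|z - conj q|^2] is at most [Q] times the squared radius. *)
Variables (a D e k sigma g Q lam : R).
Hypotheses (a0 : 0 < a) (D0 : 0 < D) (e0 : 0 < e) (e1 : e <= 1) (k0 : 0 < k) (k1 : k <= 1 / 2).
Hypothesis sigmaE : sigma = D * (2 * atan e^-1) / (1 + 2 * e).
Hypothesis gE : g = sigma / (1 + 3 * k) ^+ 2 - a.
Hypothesis g0 : 0 < g.
Hypothesis QE : Q = 2 * (1 + 4 / k ^+ 2).
Hypothesis lamE : lam = 8 * k * g * e ^+ 4 / (13 * ln Q).

Lemma Q_gt1 : 1 < Q.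
Proof.
have : 0 <= 4 / k ^+ 2 by rewrite divr_ge0 ?sqr_ge0.
rewrite QE; lra.
Qed.

Lemma gain_gt0 : 0 < lam.
Proof.
rewrite lamE; have := Q_gt1 => Q1.
by rewrite divr_gt0 ?mulr_gt0 ?exprn_gt0 // ln_gt0.
Qed.

(* The zeros in [0, r] force [F] to be exponentially small on a disc of radius
   comparable to [r] ([poisson_mvt] and [blaschke_exp]); by [disc_bound] this spreads to
   the half-plane as [r] tends to infinity, with a gain [lam] that does not depend on [F]. *)
Lemma gain F (C : R) : entire F -> 0 <= C -> dense_zeros D F ->
  (forall z, 0 <= Im z -> nsq (F z) <= C) ->
  (forall rho z, 0 < rho -> - rho <= Im z -> nsq (F z) <= C * expR (4 * a * rho)) ->
  forall z, 0 <= Im z -> nsq (F z) <= C * expR (- (lam * Im z)).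
Proof.
move=> HF C0 HD FU FL z hz.
have Q1 := Q_gt1; have lQ : 0 < ln Q by rewrite ln_gt0.
(* [r] has to be so large that [z] stays outside the disc, that its distance to [conjc q] is of
   order [r], and that the exponent [4 * rho * g] reaches the [2 * ln Q] needed in [mult_exists]. *)
pose r0 := Num.max (Num.max 1 (`|Re z|)) (Num.max (2 * Im z / e ^+ 2) (2 * ln Q / (4 * k * e ^+ 2 * g))).
have [r r0r [s [us Ds Hs]]] := HD r0.
have [r1 rx ry rQ] : [/\ 1 <= r, `|Re z| <= r, 2 * Im z / e ^+ 2 <= r & 2 * ln Q / (4 * k * e ^+ 2 * g) <= r].
  by move: r0r; rewrite /r0 !ge_max => /andP[/andP[-> ->] /andP[-> ->]].
have rp : 0 < r by lra.
have e20 : 0 < e ^+ 2 by rewrite exprn_gt0.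
have e21 : e ^+ 2 <= 1 by rewrite expr_le1 // ltW.
pose eta := e ^+ 2 * r.
have eta0 : 0 < eta by rewrite mulr_gt0.
have etar : eta <= r by rewrite /eta ler_piMl // ltW.
have yeta : 2 * Im z <= eta by move: ry; rewrite ler_pdivrMr // [r * _]mulrC.
have [x xr xS] := poisson_mvt rp e0 eta0 (fun w ws => (Hs w ws).1).
have xr2 : `|x| <= 2 * r.
  have : e * r <= r by rewrite ler_piMl // ltW.
  lra.
set S := \sum_(w <- s) _ in xS.
have Ssig : sigma <= S.
  rewrite sigmaE ler_pdivrMr; last by rewrite addr_gt0 // mulr_gt0.
  rewrite -(ler_pM2r rp).
  have E1 : e * r / eta = e^-1 by rewrite /eta; field; rewrite !gt_eqF.
  rewrite E1 in xS.
  have at0 : 0 <= 2 * atan e^-1 by rewrite mulr_ge0 // -[leLHS]atan0 le_atan // invr_ge0 ltW.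
  have -> : S * (1 + 2 * e) * r = (r + 2 * (e * r)) * S by ring.
  apply: le_trans xS; rewrite mulrAC; apply: ler_wpM2r => //.
(* [rho] is both the radius of the disc about [q] and the depth below the real axis at which
   [blaschke_exp] is applied. *)
pose q : R[i] := x +i* eta; pose rho := k * eta.
have rho0 : 0 < rho by rewrite mulr_gt0.
have rhoeta : rho <= eta / 2.
  by rewrite /rho mulrC ler_pM2l // -[2^-1]mul1r.
pose r2 := rho ^+ 2; have r20 : 0 < r2 by rewrite exprn_gt0.
pose M := C * expR (4 * a * rho).
have M0 : 0 <= M by rewrite mulr_ge0 ?expR_ge0.
have circ u : nsq (u - q) = r2 -> nsq (F u) <= C * expR (- (4 * rho * g)).
  move=> uq.
  have yu : eta - rho <= Im u.
    have : (Im u - eta) ^+ 2 <= rho ^+ 2.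
      by rewrite -/r2 -uq /nsq !ReImE /= lerDr sqr_ge0.
    move=> sqle; have : `|Im u - eta| <= rho.
      by rewrite -ler_sqr ?nnegrE ?(ltW rho0) // real_normK ?num_real.
    by rewrite ler_norml => /andP[]; lra.
  have hu : - rho <= Im u by lra.
  apply: (le_trans (blaschke_exp us HF rho0 M0 (fun z hz => FL rho z rho0 hz) (fun w ws => (Hs w ws).2) hu)).
  rewrite /M -mulrA -expRD ler_wpM2l // ler_expR.
  have le1 : 4 * rho * (sigma / (1 + 3 * k) ^+ 2) <=
     \sum_(w <- s) 4 * rho * (Im u + rho) / nsq (u - w%:C + 0 +i* (2 * rho)).
    apply: (@le_trans _ _ (4 * rho * (S / (1 + 3 * k) ^+ 2))).
      by rewrite ler_pM2l ?mulr_gt0 // ler_wpM2r // invr_ge0 sqr_ge0.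
    rewrite /S mulr_suml mulr_sumr; apply: ler_sum => w _.
    have qw : nsq (q - w%:C) = (x - w) ^+ 2 + eta ^+ 2 by rewrite /nsq !ReImE /= subr0.
    rewrite -qw.
    have qe : eta ^+ 2 <= nsq (q - w%:C) by rewrite qw lerDr sqr_ge0.
    have qp : 0 < nsq (q - w%:C) by apply: lt_le_trans qe; rewrite exprn_gt0.
    have k3 : 0 < 3 * k by rewrite mulr_gt0.
    (* With the weights 2 and [3 k], [nsqD_le] reproduces the triangle inequality: first
       [rho + 2 rho = 3 k eta], then a total factor [1 + 3 k]. *)
    have vle : nsq ((u - q) + 0 +i* (2 * rho)) <= (3 * k) ^+ 2 * nsq (q - w%:C).
      have two : (0 : R) < 2 by [].
      apply: (le_trans (nsqD_le _ _ two)); rewrite uq /r2.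
      have -> : nsq (0 +i* (2 * rho)) = 4 * rho ^+ 2 by rewrite /nsq /=; ring.
      have -> : (1 + 2) * rho ^+ 2 + (1 + 2^-1) * (4 * rho ^+ 2) = (3 * k) ^+ 2 * eta ^+ 2.
        by rewrite /rho; field.
      by rewrite ler_wpM2l ?sqr_ge0.
    have dle : nsq (u - w%:C + 0 +i* (2 * rho)) <= (1 + 3 * k) ^+ 2 * nsq (q - w%:C).
      have -> : u - w%:C + 0 +i* (2 * rho) = (q - w%:C) + ((u - q) + 0 +i* (2 * rho)) by ring.
      apply: (le_trans (nsqD_le _ _ k3)).
      apply: (@le_trans _ _ ((1 + 3 * k) * nsq (q - w%:C) + (1 + (3 * k)^-1) * ((3 * k) ^+ 2 * nsq (q - w%:C)))).
        rewrite lerD2l ler_wpM2l // addr_ge0 // invr_ge0 ltW //.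
      by apply: le_of_eq; field; rewrite gt_eqF.
    have dp : 0 < nsq (u - w%:C + 0 +i* (2 * rho)).
      apply: nsq_gt0; apply/eqP => /(congr1 (@complex.Im R)); rewrite !ReImE /=; lra.
    have kp : 0 < (1 + 3 * k) ^+ 2 by rewrite exprn_gt0 //; lra.
    rewrite -[leRHS]mulrA ler_pM2l; last by rewrite mulr_gt0.
    apply: (@le_trans _ _ (eta / ((1 + 3 * k) ^+ 2 * nsq (q - w%:C)))).
      by apply: le_of_eq; field; rewrite !gt_eqF //; lra.
    apply: ler_pM; first exact: ltW.
    - by rewrite invr_ge0 mulr_ge0 ?nsq_ge0 ?(ltW kp).
    - by lra.
    - by rewrite lef_pV2 // posrE // mulr_gt0.
  by rewrite gE; lra.
have yg : 2 * ln Q <= 4 * rho * g.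
  move: rQ; rewrite ler_pdivrMr; last by rewrite !mulr_gt0.
  by rewrite /rho /eta (_ : r * (4 * k * e ^+ 2 * g) = 4 * (k * (e ^+ 2 * r)) * g) //; ring.
have [m mQ my] := mult_exists Q1 yg.
have disc := @disc_bound _ F q eta r2 C m HF C0 r20 erefl (ltW eta0) FU _ z hz _.
have qz : r2 <= nsq (z - q).
  apply: (@le_trans _ _ ((eta - Im z) ^+ 2)).
    rewrite /r2 lerXn2r ?nnegrE ?(ltW rho0) //; lra.
  by rewrite /nsq !ReImE /= -[(Im z - eta) ^+ 2]sqrrN opprB lerDr sqr_ge0.
apply: (le_trans (disc _ qz)) => [u uq hu|].
  rewrite mulrC; apply: (@le_trans _ _ (expR (4 * rho * g) * (C * expR (- (4 * rho * g))))).
    apply: ler_pM; rewrite ?nsq_ge0 ?exprn_ge0 ?divr_ge0 ?nsq_ge0 ?(ltW r20) ?circ //.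
    apply: le_trans mQ; rewrite lerXn2r ?nnegrE ?divr_ge0 ?nsq_ge0 ?(ltW r20) //.
      by apply: ltW; apply: lt_trans Q1.
    rewrite ler_pdivrMr // (_ : u - conjc q = (u - q) + 0 +i* (2 * eta)); last first.
      by apply: complex_ext; rewrite !ReImE /=; ring.
    apply: (le_trans (nsqD2 _ _)); rewrite uq QE /r2 /rho.
    have -> : nsq (0 +i* (2 * eta)) = 4 * eta ^+ 2 by rewrite /nsq /=; ring.
    by apply: le_of_eq; field; rewrite gt_eqF.
  by rewrite mulrCA -expRD subrr expR0 mulr1.
rewrite ler_wpM2l // ler_expR lerN2.
(* 13 is 9 + 4: the horizontal distance is at most [3 r] and the vertical one, [Im z + eta], at most
   [2 r]. *)
have nz : nsq (z - conjc q) <= 13 * r ^+ 2.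
  rewrite /nsq !ReImE /=.
  have : (Re z - x) ^+ 2 <= (3 * r) ^+ 2.
    rewrite -[(Re z - x) ^+ 2]real_normK ?num_real // lerXn2r ?nnegrE ?mulr_ge0 ?(ltW rp) //.
    by apply: (le_trans (ler_normB _ _)); lra.
  have : (Im z - - eta) ^+ 2 <= (2 * r) ^+ 2.
    by rewrite lerXn2r ?nnegrE ?mulr_ge0 ?(ltW rp) //; lra.
  lra.
have np : 0 < nsq (z - conjc q).
  by apply: nsq_gt0; apply/eqP => /(congr1 (@complex.Im R)); rewrite !ReImE /=; lra.
apply: (@le_trans _ _ (4 * rho * g / (2 * ln Q) * (4 * eta * Im z / (13 * r ^+ 2)))).
  by apply: le_of_eq; rewrite lamE /rho /eta; field; rewrite !gt_eqF.
apply: ler_pM => //.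
- apply: divr_ge0; last by apply: mulr_ge0 => //; exact: ltW.
  by apply: mulr_ge0; last exact: ltW; apply: mulr_ge0 => //; exact: ltW.
- apply: divr_ge0; last by apply: mulr_ge0 => //; exact: sqr_ge0.
  by apply: mulr_ge0 => //; apply: mulr_ge0 => //; exact: ltW.
- rewrite ler_wpM2l //.
    by apply: mulr_ge0 => //; apply: mulr_ge0 => //; exact: ltW.
  by rewrite lef_pV2 // posrE mulr_gt0 ?exprn_gt0.
Qed.

End Gain.

End Levinson.

Section LevinsonTheorem.
Variable R : realType.
Implicit Types (z q : R[i]) (F G : R[i] -> R[i]).

(** The last quantity tends to [pi * D - a > 0] as [e] and [k] tend to 0. *)
Lemma gain_params (a D : R) : 0 < a -> a < pi * D -> exists e k : R, [/\ 0 < e, e <= 1, 0 < k, k <= 1 / 2 &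
  0 < (D * (2 * atan e^-1) / (1 + 2 * e)) / (1 + 3 * k) ^+ 2 - a].
Proof.
move=> a0 aD; have pi0 : 0 < pi :> R by exact: pi_gt0.
have D0 : 0 < D by rewrite -(pmulr_rgt0 _ pi0); apply: lt_trans aD.
pose th := (a / D + pi) / 2.
have aDp : a / D < pi by rewrite ltr_pdivrMr.
have aDt : a / D < th by rewrite /th; lra.
have thpi : th / 2 < pi / 2 by rewrite /th; lra.
have th0 : 0 < th by apply: lt_trans aDt; rewrite divr_gt0.
have thI : th / 2 \in `](- (pi / 2)), (pi / 2)[ by rewrite in_itv /=; apply/andP; split; lra.
have tan0 : 0 < tan (th / 2).
  rewrite /tan divr_gt0 //; first by apply: sin_gt0_pi; apply/andP; split; lra.
  by apply: cos_gt0_pihalf; apply/andP; split; lra.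
(* [th] lies between [a / D] and [pi], and [e] will make [2 * atan e^-1] at least [th]. Relative to
   [a], the slack of [D * th] is [18 c], which exceeds the loss in [(1 + 9 k) (1 + 2 e)] when [k]
   and [e] are at most [c]. *)
pose c := (th * D / a - 1) / 18.
have c0 : 0 < c.
  rewrite /c divr_gt0 // subr_gt0 ltr_pdivlMr // mul1r.
  by move: aDt; rewrite ltr_pdivrMr.
pose e := Num.min 1 (Num.min c (tan (th / 2))^-1).
pose k := Num.min (1 / 2) (Num.min c (1 / 3)).
have [e0 [e1 [ec et]]] : 0 < e /\ e <= 1 /\ e <= c /\ e <= (tan (th / 2))^-1.
  split; first by rewrite /e !lt_min ltr01 c0 invr_gt0 tan0.
  by have : e <= e by []; rewrite {2}/e !le_min => /andP[-> /andP[-> ->]].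
have [k0 [k1 [kc k3]]] : 0 < k /\ k <= 1 / 2 /\ k <= c /\ k <= 1 / 3.
  split; first by rewrite /k !lt_min c0 !divr_gt0.
  by have : k <= k by []; rewrite {2}/k !le_min => /andP[-> /andP[-> ->]].
exists e, k; split=> //; rewrite subr_gt0.
have K0 : 0 < 1 + 3 * k by rewrite addr_gt0 // mulr_gt0.
have E0 : 0 < 1 + 2 * e by rewrite addr_gt0 // mulr_gt0.
rewrite ltr_pdivlMr ?exprn_gt0 // ltr_pdivlMr //.
have ate : th / 2 <= atan e^-1.
  rewrite -(tanK thI); apply: le_atan.
  by rewrite -[tan _]invrK lef_pV2 // posrE invr_gt0.
apply: (@lt_le_trans _ _ (D * th)); last first.
  by rewrite ler_pM2l //; move: ate; lra.
have -> : D * th = a * (1 + 18 * c) by rewrite /c; field; rewrite gt_eqF.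
rewrite -mulrA ltr_pM2l //.
have k9 : (1 + 3 * k) ^+ 2 <= 1 + 9 * k.
  have : k * k <= k * (1 / 3) by rewrite ler_pM2l.
  rewrite sqrrD expr1n mul1r exprMn expr2; lra.
apply: (@le_lt_trans _ _ ((1 + 9 * k) * (1 + 2 * e))).
  by rewrite ler_pM2r.
have : k * e <= 1 / 3 * e by rewrite ler_pM2r.
clear -k0 e0 kc ec c0; clearbody k e c; lra.
Qed.

(* [H z * cexp (i a z)] is bounded in the upper half-plane; [gain] applies
   repeatedly, so its modulus is at most [exp (- n lam Im z)] for every [n]. *)
Lemma levinson H (C a D : R) : entire H -> 0 < a -> a < pi * D ->
  (forall z, nsq (H z) <= C * expR (2 * a * `|Im z|)) -> dense_zeros D H ->
  forall x : R, H x%:C = 0.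
Proof.
move=> HH a0 aD HC Hd.
have C0 : 0 <= C by have := HC 0; rewrite /= normr0 mulr0 expR0 mulr1; apply: le_trans; exact: nsq_ge0.
have D0 : 0 < D by rewrite -(pmulr_rgt0 _ (pi_gt0 R)); apply: lt_trans aD.
have [e [k [e0 e1 k0 k1 g0]]] := gain_params a0 aD.
pose Q := 2 * (1 + 4 / k ^+ 2).
pose g := (D * (2 * atan e^-1) / (1 + 2 * e)) / (1 + 3 * k) ^+ 2 - a.
pose lam := 8 * k * g * e ^+ 4 / (13 * ln Q).
have lam0 : 0 < lam := gain_gt0 e0 k0 g0 erefl erefl.
pose E (t : R) z := cexp ('i * t%:C * z).
have nE t z : nsq (E t z) = expR (- (2 * t * Im z)).
  by rewrite /E nsq_cexp !ReImE /=; congr expR; ring.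
(* The last factor cancels the decay obtained after [n] steps, so [F n] is again bounded by [C] and
   [gain] applies with the same [lam]. *)
pose F (n : nat) z := H z * E a z * E (- (lam * n%:R / 2)) z.
have nF n z : nsq (F n z) = nsq (H z) * expR (- (2 * a * Im z)) * expR (lam * n%:R * Im z).
  by rewrite /F !nsqM !nE; congr (_ * expR _); field.
have HF n : entire (F n).
  by move=> z; apply: analyticM; [apply: analyticM => //|]; exact: analytic_cexp.
have FD n : dense_zeros D (F n).
  move=> r0; have [r r0r [s [us Ds Hs]]] := Hd r0; exists r => //; exists s; split=> // w ws.
  by have [h1 h2] := Hs w ws; rewrite /F h2 !mul0r.
have FU n z : 0 <= Im z -> nsq (F n z) <= C.
  elim: n z => [|n IH] z hz.
    rewrite nF mulr0 mul0r expR0 mulr1 expRN ler_pdivrMr ?expR_gt0 //.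
    by have := HC z; rewrite (ger0_norm hz).
  (* Below the real axis the growth rate counts twice, once from [H] and once from [E a], while the
     last factor has modulus at most 1. *)
  have FL (rho : R) (u : R[i]) : 0 < rho -> - rho <= Im u -> nsq (F n u) <= C * expR (4 * a * rho).
    move=> rho0 hu; have [u0|u0] := leP 0 (Im u).
      by apply: (le_trans (IH _ u0)); rewrite ler_peMr // -expR0 ler_expR !mulr_ge0 // ltW.
    rewrite nF; have := HC u; rewrite (ltr0_norm u0) => Hu.
    have e2 : expR (lam * n%:R * Im u) <= 1.
      by rewrite -expR0 ler_expR mulr_ge0_le0 ?(ltW u0) // mulr_ge0 // ltW.
    apply: (@le_trans _ _ (nsq (H u) * expR (- (2 * a * Im u)))).
      by rewrite ler_piMr // mulr_ge0 ?nsq_ge0 ?expR_ge0.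
    apply: (@le_trans _ _ (C * expR (2 * a * - Im u) * expR (- (2 * a * Im u)))).
      by rewrite ler_wpM2r ?expR_ge0.
    rewrite -mulrA -expRD ler_wpM2l // ler_expR.
    have : a * (- Im u) <= a * rho by rewrite ler_pM2l //; move: hu; lra.
    lra.
  have := gain e0 e1 k0 k1 erefl erefl g0 erefl erefl (HF n) C0 (FD n) IH FL hz.
  rewrite -/g -/Q -/lam !nF => Gz.
  rewrite -[n.+1%:R]natr1 mulrDr mulr1 mulrDl expRD mulrA -[leRHS](mulr1 C) -[X in C * X]expR0.
  rewrite -(addNr (lam * Im z)) expRD mulrA ler_pM2r ?expR_gt0 //.
have H0 z : 0 < Im z -> H z = 0.
  move=> hz; apply/eqP; rewrite -nsq_eq0 eq_le nsq_ge0 andbT leNgt; apply/negP => Hz.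
  pose c := nsq (H z) * expR (- (2 * a * Im z)).
  have c0 : 0 < c by rewrite mulr_gt0 ?expR_gt0.
  pose n := (Num.truncn (C / c / (lam * Im z))).+1.
  have lz : 0 < lam * Im z by rewrite mulr_gt0.
  have := FU n z (ltW hz); rewrite nF -/c; apply/negP; rewrite -ltNge.
  have : C / c < n%:R * (lam * Im z) by rewrite -ltr_pdivrMr // truncnS_gt.
  rewrite ltr_pdivrMr // => h; apply: (lt_le_trans h); rewrite mulrC ler_pM2l //.
  apply: le_trans (expR_ge1Dx _).
  have -> : lam * n%:R * Im z = n%:R * (lam * Im z) by ring.
  lra.
(* Vanishing in the open half-plane passes to the real axis by the local Lipschitz bound. *)
move=> x; apply/eqP; rewrite -n1_eq0 eq_le n1_ge0 andbT; apply/ler_addgt0Pr => eps eps0.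
have [L [d [L0 d0 HL]]] := analytic_lip (HH x%:C).
pose t := Num.min (d / 2) (eps / (L + 1)).
have L1 : 0 < L + 1 by rewrite ltr_wpDl.
have t0 : 0 < t by rewrite /t lt_min; apply/andP; split; rewrite divr_gt0.
have [td te] : t < d /\ t <= eps / (L + 1).
  have : t <= t by []; rewrite {2}/t le_min => /andP[h1 h2]; split=> //.
  by apply: (le_lt_trans h1); lra.
have tn : n1 (0 +i* t : R[i]) = t by rewrite /n1 /= normr0 add0r gtr0_norm.
have := HL (0 +i* t); rewrite tn => /(_ td).
rewrite H0; last by rewrite !ReImE /= add0r.
rewrite sub0r n1N => h; rewrite add0r; apply: (le_trans h).
apply: (@le_trans _ _ (t * (L + 1))); first by rewrite mulrDr mulr1 mulrC lerDl ltW.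
by rewrite -ler_pdivlMr.
Qed.

End LevinsonTheorem.

(** * Lebesgue integration of complex-valued functions *)

Section ComplexIntegral.
Variable R : realType.
Local Notation mu := (@lebesgue_measure R).
Local Notation rint := (fun f : R -> R => mu.-integrable [set: R] (fun x => (f x)%:E)).
Local Notation RI f := (Rintegral mu [set: R] f).
Implicit Types (f g F k : R -> R[i]) (c : R[i]).

Lemma aeS (P Q : R -> Prop) : (forall x, P x -> Q x) ->
  {ae mu, forall x, P x} -> {ae mu, forall x, Q x}.
Proof. by move=> PQ; exact: (@filterS _ _ (ae_filter_ringOfSetsType mu)). Qed.

Lemma aeI (P Q : R -> Prop) :
  {ae mu, forall x, P x} -> {ae mu, forall x, Q x} -> {ae mu, forall x, P x /\ Q x}.
Proof. exact: (@filterI _ _ (ae_filter_ringOfSetsType mu)). Qed.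

Lemma ae_all (P : R -> Prop) : (forall x, P x) -> {ae mu, forall x, P x}.
Proof. by move=> HP; apply: (@aeS (fun _ => True)) => //; exact: (@filterT _ _ (ae_filter_ringOfSetsType mu)). Qed.

Definition cmeasurable F : Prop :=
  measurable_fun [set: R] (fun x => Re (F x)) /\ measurable_fun [set: R] (fun x => Im (F x)).

Lemma cintegrable_meas F : cintegrable F -> cmeasurable F.
Proof.
by case=> /measurable_int /measurable_EFinP h1 /measurable_int /measurable_EFinP h2; split.
Qed.

Lemma cmeasurable_cst c : cmeasurable (fun _ => c).
Proof. by split; exact: measurable_cst. Qed.

Lemma cmeasurableD f g : cmeasurable f -> cmeasurable g -> cmeasurable (fun x => f x + g x).
Proof.
move=> [f1 f2] [g1 g2]; split.
  by under eq_fun do rewrite cReD; exact: measurable_funD.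
by under eq_fun do rewrite cImD; exact: measurable_funD.
Qed.

Lemma cmeasurableM f g : cmeasurable f -> cmeasurable g -> cmeasurable (fun x => f x * g x).
Proof.
move=> [f1 f2] [g1 g2]; split.
  under eq_fun do rewrite cReM.
  by apply: measurable_funB; exact: measurable_funM.
under eq_fun do rewrite cImM.
by apply: measurable_funD; exact: measurable_funM.
Qed.

Lemma cmeasurableJ f : cmeasurable f -> cmeasurable (fun x => conjc (f x)).
Proof.
move=> [f1 f2]; split; first by under eq_fun do rewrite cReJ.
under eq_fun do rewrite cImJ.
exact: measurableT_comp.
Qed.

Lemma cmeasurableN f : cmeasurable f -> cmeasurable (fun x => - f x).
Proof.
move=> [f1 f2]; split; [under eq_fun do rewrite cReN|under eq_fun do rewrite cImN];
exact: measurableT_comp.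
Qed.

Lemma cmeasurableB f g : cmeasurable f -> cmeasurable g -> cmeasurable (fun x => f x - g x).
Proof. by move=> hf hg; apply: cmeasurableD => //; exact: cmeasurableN. Qed.

Lemma cmeasurableX f n : cmeasurable f -> cmeasurable (fun x => f x ^+ n).
Proof.
move=> hf; elim: n => [|n IH]; first exact: cmeasurable_cst.
by under eq_fun do rewrite exprS; exact: cmeasurableM.
Qed.

Lemma cmeasurable_comp f (u : R -> R) : measurable_fun [set: R] u -> cmeasurable f ->
  cmeasurable (fun x => f (u x)).
Proof.
move=> hu [f1 f2]; split.
  exact: (measurableT_comp f1 hu).
exact: (measurableT_comp f2 hu).
Qed.

Lemma cmeasurableC (u : R -> R) : measurable_fun [set: R] u -> cmeasurable (fun x => (u x)%:C).
Proof. by move=> hu; split => //=; exact: measurable_cst. Qed.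

Lemma cmeasurable_cexp F : cmeasurable F -> cmeasurable (fun x => cexp (F x)).
Proof.
move=> [f1 f2]; split => /=; apply: measurable_funM.
- exact: (measurableT_comp (@measurable_expR R) f1).
- by apply: (measurableT_comp _ f2); apply: continuous_measurable_fun; exact: continuous_cos.
- exact: (measurableT_comp (@measurable_expR R) f1).
- by apply: (measurableT_comp _ f2); apply: continuous_measurable_fun; exact: continuous_sin.
Qed.

Lemma measurable_subr (t : R) : measurable_fun [set: R] (fun x => x - t).
Proof. by apply: measurable_funB; [exact: measurable_id|exact: measurable_cst]. Qed.

Lemma measurable_mull (a : R) : measurable_fun [set: R] (fun x => a * x).
Proof. by apply: measurable_funM; [exact: measurable_cst|exact: measurable_id]. Qed.

Lemma measurable_mulr (a : R) : measurable_fun [set: R] (fun x => x * a).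
Proof. by apply: measurable_funM; [exact: measurable_id|exact: measurable_cst]. Qed.

Lemma cmeasurable_n1 F : cmeasurable F -> measurable_fun [set: R] (fun x => n1 (F x)).
Proof. by move=> [f1 f2]; apply: measurable_funD; exact: measurableT_comp. Qed.

Lemma cintegrable_n1 F : cintegrable F -> rint (fun x => n1 (F x)).
Proof.
move=> [f1 f2].
have := @integrableD _ _ _ mu setT measurableT _ _ (integrable_norm f1) (integrable_norm f2).
by [].
Qed.

Lemma rint_le (f g : R -> R) : measurable_fun [set: R] f -> (forall x, `|f x| <= g x) -> rint g -> rint f.
Proof.
move=> mf fg; apply: le_integrable => //; first exact/measurable_EFinP.
by move=> x _ /=; rewrite lee_fin; apply: (le_trans (fg x)); exact: ler_norm.
Qed.

Lemma cintegrable_le F (g : R -> R) : cmeasurable F -> (forall x, n1 (F x) <= g x) -> rint g ->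
  cintegrable F.
Proof.
move=> [f1 f2] Fg ig; split; apply: (rint_le _ _ ig) => // x.
  by apply: le_trans (Fg x); exact: Re_le_n1.
by apply: le_trans (Fg x); exact: Im_le_n1.
Qed.

Lemma rintZ (g : R -> R) a : rint g -> rint (fun x => g x * a).
Proof.
move=> ig; have := @integrableZl _ _ _ mu setT measurableT a _ ig.
by apply: eq_integrable => // x _ /=; rewrite -EFinM mulrC.
Qed.

Lemma cintegrableM F k M : cintegrable F -> cmeasurable k -> (forall x, n1 (k x) <= M) ->
  cintegrable (fun x => F x * k x).
Proof.
move=> hF hk kM; apply: (@cintegrable_le _ (fun x => n1 (F x) * M)).
- by apply: cmeasurableM => //; exact: cintegrable_meas.
- by move=> x; apply: (le_trans (n1M _ _)); rewrite ler_wpM2l ?n1_ge0.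
- exact/rintZ/cintegrable_n1.
Qed.

Lemma cintegrableZ F c : cintegrable F -> cintegrable (fun x => F x * c).
Proof.
by move=> hF; apply: (@cintegrableM _ _ (n1 c)) => //; exact: cmeasurable_cst.
Qed.

Lemma cintegrableD f g : cintegrable f -> cintegrable g -> cintegrable (fun x => f x + g x).
Proof.
move=> [f1 f2] [g1 g2]; split.
  have := @integrableD _ _ _ mu setT measurableT _ _ f1 g1.
  by apply: eq_integrable => // x _ /=; rewrite cReD.
have := @integrableD _ _ _ mu setT measurableT _ _ f2 g2.
by apply: eq_integrable => // x _ /=; rewrite cImD.
Qed.

Lemma cintegrableN f : cintegrable f -> cintegrable (fun x => - f x).
Proof.
move=> /(cintegrableZ (-1)); congr cintegrable.
by apply/funext => x; rewrite mulrN1.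
Qed.

Lemma cintegrableB f g : cintegrable f -> cintegrable g -> cintegrable (fun x => f x - g x).
Proof. by move=> hf hg; apply: cintegrableD => //; exact: cintegrableN. Qed.

Lemma cintegrableJ f : cintegrable f -> cintegrable (fun x => conjc (f x)).
Proof.
move=> hf; apply: (@cintegrable_le _ (fun x => n1 (f x))).
- by apply: cmeasurableJ; exact: cintegrable_meas.
- by move=> x; rewrite n1J.
- exact: cintegrable_n1.
Qed.

Lemma cintegrable0 : cintegrable (fun _ : R => 0 : R[i]).
Proof. by split; exact: integrable0. Qed.

Lemma cintegrable_sum (I : Type) (r : seq I) (f : I -> R -> R[i]) :
  (forall i, cintegrable (f i)) -> cintegrable (fun x => \sum_(i <- r) f i x).
Proof.
move=> hf; elim: r => [|i r IH].
  by under eq_fun do rewrite big_nil; exact: cintegrable0.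
by under eq_fun do rewrite big_cons; exact: cintegrableD.
Qed.

Lemma cintegralD f g : cintegrable f -> cintegrable g ->
  cintegral (fun x => f x + g x) = cintegral f + cintegral g.
Proof.
move=> [f1 f2] [g1 g2]; apply: complex_ext; rewrite !ReImE /=.
  by under eq_Rintegral do rewrite cReD; rewrite RintegralD.
by under eq_Rintegral do rewrite cImD; rewrite RintegralD.
Qed.

Lemma cintegralZ f c : cintegrable f -> cintegral (fun x => f x * c) = cintegral f * c.
Proof.
move=> [f1 f2]; apply: complex_ext; rewrite !ReImE /=.
  under eq_Rintegral do rewrite cReM.
  by rewrite RintegralB ?RintegralZr //; [exact: (rintZ (Re c) f1)|exact: (rintZ (Im c) f2)].
under eq_Rintegral do rewrite cImM.
by rewrite RintegralD ?RintegralZr //; [exact: (rintZ (Im c) f1)|exact: (rintZ (Re c) f2)].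
Qed.

Lemma cintegral0 : cintegral (fun _ : R => 0 : R[i]) = 0.
Proof.
by rewrite /cintegral /= /Rintegral /= integral0.
Qed.

Lemma cintegralB f g : cintegrable f -> cintegrable g ->
  cintegral (fun x => f x - g x) = cintegral f - cintegral g.
Proof.
move=> hf hg; rewrite -[in RHS](mulrN1 (cintegral g)) -cintegralZ // -cintegralD //; last exact: cintegrableZ.
by congr cintegral; apply/funext => x; rewrite mulrN1.
Qed.

Lemma cintegral_sum (I : Type) (r : seq I) (f : I -> R -> R[i]) :
  (forall i, cintegrable (f i)) ->
  cintegral (fun x => \sum_(i <- r) f i x) = \sum_(i <- r) cintegral (f i).
Proof.
move=> hf; elim: r => [|i r IH].
  by under [in LHS]eq_fun do rewrite big_nil; rewrite big_nil cintegral0.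
under [in LHS]eq_fun do rewrite big_cons; rewrite big_cons cintegralD ?IH //.
exact: cintegrable_sum.
Qed.

Lemma cintegralJ f : cintegrable f -> cintegral (fun x => conjc (f x)) = conjc (cintegral f).
Proof.
move=> [f1 f2]; apply: complex_ext; rewrite !ReImE /=.
  by under eq_Rintegral do rewrite cReJ.
under eq_Rintegral do rewrite cImJ -mulN1r.
by rewrite RintegralZl // mulN1r.
Qed.

Lemma n1_cintegral f (g : R -> R) : cintegrable f -> rint g -> (forall x, n1 (f x) <= g x) ->
  n1 (cintegral f) <= RI g.
Proof.
move=> hf ig fg; have [f1 f2] := hf.
apply: (@le_trans _ _ (RI (fun x => n1 (f x)))); last first.
  by apply: le_Rintegral => //; exact: cintegrable_n1.
rewrite /n1 /= RintegralD //; [|exact: integrable_norm|exact: integrable_norm].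
by apply: lerD; apply: le_normr_Rintegral.
Qed.

Lemma Rintegral_ae (f g : R -> R) : rint f -> rint g -> {ae mu, forall x, f x = g x} -> RI f = RI g.
Proof.
move=> fi gi fg; congr fine; apply: ae_eq_integral => //.
- exact: (measurable_int _ fi).
- exact: (measurable_int _ gi).
- by apply: aeS fg => x /= -> _.
Qed.

Lemma cintegral_ae f g : cintegrable f -> cintegrable g -> {ae mu, forall x, f x = g x} ->
  cintegral f = cintegral g.
Proof.
move=> [f1 f2] [g1 g2] fg; congr (_ +i* _); apply: Rintegral_ae => //;
by apply: aeS fg => x /= ->.
Qed.

Definition ccvg (u : nat -> R[i]) (l : R[i]) : Prop := (n1 (u n - l)) @[n --> \oo] --> (0 : R).

Lemma Rintegral_dct0 (h : nat -> R -> R) (g : R -> R) : (forall n, measurable_fun [set: R] (h n)) ->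
  rint g -> (forall n x, `|h n x| <= g x) ->
  {ae mu, forall x, h n x @[n --> \oo] --> (0 : R)} ->
  RI (h n) @[n --> \oo] --> (0 : R).
Proof.
move=> mh ig hg hc.
have [] := @dominated_convergence _ _ R mu setT measurableT (fun n x => (h n x)%:E) (cst 0%E) (fun x => (g x)%:E).
- by move=> n; apply/measurable_EFinP; exact: mh.
- exact: measurable_cst.
- by apply: aeS hc => x hx _ /=; apply: cvg_EFin; [exact: nearW|exact: hx].
- exact: ig.
- by apply: ae_all => x n _ /=; rewrite lee_fin.
move=> _ _ hlim; rewrite integral_cst // mul0e in hlim.
exact: (fine_cvg hlim).
Qed.

(** Convergence is asked only where [F] does not vanish, since the approximating trigonometric
    polynomials used later converge to the desired kernel only on the window. *)
Lemma cintegral_dct F (k : nat -> R -> R[i]) (k0 : R -> R[i]) M : cintegrable F ->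
  (forall n, cmeasurable (k n)) -> cmeasurable k0 ->
  (forall n x, n1 (k n x) <= M) -> (forall x, n1 (k0 x) <= M) ->
  {ae mu, forall x, F x = 0 \/ ccvg (fun n => k n x) (k0 x)} ->
  ccvg (fun n => cintegral (fun x => F x * k n x)) (cintegral (fun x => F x * k0 x)).
Proof.
move=> hF mk mk0 kM k0M hc.
have hn n : cintegrable (fun x => F x * k n x) by apply: (cintegrableM hF (mk n) (kM n)).
have h0 : cintegrable (fun x => F x * k0 x) by apply: (cintegrableM hF mk0 k0M).
pose h n x := n1 (F x) * n1 (k n x - k0 x).
have mh n : measurable_fun [set: R] (h n).
  apply: measurable_funM; first exact: (cmeasurable_n1 (cintegrable_meas hF)).
  by apply: cmeasurable_n1; apply: cmeasurableB; [exact: mk|exact: mk0].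
have hb n x : `|h n x| <= n1 (F x) * (M + M).
  rewrite /h ger0_norm ?mulr_ge0 ?n1_ge0 // ler_wpM2l ?n1_ge0 //.
  by apply: (le_trans (n1B _ _)); rewrite lerD.
have gi : rint (fun x => n1 (F x) * (M + M)) := rintZ _ (cintegrable_n1 hF).
have ih n : rint (h n) := rint_le (mh n) (hb n) gi.
have := @Rintegral_dct0 h _ mh gi hb.
have : {ae mu, forall x, h n x @[n --> \oo] --> (0 : R)}.
  apply: aeS hc => x [Fx|kx]; rewrite /h.
    by rewrite Fx n10; under eq_fun do rewrite mul0r; exact: cvg_cst.
  by rewrite -[0](mulr0 (n1 (F x))); apply: cvgM => //; exact: cvg_cst.
move=> hh /(_ hh); rewrite /ccvg => hlim.
apply: (@squeeze_cvgr _ _ _ _ (cst 0) (fun n => RI (h n))) => //; last exact: cvg_cst.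
apply: nearW => n; rewrite n1_ge0 /= -cintegralB //; apply: n1_cintegral => //.
  exact: cintegrableB.
by move=> x; rewrite -mulrBr; exact: n1M.
Qed.

Lemma ccvg_unique u l l' : ccvg u l -> ccvg u l' -> l = l'.
Proof.
move=> h h'; apply/eqP; rewrite -subr_eq0 -n1_eq0 eq_le n1_ge0 andbT.
have : (n1 (u n - l) + n1 (u n - l')) @[n --> \oo] --> (0 + 0 : R) by exact: cvgD.
rewrite addr0 => hs.
apply: (@ler_cvg_to _ _ _ _ (fun _ => n1 (l - l')) _ _ _ _ hs); first exact: cvg_cst.
apply: nearW => n.
have -> : l - l' = (u n - l') - (u n - l) by move: (u n) => v; ring.
by apply: (le_trans (n1B _ _)); rewrite addrC.
Qed.

Lemma ccvg_cst c : ccvg (fun _ => c) c.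
Proof. by rewrite /ccvg; under eq_fun do rewrite subrr n10; exact: cvg_cst. Qed.

End ComplexIntegral.

(** * Reflections and translations of the line *)

Section Reflection.
Variable R : realType.
Local Notation mu := (@lebesgue_measure R).
Implicit Types (f g F k : R -> R[i]) (c a t : R).

(** A translation is the composition of two reflections, so the change of variables is proved for
    reflections only. *)
Definition refl c : measurableTypeR R -> measurableTypeR R := fun x : R => c - x.

Lemma measurable_refl c : measurable_fun [set: measurableTypeR R] (refl c).
Proof. by apply: measurable_funB; [exact: measurable_cst|exact: measurable_id]. Qed.

(** The image measure gives every interval its length, which characterises Lebesgue measure. *)
Lemma lebesgue_refl c (A : set (measurableTypeR R)) : measurable A ->
  mu (refl c @^-1` A) = mu A.
Proof.
move=> mA; apply/esym.
apply: (@lebesgue_measure_unique _ (pushforward mu (refl c))) => //.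
  exact: measurable_refl.
move=> _ /= mr [[a b]] _ <-.
rewrite /pushforward (_ : refl c @^-1` _ = `[c - b, c - a[%classic); last first.
  apply/seteqP; split=> x; rewrite /refl /= !in_itv /= => /andP[h1 h2]; apply/andP; split; lra.
rewrite !lebesgue_measure_itv /= !lte_fin.
rewrite (_ : (c - b < c - a) = (a < b)); last by rewrite ltrD2l ltrN2.
by case: ifP => // _; rewrite -!EFinB; congr EFin; ring.
Qed.

Lemma ae_refl c (P : R -> Prop) : {ae mu, forall x, P x} -> {ae mu, forall x, P (c - x)}.
Proof.
move=> [A [mA A0 PA]]; exists (refl c @^-1` A); split.
- by rewrite -[X in measurable X]setTI; exact: measurable_refl.
- by rewrite lebesgue_refl.
- by move=> x /=; exact: PA.
Qed.

Lemma ae_shift t (P : R -> Prop) : {ae mu, forall x, P x} -> {ae mu, forall x, P (x + t)}.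
Proof.
move=> /(ae_refl t) /(ae_refl 0); apply: aeS => x.
by rewrite sub0r opprK addrC.
Qed.

Lemma integral_refl c (f : R -> \bar R) : measurable_fun [set: R] f ->
  (forall x, (0 <= f x)%E) -> (\int[mu]_x f (c - x)%R = \int[mu]_x f x)%E.
Proof.
move=> mf f0.
have := @ge0_integral_pushforward _ _ _ _ R (refl c) (measurable_refl c) mu setT f measurableT mf (fun y _ => f0 y).
rewrite preimage_setT => <-.
apply: eq_measure_integral => [|? A mA _]; [exact: measurable_refl|exact: lebesgue_refl].
Qed.

Lemma rint_refl c (f : R -> R) : mu.-integrable [set: R] (fun x => (f x)%:E) ->
  mu.-integrable [set: R] (fun x => (f (c - x))%:E).
Proof.
move=> /integrableP[mf fi]; apply/integrableP; split.
  exact: (measurableT_comp mf (measurable_refl c)).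
rewrite (@integral_refl c (fun x => `|(f x)%:E|%E)) //.
exact: measurableT_comp.
Qed.

Lemma Rintegral_refl c (f : R -> R) : mu.-integrable [set: R] (fun x => (f x)%:E) ->
  Rintegral mu [set: R] (fun x => f (c - x)) = Rintegral mu [set: R] f.
Proof.
move=> fi; have fr := rint_refl c fi; congr fine.
have := @integral_pushforward _ _ _ _ R (refl c) (measurable_refl c) mu setT (fun x => (f x)%:E).
rewrite preimage_setT => /(_ (measurable_int _ fi) fr measurableT) /= <-.
apply: eq_measure_integral => [|? A mA _]; [exact: measurable_refl|exact: lebesgue_refl].
Qed.

Lemma cintegrable_refl c f : cintegrable f -> cintegrable (fun x => f (c - x)).
Proof. by move=> [f1 f2]; split; [exact: (rint_refl c f1)|exact: (rint_refl c f2)]. Qed.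

Lemma cintegral_refl c f : cintegrable f -> cintegral (fun x => f (c - x)) = cintegral f.
Proof. by move=> [f1 f2]; congr (_ +i* _); [exact: (Rintegral_refl c f1)|exact: (Rintegral_refl c f2)]. Qed.

Lemma cintegrable_shift t f : cintegrable f -> cintegrable (fun x => f (x + t)).
Proof.
move=> /(cintegrable_refl t)/(cintegrable_refl 0); congr cintegrable.
by apply/funext => x; congr f; ring.
Qed.

Lemma cintegral_shift t f : cintegrable f -> cintegral (fun x => f (x + t)) = cintegral f.
Proof.
move=> hf; rewrite -(cintegral_refl t hf) -(cintegral_refl 0 (cintegrable_refl t hf)).
by congr cintegral; apply/funext => x; congr f; ring.
Qed.

End Reflection.

Section Localization.
Variable R : realType.
Local Notation mu := (@lebesgue_measure R).
Implicit Types (f g F k : R -> R[i]) (c a t : R).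

Definition cindic (A : set R) : R -> R[i] := fun x => (\1_A x)%:C.

Lemma cmeasurable_indic (A : set R) : measurable A -> cmeasurable (cindic A).
Proof. by move=> mA; apply: cmeasurableC; exact: measurable_indic. Qed.

Lemma n1_indic (A : set R) x : n1 (cindic A x) <= 1.
Proof. by rewrite n1C /indic; case: (_ \in _); rewrite /= ?normr1 ?normr0. Qed.

(** By the Lebesgue differentiation theorem, [f x] is almost everywhere the limit of the averages of
    [f] over balls about [x]; for [x] in [U] these averages are eventually 0. *)
Lemma rint_zero_ae (f : R -> R) (U : R -> Prop) : mu.-integrable [set: R] (fun x => (f x)%:E) ->
  (forall x, U x -> exists2 d : R, 0 < d & forall r, 0 < r < d ->
     Rintegral mu [set: R] (fun y => f y * \1_(`]x - r, x + r[%classic : set R) y) = 0) ->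
  {ae mu, forall x, U x -> f x = 0}.
Proof.
move=> fi H.
have fl : locally_integrable [set: R] f.
  by apply: open_integrable_locally => //; exact: openT.
have := lebesgue_differentiation fl.
apply: aeS => x Lx Ux; have [d d0 Hd] := H _ Ux.
pose E (y : R) (n : nat) : set R := ball y n.+1%:R^-1.
have p0 n : (0 : R) < n.+1%:R^-1 by rewrite invr_gt0.
have hE y : nicely_shrinking y (E y).
  split; first by move=> n; exact: measurable_ball.
  exists (1, fun n => PosNum (p0 n)); split=> //=.
  - exact: cvg_harmonic.
  - by move=> n z.
  - by move=> n; rewrite mul1e.
have := nice_lebesgue_differentiation hE fl Lx.
suff -> : (fun n => ((mu (E x n))^-1 * \int[mu]_(y in E x n) (f y)%:E)%E) =
   (fun n => if n.+1%:R^-1 < d then 0%E else ((mu (E x n))^-1 * \int[mu]_(y in E x n) (f y)%:E)%E).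
  move=> hc; have : ((fun _ : nat => 0%E) : nat -> \bar R) @ \oo --> (f x)%:E.
    apply: cvg_trans hc; apply: near_eq_cvg.
    have [N _ HN] := near_infty_natSinv_lt (PosNum d0).
    by exists N => // n /HN /= ->.
  by move=> /(cvg_unique _ (cvg_cst (0%E : \bar R)))-/(_ (@ereal_hausdorff R)) [].
apply/funext => n; case: ifP => // nd.
have n0 : 0 < n.+1%:R^-1 :> R by rewrite invr_gt0.
have mB : measurable (E x n) by exact: measurable_ball.
have Ei : mu.-integrable (E x n) (EFin \o f) by apply: integrableS fi.
have := Hd n.+1%:R^-1; rewrite n0 nd => /(_ erefl) H0.
rewrite -[X in (_ * X)%E]fineK; last exact: integrable_fin_num.
rewrite [fine _](_ : _ = 0) ?mule0 //.
rewrite -[LHS]/(Rintegral mu (E x n) f) Rintegral_mkcond -[RHS]H0.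
congr (Rintegral mu setT _); apply/funext => y.
rewrite /E ball_itv patchE indicE; case: (_ \in _); by rewrite ?mulr1 ?mulr0.
Qed.

End Localization.

(** * Trigonometric polynomials *)

Section Trig.
Variable R : realType.
Implicit Types (x th c : R) (tau : R -> R[i]).

Definition ei x : R[i] := cexp (0 +i* x).

Lemma eiD x y : ei (x + y) = ei x * ei y.
Proof. by rewrite /ei -cexpD; congr cexp; apply: complex_ext; rewrite !ReImE /= ?addr0. Qed.
Lemma ei0 : ei 0 = 1. Proof. by rewrite /ei cexp0. Qed.
Lemma eiJ x : conjc (ei x) = ei (- x).
Proof. by rewrite /ei cexpJ. Qed.
Lemma nsq_ei x : nsq (ei x) = 1.
Proof. by rewrite nsq_cexp /= mulr0 expR0. Qed.
Lemma n1_ei x : n1 (ei x) <= 2.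
Proof. by apply: (le_trans (n1_cexp _)); rewrite /= expR0 mulr1. Qed.
Lemma cis2pi_ei x : cis2pi x = ei (2 * pi * x).
Proof. by rewrite cis2piE. Qed.

Definition trig tau : Prop := exists s : seq (R[i] * int),
  forall th, tau th = \sum_(q <- s) q.1 * ei (q.2%:~R * th).

Lemma trigD t1 t2 : trig t1 -> trig t2 -> trig (fun th => t1 th + t2 th).
Proof. by move=> [s1 h1] [s2 h2]; exists (s1 ++ s2) => th; rewrite big_cat h1 h2. Qed.

Lemma trigM t1 t2 : trig t1 -> trig t2 -> trig (fun th => t1 th * t2 th).
Proof.
move=> [s1 h1] [s2 h2]; exists [seq (p.1 * q.1, p.2 + q.2) | p <- s1, q <- s2] => th.
rewrite h1 h2 big_distrlr big_allpairs_dep; apply: eq_bigr => p _; apply: eq_bigr => q _ /=.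
by rewrite intrD mulrDl eiD; ring.
Qed.

Lemma trig_cst (a : R[i]) : trig (fun _ => a).
Proof. by exists [:: (a, 0)] => th; rewrite big_seq1 mul0r ei0 mulr1. Qed.

Lemma trigX t n : trig t -> trig (fun th => t th ^+ n).
Proof.
move=> ht; elim: n => [|n IH]; first exact: trig_cst.
by under eq_fun do rewrite exprS; exact: trigM.
Qed.

Lemma trig_sum (I : Type) (r : seq I) (t : I -> R -> R[i]) : (forall i, trig (t i)) ->
  trig (fun th => \sum_(i <- r) t i th).
Proof.
move=> ht; elim: r => [|i r IH]; first by under eq_fun do rewrite big_nil; exact: trig_cst.
by under eq_fun do rewrite big_cons; exact: trigD.
Qed.

Lemma cos_ei x : (cos x)%:C = (ei x + ei (- x)) / 2.
Proof.
rewrite -(rmorph_nat (real_complex R)) -fmorphV.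
by apply: complex_ext; rewrite !ReImE /= expR0 ?cosN ?sinN; field.
Qed.

Lemma sin_ei x : (sin x)%:C = (ei x - ei (- x)) * (0 +i* - (1 / 2)).
Proof.
by apply: complex_ext; rewrite !ReImE /= expR0 ?cosN ?sinN; field.
Qed.

Lemma trig_cos c : trig (fun th => (cos (th - c))%:C).
Proof.
exists [:: (ei (- c) / 2, 1); (ei c / 2, -1)] => th.
rewrite big_cons big_seq1 /= cos_ei mulrNz !mul1r mulN1r opprB eiD [ei (c - th)]eiD; ring.
Qed.

Lemma trig_sin (k : int) : trig (fun th => (sin (k%:~R * th))%:C).
Proof.
exists [:: (0 +i* - (1 / 2), k); (0 +i* (1 / 2), - k)] => th.
rewrite big_cons big_seq1 /= sin_ei mulrNz mulNr.
by apply: complex_ext; rewrite !ReImE /=; ring.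
Qed.

Lemma bernoulli_ge (x : R) n : 0 <= x <= 1 -> 1 - n%:R * x <= (1 - x) ^+ n.
Proof.
move=> /andP[x0 x1]; elim: n => [|n IH]; first by rewrite mul0r subr0 expr0.
rewrite exprS; apply: (@le_trans _ _ ((1 - x) * (1 - n%:R * x))); last by rewrite ler_wpM2l // subr_ge0.
rewrite -natr1; have : 0 <= n%:R * (x * x) by rewrite !mulr_ge0.
lra.
Qed.

Lemma bernoulli_le (x : R) n : 0 <= x <= 1 -> n%:R * x * (1 - x) ^+ n <= 1.
Proof.
move=> /andP[x0 x1].
have h1 : n%:R * x <= (1 + x) ^+ n.
  elim: n => [|n IH]; first by rewrite mul0r.
  have h : 1 <= (1 + x) ^+ n by rewrite exprn_ege1 // lerDl.
  have h' : x <= x * (1 + x) ^+ n by rewrite ler_peMr.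
  by rewrite exprS -natr1; lra.
apply: (@le_trans _ _ ((1 + x) ^+ n * (1 - x) ^+ n)); first by rewrite ler_wpM2r // exprn_ge0 // subr_ge0.
have -> : (1 + x) ^+ n * (1 - x) ^+ n = (1 - x ^+ 2) ^+ n by rewrite -exprMn; congr (_ ^+ _); ring.
have ? : 0 <= x ^+ 2 := sqr_ge0 x.
have ? : x ^+ 2 <= 1 by rewrite expr_le1.
by rewrite exprn_ile1 // ?subr_ge0 // lerBlDr lerDl.
Qed.

(* The polynomials of Brosowski and Deutsch's proof of the Stone-Weierstrass theorem. *)
Lemma step_cvg (w : R) : 0 <= w <= 1 -> w != 1 / 2 ->
  (1 - w ^+ n) ^+ (2 ^ n) @[n --> \oo] --> ((w < 1 / 2)%R%:R : R).
Proof.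
move=> /andP[w0 w1] wh.
have wn n : 0 <= w ^+ n <= 1 by rewrite exprn_ge0 //= exprn_ile1.
have [wlt|wge] := ltP w (1 / 2).
  apply: (@squeeze_cvgr _ _ _ _ (fun n => 1 - (2 * w) ^+ n) (cst 1)); last 2 first.
  - rewrite -[X in _ --> X]subr0; apply: cvgB; first exact: cvg_cst.
    by apply: cvg_expr; rewrite ger0_norm ?mulr_ge0 //; lra.
  - exact: cvg_cst.
  apply: nearW => n; apply/andP; split; last first.
    by have /andP[? ?] := wn n; rewrite exprn_ile1 // ?subr_ge0 // lerBlDr lerDl.
  by apply: le_trans (bernoulli_ge _ (wn n)); rewrite natrX -exprMn.
have {wge wh} wgt : 1 / 2 < w by rewrite lt_neqAle eq_sym wh.
have w20 : 0 < 2 * w by lra.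
apply: (@squeeze_cvgr _ _ _ _ (cst 0) (fun n => ((2 * w)^-1) ^+ n)); last 2 first.
- exact: cvg_cst.
- apply: cvg_expr; rewrite ger0_norm ?invr_ge0 ?(ltW w20) // invf_lt1 //; lra.
apply: nearW => n; have /andP[h0 h1] := wn n; apply/andP; split; first by rewrite exprn_ge0 // subr_ge0.
rewrite exprVn -[leRHS]mul1r ler_pdivlMr ?exprn_gt0 // mulrC.
by have := bernoulli_le (2 ^ n) (wn n); rewrite natrX -exprMn.
Qed.

(** The indicator function of an arc about [c] is a bounded limit of trigonometric polynomials off
    its end points. *)
Lemma trig_arc c (kap : R) : -1 <= kap <= 1 -> exists tau : nat -> R -> R[i],
  [/\ forall n, trig (tau n), forall n th, n1 (tau n th) <= 1 &
    forall th, cos (th - c) != kap -> ccvg (fun n => tau n th) ((kap < cos (th - c))%R%:R)].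
Proof.
move=> /andP[k1 k2].
(* Affine in the cosine, with values in [0, 1], and below 1/2 exactly where the cosine exceeds
   [kap]: the threshold in [step_cvg]. *)
pose w th : R := (1 - (cos (th - c) - kap) / 2) / 2.
have w01 th : 0 <= w th <= 1.
  have := cos_geN1 (th - c); have := cos_le1 (th - c) => h1 h2.
  by rewrite /w; apply/andP; split; lra.
exists (fun n th => ((1 - w th ^+ n) ^+ (2 ^ n))%:C); split.
- move=> n; have tw : trig (fun th => (w th)%:C).
    have -> : (fun th => (w th)%:C) = (fun th => (1 / 2 + kap / 4)%:C + (- (1 / 4))%:C * (cos (th - c))%:C).
      by apply/funext => th; rewrite -rmorphM -rmorphD /w; congr (_%:C); field.
    by apply: trigD; [exact: trig_cst|apply: trigM; [exact: trig_cst|exact: trig_cos]].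
  have -> : (fun th => ((1 - w th ^+ n) ^+ (2 ^ n))%:C) = (fun th => (1 + (-1) * (w th)%:C ^+ n) ^+ (2 ^ n)).
    by apply/funext => th; rewrite rmorphXn rmorphB rmorph1 rmorphXn mulN1r.
  apply: trigX; apply: trigD; first exact: trig_cst.
  by apply: trigM; [exact: trig_cst|exact: trigX].
- move=> n th; have /andP[h0 h1] := w01 th.
  have h : 0 <= w th ^+ n <= 1 by rewrite exprn_ge0 //= exprn_ile1.
  case/andP: h => ? ?.
  by rewrite n1C ger0_norm ?exprn_ge0 ?subr_ge0 // exprn_ile1 ?subr_ge0 // lerBlDr lerDl.
- move=> th hth.
  have wne : w th != 1 / 2.
    by apply: contraNneq hth; rewrite /w => h; apply/eqP; lra.
  have := step_cvg (w01 th) wne.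
  have -> : (w th < 1 / 2) = (kap < cos (th - c)).
    by apply/idP/idP; rewrite /w; lra.
  move=> hc; rewrite /ccvg.
  set b := (_ < _) in hc *.
  have -> : (fun n => n1 (((1 - w th ^+ n) ^+ (2 ^ n))%:C - b%:R)) =
     (fun n => `|(1 - w th ^+ n) ^+ (2 ^ n) - b%:R|).
    by apply/funext => n; rewrite -(rmorph_nat (real_complex R)) -rmorphB n1C.
  by apply/norm_cvg0P; rewrite -(subrr (b%:R : R)); apply: cvgB => //; exact: cvg_cst.
Qed.

End Trig.

(** * Fourier coefficients determine an integrable function *)

Section FourierUnique.
Variable R : realType.
Local Notation mu := (@lebesgue_measure R).
Implicit Types (x t h r c : R) (F : R -> R[i]).

(** The range of [a] may pass [pi] but ends where the next translate of the arc begins. *)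
Lemma cos_arc (rho a : R) : 0 < rho < pi -> `|a| < 2 * pi - rho -> `|a| != rho ->
  cos a != cos rho /\ (cos rho < cos a) = (`|a| < rho).
Proof.
move=> /andP[r0 rp] ar ane.
have -> : cos a = cos `|a| by case: (ger0P a) => // _; rewrite cosN.
move: ar ane (normr_ge0 a); move: `|a| => {}a ar ane a0.
have main b : 0 <= b <= pi -> (cos rho < cos b) = (b < rho).
  by move=> b0; rewrite ltr_cos // in_itv /= ?b0 // (ltW r0) (ltW rp).
have inj b : 0 <= b <= pi -> b != rho -> cos b != cos rho.
  move=> b0; apply: contra_neq; apply: cos_inj; by rewrite in_itv /= ?b0 // (ltW r0) (ltW rp).
have [ap|ap] := leP a pi; first by rewrite main ?a0 // inj ?a0.
have h1 : 0 <= 2 * pi - a <= pi by apply/andP; split; lra.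
have -> : cos a = cos (2 * pi - a).
  by rewrite addrC mulr_natl cosD2pi cosN.
split; first by apply: inj => //; lra.
by rewrite main //; apply/idP/idP; lra.
Qed.

Lemma ae_neq (a : R) : {ae mu, forall x, x != a}.
Proof.
exists [set a]; split; [exact: measurable_set1|exact: lebesgue_measure_set1|].
by move=> x /= /negP; rewrite negbK => /eqP.
Qed.

Lemma cmeasurable_ei (u : R -> R) : measurable_fun [set: R] u -> cmeasurable (fun x => ei (u x)).
Proof. by move=> hu; apply: cmeasurable_cexp; split => //=; exact: measurable_cst. Qed.

Lemma cmeasurable_cis2pi (xi : R) : cmeasurable (fun x : R => cis2pi (- (x * xi))).
Proof.
under eq_fun do rewrite cis2pi_ei; apply: cmeasurable_ei; apply: measurableT_comp (measurable_mull _) _.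
by apply: measurableT_comp => //; exact: measurable_mulr.
Qed.

Lemma n1_cis2pi (x : R) : n1 (cis2pi x) <= 2. Proof. by rewrite cis2pi_ei n1_ei. Qed.

Lemma cmeasurable_trig tau (u : R -> R) : trig tau -> measurable_fun [set: R] u ->
  cmeasurable (fun x => tau (u x)).
Proof.
move=> [s hs] hu; under eq_fun do rewrite hs.
elim: s {hs tau} => [|q s IH]; first by under eq_fun do rewrite big_nil; exact: cmeasurable_cst.
under eq_fun do rewrite big_cons; apply: cmeasurableD => //.
apply: cmeasurableM; first exact: cmeasurable_cst.
by apply: cmeasurable_ei; apply: measurable_funM => //; exact: measurable_cst.
Qed.

Lemma cintegral_trig F (u : R -> R) tau : cintegrable F -> measurable_fun [set: R] u ->
  (forall k : int, cintegral (fun x => F x * ei (k%:~R * u x)) = 0) ->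
  trig tau -> cintegral (fun x => F x * tau (u x)) = 0.
Proof.
move=> hF hu H [s hs].
have hi (k : int) : cintegrable (fun x => F x * ei (k%:~R * u x)).
  apply: (cintegrableM hF _ (fun x => n1_ei _)); apply: cmeasurable_ei.
  by apply: measurable_funM => //; exact: measurable_cst.
have -> : (fun x => F x * tau (u x)) = (fun x => \sum_(q <- s) F x * ei (q.2%:~R * u x) * q.1).
  by apply/funext => x; rewrite hs mulr_sumr; apply: eq_bigr => q _; ring.
rewrite cintegral_sum; last by move=> q; exact: cintegrableZ.
by rewrite big1 // => q _; rewrite cintegralZ // H mul0r.
Qed.

(** Orthogonality to the exponentials extends to trigonometric polynomials and then, by [trig_arc]
    and dominated convergence, to indicator functions of intervals; [rint_zero_ae] concludes. *)
Lemma fourier_unique F t h : 0 < h -> cintegrable F ->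
  {ae mu, forall x, x \notin `[t - h, t + h] -> F x = 0} ->
  (forall k : int, cintegral (fun x => F x * ei (k%:~R * (pi / h * x))) = 0) ->
  {ae mu, forall x, F x = 0}.
Proof.
move=> h0 hF Fs H.
pose u x : R := pi / h * x.
have hu : measurable_fun [set: R] u.
  exact: measurable_mull.
pose U x : Prop := t - h < x < t + h.
(* The slope [pi / h] of [u] makes the window fill one turn of the circle, where the interval about
   [x] is the arc of half-length [pi / h * r] about [u x]. *)
have key x r : U x -> 0 < r < Num.min (x - (t - h)) (t + h - x) ->
    cintegral (fun y => F y * cindic `]x - r, x + r[%classic y) = 0.
  move=> /andP[U1 U2]; rewrite lt_min => /andP[r0 /andP[r1 r2]].
  have hpi : 0 < pi / h :> R by rewrite divr_gt0 // pi_gt0.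
  have kb : -1 <= cos (pi / h * r) <= 1 by rewrite cos_geN1 cos_le1.
  have [tau [htau taub tauc]] := trig_arc (u x) kb.
  have := @cintegral_dct R F (fun n y => tau n (u y)) (cindic `]x - r, x + r[%classic) 1 hF.
  move=> /(_ (fun n => cmeasurable_trig (htau n) hu)) /(_ (cmeasurable_indic (measurable_itv _))).
  move=> /(_ (fun n y => taub n (u y)) (fun y => n1_indic _ y)).
  have -> : (fun n => cintegral (fun y => F y * tau n (u y))) = (fun _ => 0).
    by apply/funext => n; apply: cintegral_trig.
  move=> hc; apply/esym/(ccvg_unique (ccvg_cst 0))/hc.
  have := aeI Fs (aeI (ae_neq (x - r)) (ae_neq (x + r))).
  apply: aeS => y [Fy [y1 y2]].
  have [yI|yI] := boolP (y \in `[t - h, t + h]); last by left; exact: Fy.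
  right; move: yI; rewrite in_itv /= => /andP[z1 z2].
  have hr : r < h by lra.
  have ay : `|u y - u x| = pi / h * `|y - x| by rewrite /u -mulrBr normrM (gtr0_norm hpi).
  have rho : 0 < pi / h * r < pi.
    rewrite mulr_gt0 //= -[ltRHS]mulr1 -mulrA ltr_pM2l ?pi_gt0 //.
    by rewrite mulrC ltr_pdivrMr // mul1r.
  have ar : `|u y - u x| < 2 * pi - pi / h * r.
    rewrite ay ltrBrDr -mulrDr.
    have -> : 2 * pi = pi / h * (2 * h) :> R by field; rewrite gt_eqF.
    rewrite ltr_pM2l //; have : `|y - x| < 2 * h - r by rewrite ltr_norml; apply/andP; split; lra.
    lra.
  have ane : `|u y - u x| != pi / h * r.
    rewrite ay; apply/eqP => /(mulfI (lt0r_neq0 hpi)) hyx.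
    move: y1 y2; have [yx|yx] := leP x y.
      by rewrite ger0_norm ?subr_ge0 // in hyx; move=> _ /eqP; apply; lra.
    by rewrite ltr0_norm ?subr_lt0 // in hyx; move=> /eqP + _; apply; lra.
  have [cne ceq] := cos_arc rho ar ane.
  have := tauc (u y) cne; congr ccvg.
  rewrite /cindic indicE ceq ay ltr_pM2l //.
  rewrite (_ : (y \in (`]x - r, x + r[%classic : set R)) = (`|y - x| < r)) ?rmorph_nat //.
  apply/idP/idP; rewrite inE /= in_itv /= ltr_norml => /andP[? ?]; apply/andP; split; lra.
have cU x : U x -> exists2 d : R, 0 < d & forall r, 0 < r < d ->
    cintegral (fun y => F y * cindic `]x - r, x + r[%classic y) = 0.
  move=> Ux; exists (Num.min (x - (t - h)) (t + h - x)); last by move=> r; exact: key.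
  by case/andP: Ux => ? ?; rewrite lt_min !subr_gt0; apply/andP.
have AR : {ae mu, forall x, U x -> Re (F x) = 0}.
  apply: rint_zero_ae; first by case: hF.
  move=> x Ux; have [d d0 Hd] := cU x Ux; exists d => // r hr.
  have := congr1 (@complex.Re R) (Hd r hr); rewrite /= => <-.
  by apply: eq_Rintegral => y _; rewrite cReM /= mulr0 subr0.
have AI : {ae mu, forall x, U x -> Im (F x) = 0}.
  apply: rint_zero_ae; first by case: hF.
  move=> x Ux; have [d d0 Hd] := cU x Ux; exists d => // r hr.
  have := congr1 (@complex.Im R) (Hd r hr); rewrite /= => <-.
  by apply: eq_Rintegral => y _; rewrite cImM /= mulr0 add0r.
have := aeI (aeI AR AI) (aeI Fs (aeI (ae_neq (t - h)) (ae_neq (t + h)))).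
apply: aeS => x [[hR hI] [hFs [x1 x2]]].
have [xI|xI] := boolP (x \in `[t - h, t + h]); last exact: hFs.
have Ux : U x.
  by move: xI; rewrite in_itv /= => /andP[? ?]; rewrite /U !lt_neqAle eq_sym x1 x2; apply/andP.
by apply: complex_ext; rewrite ?hR ?hI.
Qed.

End FourierUnique.

(** * Real frequencies as limits of integer frequencies *)

Section Sawtooth.
Variable R : realType.
Implicit Types (x th c r : R) (N : nat).

(** The imaginary part of a Taylor polynomial of [log (1 + z)] at [z = r exp (i th)]; [dsaw] is its
    derivative in [r]. *)
Definition saw N r th : R := \sum_(k < N) (-1) ^+ k * (r ^+ k.+1 / k.+1%:R) * sin (k.+1%:R * th).
Definition dsaw N r th : R := \sum_(k < N) (-1) ^+ k * r ^+ k * sin (k.+1%:R * th).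

(** Multiplication by [|1 + r exp (i th)|^2] telescopes the sum, by the three-term recurrence for
    the sines of multiples of [th]. *)
Lemma dsawE N r th : dsaw N r th * (1 + 2 * r * cos th + r ^+ 2) =
  sin th - (-1) ^+ N * r ^+ N * (sin (N.+1%:R * th) + r * sin (N%:R * th)).
Proof.
elim: N => [|N IH].
  by rewrite /dsaw big_ord0 !expr0 !mul1r !mul0r sin0 mulr0 addr0 subrr.
rewrite /dsaw big_ord_recr /= -/(dsaw N r th) mulrDl IH.
have -> : sin (N.+2%:R * th) = 2 * cos th * sin (N.+1%:R * th) - sin (N%:R * th).
  have -> : N.+2%:R * th = N.+1%:R * th + th by rewrite -[N.+2%:R]natr1 mulrDl mul1r.
  have -> : N%:R * th = N.+1%:R * th - th by rewrite -[N.+1%:R]natr1 mulrDl mul1r addrK.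
  by rewrite sinD sinB; ring.
rewrite !exprS; ring.
Qed.

Lemma is_derive_saw N th r : is_derive r (1 : R) (fun r => saw N r th) (dsaw N r th).
Proof.
elim: N => [|N IH].
  rewrite /dsaw big_ord0 (_ : (fun _ => _) = cst 0); first exact: is_derive_cst.
  by apply/funext => y; rewrite /saw big_ord0.
rewrite /dsaw big_ord_recr /= -/(dsaw N r th).
set C := (-1) ^+ N * sin (N.+1%:R * th) / N.+1%:R.
rewrite (_ : (fun _ => _) = (fun r => saw N r th) + (fun r => r ^+ N.+1 * C)); last first.
  apply/funext => y; transitivity (saw N y th + y ^+ N.+1 * C); last by [].
  by rewrite /saw big_ord_recr /= /C; congr (_ + _); ring.
apply: is_deriveD.
rewrite (_ : (fun _ => _) = (id ^+ N.+1) * cst C); last first.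
  by apply/funext => t; rewrite /GRing.mul /= exprfctE.
apply: is_derive_eq (is_deriveM (is_deriveX N.+1 (is_derive_id r 1)) (is_derive_cst C r 1)) _.
rewrite /GRing.scale /= mulr0 add0r mulr1 /C.
by field; rewrite nat1r.
Qed.

Lemma is_derive_atan_shift th r : sin th != 0 ->
  is_derive r (1 : R) (fun r => atan ((r + cos th) / sin th)) (sin th / (1 + 2 * r * cos th + r ^+ 2)).
Proof.
move=> s0; apply: is_derive_eq.
have D : 1 + 2 * r * cos th + r ^+ 2 = sin th ^+ 2 + (r + cos th) ^+ 2.
  by have := cos2Dsin2 th; lra.
have D0 : sin th ^+ 2 + (r + cos th) ^+ 2 != 0.
  by rewrite gt_eqF // ltr_pwDl ?sqr_ge0 // exprn_even_gt0.
rewrite D /GRing.scale /= ?mulr0 ?addr0 ?add0r ?mulr1.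
have -> : 1 + ((r + cos th) / sin th) ^+ 2 = (sin th ^+ 2 + (r + cos th) ^+ 2) / sin th ^+ 2.
  by field.
by field; rewrite s0 D0.
Qed.

(** The difference of arctangents is the argument of [1 + r exp (i th)]. It agrees with [saw] at
    [r = 0], and the derivatives in [r] differ by the tail of a geometric series. *)
Lemma saw_atan N th r : sin th != 0 -> 0 <= r < 1 ->
  `|saw N r th - (atan ((r + cos th) / sin th) - atan (cos th / sin th))| <= 2 * r ^+ N / (1 - r) ^+ 2.
Proof.
move=> s0 /andP[r0 r1].
pose f s := saw N s th - atan ((s + cos th) / sin th).
pose df s := dsaw N s th - sin th / (1 + 2 * s * cos th + s ^+ 2).
have fd s : is_derive s (1 : R) f (df s).
  by apply: is_deriveB; [exact: is_derive_saw|exact: is_derive_atan_shift].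
have fc : {within `[0, r], continuous f}.
  by apply: derivable_within_continuous => t _; case: (fd t).
have [c cr fE] := MVT_segment r0 (fun t _ => fd t) fc.
have saw0 : saw N 0 th = 0.
  by rewrite /saw big1 // => k _; rewrite expr0n /= mul0r mulr0 mul0r.
have -> : saw N r th - (atan ((r + cos th) / sin th) - atan (cos th / sin th)) = f r - f 0.
  by rewrite /f saw0 !add0r; ring.
rewrite fE subr0 normrM (ger0_norm r0).
apply: (@le_trans _ _ (`|df c|)); first by rewrite ler_piMr // ltW.
move: cr; rewrite in_itv /= => /andP[c0 cr].
have c1 : c < 1 by apply: le_lt_trans r1.
have Dge : (1 - c) ^+ 2 <= 1 + 2 * c * cos th + c ^+ 2.
  have : 0 <= c * (1 + cos th) by rewrite mulr_ge0 //; have := cos_geN1 th; lra.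
  lra.
have D0 : 0 < 1 + 2 * c * cos th + c ^+ 2.
  by apply: lt_le_trans Dge; rewrite exprn_gt0 // subr_gt0.
have -> : df c = - ((-1) ^+ N * c ^+ N * (sin (N.+1%:R * th) + c * sin (N%:R * th))) / (1 + 2 * c * cos th + c ^+ 2).
  apply: (@mulIf _ (1 + 2 * c * cos th + c ^+ 2)); first by rewrite gt_eqF.
  by rewrite /df mulrBl dsawE !divfK ?gt_eqF //; ring.
have cN0 : 0 <= c ^+ N by rewrite exprn_ge0.
rewrite normrM normrN normrM normrM normrX normrN1 expr1n mul1r (ger0_norm cN0) [`|_^-1|]gtr0_norm ?invr_gt0 //.
have sl : `|sin (N.+1%:R * th) + c * sin (N%:R * th)| <= 2.
  apply: (le_trans (ler_normD _ _)); rewrite normrM (ger0_norm c0).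
  have h1 : `|sin (N.+1%:R * th)| <= 1 by rewrite ler_norml sin_geN1 sin_le1.
  have h2 : `|sin (N%:R * th)| <= 1 by rewrite ler_norml sin_geN1 sin_le1.
  have : c * `|sin (N%:R * th)| <= 1 * 1 by rewrite ler_pM // ltW.
  lra.
apply: ler_pM; rewrite ?mulr_ge0 ?invr_ge0 ?(ltW D0) //.
  by rewrite mulrC ler_pM // lerXn2r ?nnegrE.
rewrite lef_pV2 ?posrE ?exprn_gt0 ?subr_gt0 //; apply: le_trans Dge.
by rewrite lerXn2r ?nnegrE ?subr_ge0 ?(ltW r1) ?(ltW c1) //; lra.
Qed.

Lemma saw_odd N r th : saw N r (- th) = - saw N r th.
Proof.
by rewrite /saw -sumrN; apply: eq_bigr => k _; rewrite mulrN sinN mulrN.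
Qed.

Lemma saw_sin0 N r th : sin th = 0 -> saw N r th = 0.
Proof.
move=> s0; rewrite /saw big1 // => k _.
have -> : sin (k.+1%:R * th) = 0; last by rewrite mulr0.
elim: {k}(k.+1) => [|k IH]; first by rewrite mul0r sin0.
by rewrite -natr1 mulrDl mul1r sinD IH s0 mul0r mulr0 addr0.
Qed.

Lemma trig_saw N r : trig (fun th => (saw N r th)%:C).
Proof.
have -> : (fun th => (saw N r th)%:C) = (fun th => \sum_(k < N) ((-1) ^+ k * (r ^+ k.+1 / k.+1%:R))%:C * (sin ((k.+1 : int)%:~R * th))%:C).
  by apply/funext => th; rewrite /saw rmorph_sum; apply: eq_bigr => k _; rewrite -rmorphM.
by apply: trig_sum => k; apply: trigM; [exact: trig_cst|exact: trig_sin].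
Qed.

(* The Abel means of the Fourier series of the sawtooth: bounded trigonometric
   polynomials converging to the identity on ]-pi, pi[. *)
Lemma saw_seq : exists p : nat -> R -> R, exists2 M : R, 0 <= M &
  [/\ forall n, trig (fun th => (p n th)%:C), forall n th, `|p n th| <= M &
    forall th, `|th| < pi -> p n th @[n --> \oo] --> th].
Proof.
pose r n : R := 1 - n.+2%:R^-1.
have r01 n : 0 <= r n < 1.
  rewrite /r subr_ge0 invf_le1 ?ltr0n // ler1n /= ltrBlDr ltrDl invr_gt0 ltr0n //.
have rE n : r n = 1 - n.+2%:R^-1 by [].
clearbody r.
(* The Abel parameter [r n] is fixed first; the truncation order is then chosen to make the
   remainder at most [1 / (n + 1)]. *)
have exN n : exists N, 2 * r n ^+ N / (1 - r n) ^+ 2 <= n.+1%:R^-1.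
  have /andP[r0 r1] := r01 n.
  have hc : r n ^+ N @[N --> \oo] --> (0 : R) by apply: cvg_expr; rewrite ger0_norm.
  pose e := n.+1%:R^-1 * (1 - r n) ^+ 2 / 2.
  have e0 : 0 < e by rewrite divr_gt0 // mulr_gt0 ?invr_gt0 ?exprn_gt0 ?subr_gt0.
  move/cvgrPdist_le : hc => /(_ e e0) [N _ HN].
  exists N; have := HN N (leqnn N); rewrite /= sub0r normrN ger0_norm ?exprn_ge0 // => h.
  rewrite ler_pdivrMr ?exprn_gt0 ?subr_gt0 //.
  by move: h; rewrite /e ler_pdivlMr // mulrC.
have [N HN] := choice exN.
(* As [r n] tends to 1 the sum tends to the argument of [1 + exp (i th)], which is [th / 2]; hence
   the factor 2. In the bound, [pi] comes from the difference of arctangents and 1 from the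
   remainder. *)
exists (fun n th => 2 * saw (N n) (r n) th), (2 * (pi + 1)).
  by rewrite mulr_ge0 // addr_ge0 // pi_ge0.
have inv1 n : (n.+1%:R^-1 : R) <= 1 by rewrite invf_le1 ?ltr0n // ler1n.
split.
- move=> n; under eq_fun do rewrite rmorphM.
  by apply: trigM; [exact: trig_cst|exact: trig_saw].
- move=> n th; rewrite normrM (ger0_norm (ler0n _ _)) ler_pM2l //.
  have [s0|s0] := eqVneq (sin th) 0.
    by rewrite saw_sin0 // normr0 addr_ge0 // pi_ge0.
  have := le_trans (saw_atan (N n) s0 (r01 n)) (HN n).
  have := atan_ltpi2 ((r n + cos th) / sin th); have := atan_gtNpi2 ((r n + cos th) / sin th).
  have := atan_ltpi2 (cos th / sin th); have := atan_gtNpi2 (cos th / sin th).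
  have := inv1 n; rewrite !ler_norml => h1 h2 h3 h4 h5 /andP[h6 h7].
  move: (n.+1%:R^-1) h1 h6 h7 => q h1 h6 h7.
  by apply/andP; split; lra.
have rc : r n @[n --> \oo] --> (1 : R).
  rewrite (_ : r = fun n => 1 - (harmonic n.+1 : R)); last exact/funext.
  rewrite -[X in _ --> X]subr0; apply: cvgB; first exact: cvg_cst.
  by rewrite (cvg_shiftS (harmonic : nat -> R)); exact: cvg_harmonic.
have pos th : 0 < th < pi -> 2 * saw (N n) (r n) th @[n --> \oo] --> th.
  move=> /andP[t0 tp].
  have sp : 0 < sin th by apply: sin_gt0_pi; rewrite t0.
  have s0 : sin th != 0 by rewrite gt_eqF.
  have A0 : atan (cos th / sin th) = pi / 2 - th.
    have I0 : pi / 2 - th \in `](- (pi / 2)), (pi / 2)[ by rewrite in_itv /=; apply/andP; split; lra.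
    rewrite -[RHS](tanK I0); congr atan; rewrite /tan.
    rewrite sinB cosB sin_pihalf cos_pihalf; by rewrite !mul0r !mul1r subr0 add0r.
  have A1 : atan ((1 + cos th) / sin th) = pi / 2 - th / 2.
    have I0 : pi / 2 - th / 2 \in `](- (pi / 2)), (pi / 2)[ by rewrite in_itv /=; apply/andP; split; lra.
    rewrite -[RHS](tanK I0); congr atan; rewrite /tan.
    rewrite sinB cosB sin_pihalf cos_pihalf !mul0r !mul1r subr0 add0r.
    have h2 : th = th / 2 + th / 2 by field.
    have sh : sin (th / 2) != 0.
      by rewrite gt_eqF // sin_gt0_pi //; apply/andP; split; lra.
    have sE : sin th = 2 * sin (th / 2) * cos (th / 2) by rewrite {1}h2 sinD; ring.
    have cE : 1 + cos th = 2 * cos (th / 2) ^+ 2.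
      by rewrite {1}h2 cosD; have := cos2Dsin2 (th / 2); lra.
    have ch : cos (th / 2) != 0.
      by rewrite gt_eqF // cos_gt0_pihalf //; apply/andP; split; lra.
    by rewrite sE cE; field; rewrite sh ch.
  have Ac : atan ((r n + cos th) / sin th) @[n --> \oo] --> pi / 2 - th / 2.
    rewrite -A1; apply: continuous_cvg; first exact: continuous_atan.
    apply: cvgM; last exact: cvg_cst.
    apply: cvgD; last exact: cvg_cst.
    exact: rc.
  have hc : saw (N n) (r n) th @[n --> \oo] --> (pi / 2 - th / 2) - (pi / 2 - th).
    apply: (@squeeze_cvgr _ _ _ _
      (fun n => atan ((r n + cos th) / sin th) - (pi / 2 - th) - harmonic n)
      (fun n => atan ((r n + cos th) / sin th) - (pi / 2 - th) + harmonic n)).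
    - apply: nearW => n; have := le_trans (saw_atan (N n) s0 (r01 n)) (HN n).
      rewrite A0 ler_norml /harmonic /=; move: (n.+1%:R^-1) => q /andP[h1 h2].
      by apply/andP; split; lra.
    - rewrite -[X in _ --> X]subr0; apply: cvgB; last exact: cvg_harmonic.
      by apply: cvgB => //; exact: cvg_cst.
    - rewrite -[X in _ --> X]addr0; apply: cvgD; last exact: cvg_harmonic.
      by apply: cvgB => //; exact: cvg_cst.
  have {2}-> : th = 2 * ((pi / 2 - th / 2) - (pi / 2 - th)) by field.
  by apply: cvgM; first exact: cvg_cst.
move=> th tp.
have [t0|t0|->] := ltgtP th 0.
- have -> : (fun n => 2 * saw (N n) (r n) th) = (fun n => - (2 * saw (N n) (r n) (- th))).
    by apply/funext => n; rewrite saw_odd mulrN opprK.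
  rewrite -[X in _ --> X]opprK; apply: cvgN; apply: pos.
  by rewrite oppr_gt0 t0 -(ltr0_norm t0).
- by apply: pos; rewrite t0 -(gtr0_norm t0).
- by under eq_fun do rewrite saw_sin0 ?sin0 // mulr0; exact: cvg_cst.
Qed.

Lemma n1_le_mul (u v a b : R[i]) :
  n1 (u * v - a * b) <= n1 (u - a) * (n1 (v - b) + n1 b) + n1 a * n1 (v - b).
Proof.
have -> : u * v - a * b = (u - a) * v + a * (v - b) by ring.
apply: (le_trans (n1D _ _)); apply: lerD; apply: (le_trans (n1M _ _)); rewrite ler_wpM2l ?n1_ge0 //.
by apply: le_trans (n1D _ _); rewrite subrK.
Qed.

Lemma ccvgM (u v : nat -> R[i]) a b : ccvg u a -> ccvg v b -> ccvg (fun n => u n * v n) (a * b).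
Proof.
move=> ha hb.
apply: (@squeeze_cvgr _ _ _ _ (cst 0) (fun n => n1 (u n - a) * (n1 (v n - b) + n1 b) + n1 a * n1 (v n - b))).
- by apply: nearW => n; rewrite n1_ge0 n1_le_mul.
- exact: cvg_cst.
rewrite (_ : 0 = 0 * (0 + n1 b) + n1 a * 0 :> R); last by rewrite mul0r mulr0 addr0.
apply: cvgD.
  by apply: cvgM => //; apply: cvgD => //; exact: cvg_cst.
by apply: cvgM => //; exact: cvg_cst.
Qed.

Lemma ccvgX (u : nat -> R[i]) a k : ccvg u a -> ccvg (fun n => u n ^+ k) (a ^+ k).
Proof.
move=> ha; elim: k => [|k IH]; first exact: ccvg_cst.
under eq_fun do rewrite exprS; rewrite exprS; exact: ccvgM.
Qed.

Lemma ccvg_ei (x : nat -> R) l : x n @[n --> \oo] --> l -> ccvg (fun n => ei (x n)) (ei l).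
Proof.
move=> hx.
have h1 : `|cos (x n) - cos l| @[n --> \oo] --> (0 : R).
  apply/norm_cvg0P; rewrite -(subrr (cos l)); apply: cvgB; last exact: cvg_cst.
  by apply: continuous_cvg => //; exact: continuous_cos.
have h2 : `|sin (x n) - sin l| @[n --> \oo] --> (0 : R).
  apply/norm_cvg0P; rewrite -(subrr (sin l)); apply: cvgB; last exact: cvg_cst.
  by apply: continuous_cvg => //; exact: continuous_sin.
rewrite /ccvg (_ : (fun n => _) = (fun n => `|cos (x n) - cos l| + `|sin (x n) - sin l|)); last first.
  by apply/funext => n; rewrite /n1 !ReImE /= expR0 !mul1r.
by rewrite -[X in _ --> X]addr0; apply: cvgD.
Qed.

(* For real [nu], [ei (nu * th)] is not a trigonometric polynomial on the circle, but it is a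
   bounded pointwise limit of such on ]-pi, pi[: compose [saw_seq] with the Taylor
   polynomials of the exponential. *)
Lemma trig_ei (nu : R) : exists tau : nat -> R -> R[i], exists M : R,
  [/\ forall n, trig (tau n), forall n th, n1 (tau n th) <= M &
    forall th, `|th| < pi -> ccvg (fun n => tau n th) (ei (nu * th))].
Proof.
have [p [M M0 [pt pb pc]]] := saw_seq.
(* Dividing [nu] by [K] brings the argument of the exponential below 1/4 in [n1], where the bound of
   [cexp_taylor1] decreases like [(1 / 2) ^+ n]; the [K]-th power restores [nu]. *)
pose K := (Num.truncn (4 * (`|nu| * M))).+1.
have K0 : (0 : R) < K%:R by rewrite ltr0n.
pose c := nu / K%:R.
have cM : `|c| * M <= 1 / 4.
  rewrite /c normrM (ger0_norm (_ : 0 <= K%:R^-1)) ?invr_ge0 ?ler0n //.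
  rewrite mulrAC ler_pdivrMr //.
  have := truncnS_gt (4 * (`|nu| * M)); rewrite -/K; lra.
pose w n th : R[i] := (0 +i* c) * (p n th)%:C.
have wE n th : w n th = 0 +i* (c * p n th) by apply: complex_ext; rewrite !ReImE /=; ring.
have wb n th : n1 (w n th) <= 1 / 4.
  rewrite wE /n1 /= normr0 add0r normrM; apply: le_trans cM.
  by rewrite ler_wpM2l.
have err n th : n1 (ei (c * p n th) - csum n (w n th)) <= 2 * expR (1 / 4) * (1 / 2) ^+ n.
  rewrite /ei -wE; apply: (le_trans (cexp_taylor1 _ _)).
  rewrite exprS -!mulrA ler_pM2l // mulrA -exprMn mulrC.
  apply: ler_pM; rewrite ?expR_ge0 ?exprn_ge0 ?mulr_ge0 ?n1_ge0 ?ler_expR //.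
  rewrite lerXn2r ?nnegrE ?mulr_ge0 ?n1_ge0 //; have := wb n th; lra.
exists (fun n th => csum n (w n th) ^+ K), ((2 + 2 * expR (1 / 4)) ^+ K); split.
- move=> n; apply: trigX; apply: trig_sum => k; apply: trigM; last exact: trig_cst.
  by apply: trigX; apply: trigM; [exact: trig_cst|exact: pt].
- move=> n th; apply: (le_trans (n1X _ _)).
  rewrite lerXn2r ?nnegrE ?n1_ge0 ?addr_ge0 ?mulr_ge0 ?expR_ge0 //.
  have -> : csum n (w n th) = ei (c * p n th) - (ei (c * p n th) - csum n (w n th)) by ring.
  apply: (le_trans (n1B _ _)); apply: lerD; first exact: n1_ei.
  apply: (le_trans (err n th)); rewrite ler_piMr ?mulr_ge0 ?expR_ge0 //.
  by rewrite exprn_ile1 //; lra.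
- move=> th /pc hp.
  have -> : ei (nu * th) = ei (c * th) ^+ K.
    rewrite /ei -cexpMn; congr cexp.
    have -> : 0 +i* (c * th) *+ K = (K%:R)%:C * (0 +i* (c * th)).
      by rewrite rmorph_nat mulr_natl.
    by apply: complex_ext; rewrite !ReImE /=; [ring|rewrite /c; field; rewrite gt_eqF].
  apply: ccvgX.
  have h1 : ccvg (fun n => ei (c * p n th)) (ei (c * th)).
    by apply: ccvg_ei; apply: cvgM => //; exact: cvg_cst.
  apply: (@squeeze_cvgr _ _ _ _ (cst 0) (fun n => n1 (ei (c * p n th) - ei (c * th)) + 2 * expR (1 / 4) * (1 / 2) ^+ n)).
  + apply: nearW => n; rewrite n1_ge0 /=.
    have -> : csum n (w n th) - ei (c * th) = (ei (c * p n th) - ei (c * th)) - (ei (c * p n th) - csum n (w n th)) by ring.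
    by apply: (le_trans (n1B _ _)); rewrite lerD2l.
  + exact: cvg_cst.
  + rewrite -[X in _ --> X]addr0 -[X in _ --> _ + X](mulr0 (2 * expR (1 / 4))).
    apply: cvgD => //; apply: cvgM; first exact: cvg_cst.
    by apply: cvg_expr; rewrite ger0_norm; lra.
Qed.

End Sawtooth.

(** * Fourier-Laplace transforms and sampling *)

Section FourierLaplace.
Variable R : realType.
Local Notation mu := (@lebesgue_measure R).
Local Notation RI f := (Rintegral mu [set: R] f).
Implicit Types (c : R -> R) (z w h a : R[i]).

(* The phase [c] is a bounded function so that the transform is entire whatever [F]
   is; for [F] supported in [t - B, t + B] it will be [x - t] truncated to [- B, B]. *)
Definition fker c z (x : R) : R[i] := cexp ((0 +i* (- (2 * pi * c x))) * z).
Definition FL (F : R -> R[i]) c z : R[i] := cintegral (fun x => F x * fker c z x).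

Section Kernel.
Variables (c : R -> R) (B : R).
Hypotheses (mc : measurable_fun [set: R] c) (cB : forall x, `|c x| <= B).
Let A := 2 * pi * B.

Let d x : R[i] := 0 +i* (- (2 * pi * c x)).

Lemma kernel_B_ge0 : 0 <= B.
Proof. exact: le_trans (normr_ge0 _) (cB 0). Qed.

Lemma kernel_exponent_ge0 : 0 <= A.
Proof. by rewrite /A !mulr_ge0 ?pi_ge0 ?kernel_B_ge0. Qed.

Lemma n1_d x : n1 (d x) <= A.
Proof.
rewrite /n1 /d /= normr0 add0r normrN normrM ger0_norm ?mulr_ge0 ?pi_ge0 //.
by rewrite /A ler_wpM2l ?mulr_ge0 ?pi_ge0.
Qed.

Lemma cmeasurable_d : cmeasurable d.
Proof.
split => /=; first exact: measurable_cst.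
apply: measurableT_comp => //; apply: measurable_funM => //; exact: measurable_cst.
Qed.

Lemma cmeasurable_fker z : cmeasurable (fker c z).
Proof.
apply: cmeasurable_cexp; apply: cmeasurableM; first exact: cmeasurable_d.
exact: cmeasurable_cst.
Qed.

Lemma n1_fker z x : n1 (fker c z x) <= 2 * expR (A * `|Im z|).
Proof.
apply: (le_trans (n1_cexp _)); rewrite ler_pM2l // ler_expR !ReImE /= mul0r sub0r mulNr opprK.
apply: (le_trans (ler_norm _)); rewrite normrM ler_wpM2r //.
rewrite normrM ger0_norm ?mulr_ge0 ?pi_ge0 //.
by rewrite /A ler_wpM2l ?mulr_ge0 ?pi_ge0.
Qed.

Lemma fker_integrable (F : R -> R[i]) z : cintegrable F -> cintegrable (fun x => F x * fker c z x).
Proof.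
move=> hF; apply: (cintegrableM hF (cmeasurable_fker z)) => x; exact: n1_fker.
Qed.

Lemma FL_growth (F : R -> R[i]) : cintegrable F -> forall z,
  n1 (FL F c z) <= 2 * RI (fun x => n1 (F x)) * expR (A * `|Im z|).
Proof.
move=> hF z; have hn := cintegrable_n1 hF.
apply: (le_trans (n1_cintegral (fker_integrable z hF) (rintZ (2 * expR (A * `|Im z|)) hn) _)).
  by move=> x; apply: (le_trans (n1M _ _)); rewrite ler_wpM2l ?n1_ge0 ?n1_fker.
by rewrite RintegralZr //; apply: le_of_eq; ring.
Qed.

(** The jet comes from expanding the kernel in powers of [h] under the integral; as [c] is bounded,
    the Taylor remainder is uniform in [x]. *)
Lemma FL_entire (F : R -> R[i]) : cintegrable F -> entire (FL F c).
Proof.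
move=> hF z m; have hn := cintegrable_n1 hF.
have hk k : cintegrable (fun x => F x * fker c z x * (d x ^+ k / k`!%:R)).
  apply: (@cintegrableM _ _ _ (A ^+ k * n1 (k`!%:R^-1 : R[i])) (fker_integrable z hF)).
    by apply: cmeasurableM; [apply: cmeasurableX; exact: cmeasurable_d|exact: cmeasurable_cst].
  move=> x; apply: (le_trans (n1M _ _)); rewrite ler_wpM2r ?n1_ge0 //.
  apply: (le_trans (n1X _ _)); rewrite lerXn2r ?nnegrE ?n1_ge0 ?kernel_exponent_ge0 ?n1_d //.
pose a k := cintegral (fun x => F x * fker c z x * (d x ^+ k / k`!%:R)).
pose E := 2 * expR (A * `|Im z|).
have E0 : 0 <= E by rewrite mulr_ge0 ?expR_ge0.
have A0 := kernel_exponent_ge0.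
pose M := RI (fun x => n1 (F x)).
have M0 : 0 <= M by apply: Rintegral_ge0 => x _; exact: n1_ge0.
exists (\sum_(k < m) (a k) *: 'X^k), (M * (E * (2 ^+ m.+1 * A ^+ m * expR A))), 1; split=> //.
  by rewrite !mulr_ge0 ?exprn_ge0 ?expR_ge0.
move=> h h1.
have -> : (\sum_(k < m) (a k) *: 'X^k).[h] =
    cintegral (fun x => \sum_(k < m) F x * fker c z x * (d x ^+ k / k`!%:R) * h ^+ k).
  rewrite cintegral_sum; last by move=> k; exact: cintegrableZ.
  rewrite horner_sum; apply: eq_bigr => k _.
  by rewrite hornerZ hornerXn cintegralZ.
have hS : cintegrable (fun x => \sum_(k < m) F x * fker c z x * (d x ^+ k / k`!%:R) * h ^+ k).
  by apply: cintegrable_sum => k; exact: cintegrableZ.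
rewrite /FL -cintegralB //; last exact: fker_integrable.
have HE : (fun x => F x * fker c (z + h) x - \sum_(k < m) F x * fker c z x * (d x ^+ k / k`!%:R) * h ^+ k) =
  (fun x => F x * (fker c z x * (cexp (d x * h) - csum m (d x * h)))).
  apply/funext => x; rewrite /fker mulrDr cexpD -/(d x) [in RHS]mulrBr mulrBr; congr (_ - _).
  rewrite /csum !mulr_sumr; apply: eq_bigr => k _; rewrite exprMn; ring.
rewrite HE.
have bnd x : n1 (F x * (fker c z x * (cexp (d x * h) - csum m (d x * h)))) <=
    n1 (F x) * (E * (2 ^+ m.+1 * A ^+ m * expR A) * n1 h ^+ m).
  apply: (le_trans (n1M _ _)); rewrite ler_wpM2l ?n1_ge0 //.
  apply: (le_trans (n1M _ _)); rewrite -[leRHS]mulrA ler_pM ?n1_ge0 ?n1_fker //.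
  apply: (le_trans (cexp_taylor1 _ _)).
  have dh : n1 (d x * h) <= A * n1 h.
    by apply: (le_trans (n1M _ _)); rewrite ler_wpM2r ?n1_ge0 ?n1_d.
  rewrite -!mulrA ler_wpM2l ?exprn_ge0 //.
  rewrite (_ : A ^+ m * (expR A * n1 h ^+ m) = (A * n1 h) ^+ m * expR A); last by rewrite (exprMn _ A (n1 h)); ring.
  rewrite ler_pM ?exprn_ge0 ?n1_ge0 ?expR_ge0 //.
    by rewrite lerXn2r // nnegrE ?n1_ge0 //; exact: (mulr_ge0 A0 (n1_ge0 _)).
  by rewrite ler_expR; apply: (le_trans dh); rewrite ler_piMr // ltW.
apply: (le_trans (n1_cintegral _ (rintZ _ hn) bnd)).
  rewrite -HE.
  by apply: cintegrableB => //; exact: fker_integrable.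
by rewrite RintegralZr //; apply: le_of_eq; rewrite /M; ring.
Qed.

End Kernel.

Lemma conjc_horner (p : {poly R[i]}) h : conjc p.[h] = (map_poly (@conjc R) p).[conjc h].
Proof. by rewrite horner_map. Qed.

(** On the real line this is the conjugate of [F], so squared moduli and products with conjugates
    become restrictions of entire functions. *)
Lemma entire_star (F : R[i] -> R[i]) : (forall z, analytic_at F z) -> entire (fun z => conjc (F (conjc z))).
Proof.
move=> HF z m; have [p [K [e [K0 e0 H]]]] := HF (conjc z) m.
exists (map_poly (@conjc R) p), K, e; split=> // h he.
have -> : (map_poly (@conjc R) p).[h] = conjc p.[conjc h] by rewrite conjc_horner conjcK.
rewrite -conjcN -conjcD n1J conjcD -(n1J h); apply: H; by rewrite n1J.
Qed.

Lemma entire_shift (F : R[i] -> R[i]) a : entire F -> entire (fun z => F (z + a)).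
Proof.
move=> HF z m; have [p [K [e [K0 e0 H]]]] := HF (z + a) m.
by exists p, K, e; split=> // h he; rewrite addrAC; exact: H.
Qed.

End FourierLaplace.

(** * Sampling at frequencies of large density *)

Section Sampling.
Variable R : realType.
Local Notation mu := (@lebesgue_measure R).
Local Notation RI f := (Rintegral mu [set: R] f).
Implicit Types (F G : R -> R[i]) (z w h a : R[i]).

Lemma limsup_frequently (u : nat -> R) (a : R) : (a%:E < limn_esup (fun n => (u n)%:E))%E ->
  exists2 D, a < D & forall N, exists2 n, (N <= n)%N & D < u n.
Proof.
move=> hl.
have [D aD Dl] : exists2 D : R, a < D & (D%:E < limn_esup (fun n => (u n)%:E))%E.
  move: hl; case: (limn_esup _) => [l| |] //=.
    rewrite lte_fin => al; exists ((a + l) / 2); rewrite ?lte_fin; lra.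
  by move=> _; exists (a + 1); rewrite ?ltry //; lra.
exists D => // N; apply: contrapT => hN.
move: Dl; rewrite ltNge => /negP; apply.
rewrite limn_esup_lim; apply: lime_le; first exact: is_cvg_esups.
exists N => // n /= Nn; apply: ge_ereal_sup => _ [k /= nk <-]; rewrite lee_fin leNgt.
by apply/negP => Dk; apply: hN; exists k => //; exact: leq_trans nk.
Qed.

Lemma dense_zeros_seq (omega : nat -> R) (a : R) : 0 < a ->
  (forall n, (0 < n)%N -> 0 < omega n) ->
  (forall m n, (0 < m)%N -> (m < n)%N -> omega m < omega n) ->
  (a%:E < limn_esup (fun n => (n%:R / omega n)%:E))%E ->
  exists2 D, a < D & forall H : R[i] -> R[i],
    (forall n, (0 < n)%N -> H (omega n)%:C = 0) -> dense_zeros D H.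
Proof.
move=> a0 o0 oi /limsup_frequently[D aD HD]; exists D => // H Hz r0.
have D0 : 0 < D by apply: lt_trans aD.
(* [n] is also at least [D * r0], so the first [n] frequencies are numerous enough even if
   [omega n < r0] and the radius has to be [r0]. *)
have [n Nn Dn] := HD (maxn 1 (Num.truncn (D * r0)).+1).
have n0 : (0 < n)%N by apply: leq_trans Nn; rewrite leq_max.
have on0 := o0 _ n0.
have Dr0 : D * r0 <= n%:R.
  apply: (@le_trans _ _ (Num.truncn (D * r0)).+1%:R); first by rewrite ltW // truncnS_gt.
  by rewrite ler_nat; apply: leq_trans Nn; rewrite leq_maxr.
exists (Num.max (omega n) r0); first by rewrite le_max lexx orbT.
exists [seq omega k | k <- iota 1 n]; split.
- rewrite map_inj_in_uniq ?iota_uniq // => i j; rewrite !mem_iota => /andP[i0 _] /andP[j0 _] eij.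
  by apply/eqP; case: ltngtP => // /oi; [move=> /(_ i0)|move=> /(_ j0)]; rewrite eij ltxx.
- rewrite size_map size_iota; have [h|h] := leP (omega n) r0; first exact: Dr0.
  by rewrite ltW // -ltr_pdivlMr.
- move=> w /mapP[k]; rewrite mem_iota add1n ltnS => /andP[k0 kn] ->; split; last exact: Hz.
  rewrite (ltW (o0 _ k0)) /= le_max; apply/orP; left.
  by move: kn; rewrite leq_eqVlt => /predU1P[->//|kn]; rewrite ltW // oi.
Qed.

Definition supported t (B : R) F : Prop :=
  {ae mu, forall x, x \notin `[t - B, t + B] -> F x = 0}.

Definition clamp t (B x : R) : R := Num.max (- B) (Num.min B (x - t)).

Section Clamp.
Variables (t B : R).
Hypothesis B0 : 0 < B.

Lemma clamp_meas : measurable_fun [set: R] (clamp t B).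
Proof.
apply: measurable_maxr; first exact: measurable_cst.
apply: measurable_minr; first exact: measurable_cst.
exact: measurable_subr.
Qed.

Lemma clamp_bound x : `|clamp t B x| <= B.
Proof.
rewrite /clamp ler_norml le_max lexx /= ge_max ge_min lexx /= andbT; move: B0; lra.
Qed.

Lemma clamp_eq x : x \in `[t - B, t + B] -> clamp t B x = x - t.
Proof.
rewrite in_itv /= => /andP[h1 h2]; rewrite /clamp min_r; last by lra.
by rewrite max_r //; lra.
Qed.

Lemma clamp_refl x : clamp t B (2 * t - x) = - clamp t B x.
Proof.
rewrite /clamp (_ : 2 * t - x - t = - (x - t)); last by ring.
move: (x - t) => y.
have Bp := B0; have [h1|h1] := leP y B; last first.
  have e1 : Num.min B y = B by rewrite min_l // ltW.
  have e2 : Num.max (- B) B = B by rewrite max_r //; lra.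
  have e3 : Num.min B (- y) = - y by rewrite min_r //; lra.
  have e4 : Num.max (- B) (- y) = - B by rewrite max_l //; lra.
  by rewrite ?e1 ?e2 ?e3 ?e4.
have [h2|h2] := leP (- B) y.
  have e1 : Num.min B y = y by rewrite min_r.
  have e2 : Num.max (- B) y = y by rewrite max_r.
  have e3 : Num.min B (- y) = - y by rewrite min_r //; lra.
  have e4 : Num.max (- B) (- y) = - y by rewrite max_r //; lra.
  by rewrite ?e1 ?e2 ?e3 ?e4.
have e1 : Num.min B y = y by rewrite min_r.
have e2 : Num.max (- B) y = - B by rewrite max_l // ltW.
have e3 : Num.min B (- y) = B by rewrite min_l //; lra.
have e4 : Num.max (- B) B = B by rewrite max_r //; lra.
by rewrite ?e1 ?e2 ?e3 ?e4 opprK.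
Qed.

End Clamp.

Section TwoSignals.
Variables (t B : R) (F G : R -> R[i]).
Hypotheses (B0 : 0 < B) (hF : cintegrable F) (hG : cintegrable G).
Local Notation c := (clamp t B).
Local Notation P := (FL F c).
Local Notation Q := (FL G c).
Let mc := clamp_meas t B.
Let cB := clamp_bound t B0.

Lemma FL_growth_sq (F1 : R -> R[i]) : cintegrable F1 -> exists2 I : R, 0 <= I & forall z,
   n1 (FL F1 c z) <= I * expR (2 * pi * B * `|Im z|).
Proof.
move=> h; exists (2 * RI (fun x => n1 (F1 x))).
  by rewrite mulr_ge0 // Rintegral_ge0 // => x _; exact: n1_ge0.
exact: FL_growth.
Qed.

(** The difference of the two squared moduli extends to an entire function of exponential type
    [4 pi B]. Its zeros have density [D > 4 B], which is the condition [a < pi * D] of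
    [levinson]. *)
Lemma sampling_density (omega : nat -> R) :
  (forall n, (0 < n)%N -> 0 < omega n) ->
  (forall m n, (0 < m)%N -> (m < n)%N -> omega m < omega n) ->
  ((4 * B)%:E < limn_esup (fun n => (n%:R / omega n)%:E))%E ->
  (forall n, (0 < n)%N -> nsq (P (omega n)%:C) = nsq (Q (omega n)%:C)) ->
  forall x : R, nsq (P x%:C) = nsq (Q x%:C).
Proof.
move=> o0 oi ol PQ.
have B4 : 0 < 4 * B by rewrite mulr_gt0.
have [D BD HD] := dense_zeros_seq B4 o0 oi ol.
pose H z := P z * conjc (P (conjc z)) - Q z * conjc (Q (conjc z)).
have HE x : H x%:C = (nsq (P x%:C) - nsq (Q x%:C))%:C.
  by rewrite /H conjc_real !nsqJE rmorphB.
have eP := FL_entire mc cB hF; have eQ := FL_entire mc cB hG.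
have HH : entire H.
  by move=> z; apply: analyticB; apply: analyticM => //; exact: entire_star.
have [I I0 HI] := FL_growth_sq hF; have [J J0 HJ] := FL_growth_sq hG.
have Hz : dense_zeros D H.
  by apply: HD => n n0; rewrite HE PQ // subrr.
have gr z : n1 (H z) <= (I ^+ 2 + J ^+ 2) * expR (4 * pi * B * `|Im z|).
  have E2 : expR (4 * pi * B * `|Im z|) = expR (2 * pi * B * `|Im z|) ^+ 2.
    by rewrite -expRM_natl; congr expR; ring.
  rewrite E2 mulrDl -!exprMn; apply: (le_trans (n1B _ _)).
  have Iz : `|Im (conjc z)| = `|Im z| by rewrite cImJ normrN.
  apply: lerD; apply: (le_trans (n1M _ _)); rewrite n1J expr2 ler_pM ?n1_ge0 //.
    by rewrite -Iz.
  by rewrite -Iz.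
have a0 : 0 < 4 * pi * B by rewrite !mulr_gt0 // pi_gt0.
have aD : 4 * pi * B < pi * D.
  by rewrite (_ : 4 * pi * B = pi * (4 * B)) ?ltr_pM2l ?pi_gt0 //; ring.
move=> x; have := @levinson R H ((I ^+ 2 + J ^+ 2) ^+ 2) (4 * pi * B) D HH a0 aD _ Hz x.
rewrite HE => h; apply/eqP; rewrite -subr_eq0; apply/eqP.
suff : (nsq (P x%:C) - nsq (Q x%:C))%:C = 0 :> R[i] by move=> /complexI.
apply: h => z; apply: (le_trans (nsq_le _)).
have -> : expR (2 * (4 * pi * B) * `|Im z|) = expR (4 * pi * B * `|Im z|) ^+ 2.
  by rewrite -expRM_natl; congr expR; ring.
by rewrite -exprMn lerXn2r ?nnegrE ?n1_ge0 // mulr_ge0 ?expR_ge0 // addr_ge0 ?sqr_ge0.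
Qed.

End TwoSignals.

End Sampling.

(** * Sampling on the lattice *)

Section Lattice.
Variable R : realType.
Local Notation mu := (@lebesgue_measure R).
Local Notation RI f := (Rintegral mu [set: R] f).
Implicit Types (z w h a : R[i]).

Lemma fker_real (c : R -> R) (w x : R) : fker c w%:C x = ei (- (2 * pi * c x) * w).
Proof. by rewrite /fker /ei; congr cexp; apply: complex_ext; rewrite !ReImE /=; ring. Qed.

Section OneSignal.
Variables (t B : R) (F : R -> R[i]).
Hypotheses (B0 : 0 < B) (hF : cintegrable F) (sF : supported t B F).
Local Notation c := (clamp t B).
Local Notation P := (FL F c).
Let mc := clamp_meas t B.
Let cB := clamp_bound t B0.
(** Scales the window to [-pi/2, pi/2]: differences of two values stay in [-pi, pi], and the
    frequencies [k / (4 B)] become integers. *)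
Let phi (x : R) : R := - (2 * pi * c x) / (4 * B).

Let mphi : measurable_fun [set: R] phi.
Proof.
apply: measurable_funM; last exact: measurable_cst.
apply: measurableT_comp => //; apply: measurable_funM => //; exact: measurable_cst.
Qed.

Lemma ei_phi (w x : R) : ei (w * phi x) = fker c (w / (4 * B))%:C x.
Proof. by rewrite fker_real /phi; congr ei; field; rewrite gt_eqF. Qed.

Lemma ae_phi : {ae mu, forall x, F x = 0 \/ `|phi x| < pi / 2}.
Proof.
have := aeI sF (aeI (ae_neq (t - B)) (ae_neq (t + B))).
apply: aeS => x [Fx [x1 x2]].
have [xI|xI] := boolP (x \in `[t - B, t + B]); last by left; exact: Fx.
right; rewrite /phi clamp_eq // normrM normrN normrM (ger0_norm (_ : 0 <= 2 * pi)) ?mulr_ge0 ?pi_ge0 //.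
rewrite [`|_^-1|]gtr0_norm ?invr_gt0 ?mulr_gt0 // ltr_pdivrMr ?mulr_gt0 //.
have -> : pi / 2 * (4 * B) = 2 * pi * B by field.
rewrite ltr_pM2l ?mulr_gt0 ?pi_gt0 //.
move: xI; rewrite in_itv /= => /andP[h1 h2].
have h3 : t - B < x by rewrite lt_neqAle eq_sym x1.
have h4 : x < t + B by rewrite lt_neqAle x2.
by rewrite ltr_norml; apply/andP; split; lra.
Qed.

(* [nsq P] is the Fourier transform of the autocorrelation of [F], which lives on
   [- 2 B, 2 B]: after scaling, the exponential of frequency [nu] is only tested on
   ]-pi, pi[, where it is a limit of exponentials of integer frequencies. *)
Lemma power_spectrum_limit (nu : R) (tau : nat -> R -> R[i]) (M : R) (s : nat -> seq (R[i] * int)) :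
  (forall n th, tau n th = \sum_(q <- s n) q.1 * ei (q.2%:~R * th)) ->
  (forall n th, n1 (tau n th) <= M) ->
  (forall th, `|th| < pi -> ccvg (fun n => tau n th) (ei (nu * th))) ->
  ccvg (fun n => \sum_(q <- s n) q.1 * (nsq (P (q.2%:~R / (4 * B))%:C))%:C)
    (nsq (P (nu / (4 * B))%:C))%:C.
Proof.
move=> ts tM tc.
have tE n : trig (tau n) by exists (s n) => th; exact: ts.
have hFJ := cintegrableJ hF.
have eE (w : R) : cintegral (fun x => F x * ei (w * phi x)) = P (w / (4 * B))%:C.
  by rewrite /FL; congr cintegral; apply/funext => x; rewrite ei_phi.
have mei (w : R) : cmeasurable (fun x => ei (w * phi x)).
  by apply: cmeasurable_ei; apply: measurable_funM => //; exact: measurable_cst.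
have hei (w : R) : cintegrable (fun x => F x * ei (w * phi x)).
  by apply: (cintegrableM hF (mei w)) => x; exact: n1_ei.
have eJ (w : R) : cintegral (fun x => conjc (F x) * ei (- (w * phi x))) = conjc (P (w / (4 * B))%:C).
  rewrite -eE -cintegralJ //; congr cintegral; apply/funext => x.
  by rewrite conjcM eiJ.
have heJ (w : R) : cintegrable (fun x => conjc (F x) * ei (- (w * phi x))).
  have := cintegrableJ (hei w); congr cintegrable; apply/funext => x.
  by rewrite conjcM eiJ.
(* The autocorrelation enters as an iterated integral, and dominated convergence is applied twice:
   in [y] for fixed [x], then in [x]. *)
pose inner n (x : R) := cintegral (fun y => conjc (F y) * tau n (phi x - phi y)).
pose inner0 (x : R) := cintegral (fun y => conjc (F y) * ei (nu * (phi x - phi y))).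
have mtau n x : cmeasurable (fun y => tau n (phi x - phi y)).
  by apply: (cmeasurable_trig (tE n)); apply: measurable_funB => //; exact: measurable_cst.
have innerE n x : inner n x = \sum_(q <- s n) q.1 * ei (q.2%:~R * phi x) * conjc (P (q.2%:~R / (4 * B))%:C).
  rewrite /inner.
  have -> : (fun y => conjc (F y) * tau n (phi x - phi y)) =
     (fun y => \sum_(q <- s n) conjc (F y) * ei (- (q.2%:~R * phi y)) * (q.1 * ei (q.2%:~R * phi x))).
    apply/funext => y; rewrite ts mulr_sumr; apply: eq_bigr => q _.
    by rewrite mulrBr eiD; ring.
  rewrite cintegral_sum; last by move=> q; apply: cintegrableZ.
  by apply: eq_bigr => q _; rewrite cintegralZ // eJ mulrC.
have inner0E x : inner0 x = ei (nu * phi x) * conjc (P (nu / (4 * B))%:C).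
  rewrite /inner0 -eJ [RHS]mulrC -cintegralZ //; congr cintegral; apply/funext => y.
  by rewrite mulrBr eiD; ring.
have nF := cintegrable_n1 hF.
have bnd (k : R -> R[i]) (M' : R) : cmeasurable k -> (forall y, n1 (k y) <= M') ->
    n1 (cintegral (fun y => conjc (F y) * k y)) <= RI (fun y => n1 (F y) * M').
  move=> mk kM; apply: n1_cintegral; first exact: (cintegrableM hFJ mk kM).
    exact: rintZ.
  by move=> y; apply: (le_trans (n1M _ _)); rewrite n1J ler_wpM2l ?n1_ge0.
pose M1 := Num.max M 2.
pose K := RI (fun y => n1 (F y) * M1).
have tM1 n th : n1 (tau n th) <= M1 by rewrite /M1 le_max tM.
have eM1 th : n1 (ei th : R[i]) <= M1 by rewrite /M1 le_max n1_ei orbT.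
have innerc x : `|phi x| < pi / 2 -> ccvg (fun n => inner n x) (inner0 x).
  move=> px; apply: (@cintegral_dct _ _ _ _ M1) => //.
    by apply: cmeasurable_ei; apply: measurable_funM; [exact: measurable_cst|apply: measurable_funB => //; exact: measurable_cst].
  move: ae_phi; apply: aeS => y [Fy|py]; first by left; rewrite Fy conjc0.
  right; apply: tc; apply: (le_lt_trans (ler_normB _ _)).
  by rewrite [ltRHS](_ : pi = pi / 2 + pi / 2); [rewrite ltrD|field].
have := @cintegral_dct R F inner inner0 K hF.
have minner n : cmeasurable (inner n).
  have -> : inner n = (fun x => \sum_(q <- s n) q.1 * conjc (P (q.2%:~R / (4 * B))%:C) * ei (q.2%:~R * phi x)).
    by apply/funext => x; rewrite innerE; apply: eq_bigr => q _; ring.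
  elim: (s n) => [|q l IH]; first by under eq_fun do rewrite big_nil; exact: cmeasurable_cst.
  under eq_fun do rewrite big_cons; apply: cmeasurableD => //.
  by apply: cmeasurableM; [exact: cmeasurable_cst|exact: mei].
have minner0 : cmeasurable inner0.
  have -> : inner0 = (fun x => ei (nu * phi x) * conjc (P (nu / (4 * B))%:C)) by apply/funext.
  by apply: cmeasurableM; [exact: mei|exact: cmeasurable_cst].
move=> /(_ minner minner0) H.
have -> : (fun n => \sum_(q <- s n) q.1 * (nsq (P (q.2%:~R / (4 * B))%:C))%:C) =
   (fun n => cintegral (fun x => F x * inner n x)).
  apply/funext => n.
  have -> : (fun x => F x * inner n x) = (fun x => \sum_(q <- s n) F x * ei (q.2%:~R * phi x) * (q.1 * conjc (P (q.2%:~R / (4 * B))%:C))).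
    by apply/funext => x; rewrite innerE mulr_sumr; apply: eq_bigr => q _; ring.
  rewrite cintegral_sum; last by move=> q; apply: cintegrableZ.
  by apply: eq_bigr => q _; rewrite cintegralZ // eE mulrCA nsqJE.
have -> : (nsq (P (nu / (4 * B))%:C))%:C = cintegral (fun x => F x * inner0 x).
  have -> : (fun x => F x * inner0 x) = (fun x => F x * ei (nu * phi x) * conjc (P (nu / (4 * B))%:C)).
    by apply/funext => x; rewrite inner0E mulrA.
  by rewrite cintegralZ // eE nsqJE.
apply: H.
- move=> n x; apply: bnd => //.
- move=> x; apply: bnd => //.
  by apply: cmeasurable_ei; apply: measurable_funM; [exact: measurable_cst|apply: measurable_funB => //; exact: measurable_cst].
- by move: ae_phi; apply: aeS => x [Fx|px]; [left|right; exact: innerc].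
Qed.

End OneSignal.

(** The approximating polynomials do not depend on the signal, so both power spectra are limits of
    the same linear combinations of equal samples. *)
Lemma sampling_lattice t B (F G : R -> R[i]) : 0 < B -> cintegrable F -> cintegrable G ->
  supported t B F -> supported t B G ->
  (forall k : int, nsq (FL F (clamp t B) (k%:~R / (4 * B))%:C) = nsq (FL G (clamp t B) (k%:~R / (4 * B))%:C)) ->
  forall x : R, nsq (FL F (clamp t B) x%:C) = nsq (FL G (clamp t B) x%:C).
Proof.
move=> B0 hF hG sF sG FG x.
have [tau [M [tt tM tc]]] := @trig_ei R (x * (4 * B)).
have [s hs] := choice tt.
have := power_spectrum_limit B0 hF sF hs tM tc.
have := power_spectrum_limit B0 hG sG hs tM tc.
rewrite mulfK; last by rewrite gt_eqF // mulr_gt0.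
under eq_fun do under eq_bigr do rewrite -FG.
by move=> h1 h2; have /complexI := ccvg_unique h2 h1.
Qed.

End Lattice.

(** * Phase retrieval on one window *)

Section Retrieval.
Variable R : realType.
Local Notation mu := (@lebesgue_measure R).
Implicit Types (z h a : R[i]).

Definition many_zeros (H : R[i] -> R[i]) : Prop := forall n : nat,
  exists s : seq R, [/\ uniq s, size s = n & forall w : R, w \in s -> 0 <= w <= 1 /\ H w%:C = 0].

Definition exp_type (H : R[i] -> R[i]) : Prop := exists2 C : R, 0 <= C & exists2 a : R, 0 <= a &
  forall z, n1 (H z) <= C * expR (a * `|Im z|).

Lemma exp_typeM (H K : R[i] -> R[i]) : exp_type H -> exp_type K -> exp_type (fun z => H z * K z).
Proof.
move=> [C C0 [a a0 h]] [D D0 [b b0 k]]; exists (C * D); first exact: mulr_ge0.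
exists (a + b); first exact: addr_ge0.
move=> z; apply: (le_trans (n1M _ _)); rewrite (mulrDl a b) expRD mulrACA.
by rewrite ler_pM ?n1_ge0.
Qed.

Lemma exp_typeB (H K : R[i] -> R[i]) : exp_type H -> exp_type K -> exp_type (fun z => H z - K z).
Proof.
move=> [C C0 [a a0 h]] [D D0 [b b0 k]]; exists (C + D); first exact: addr_ge0.
exists (a + b); first exact: addr_ge0.
move=> z; apply: (le_trans (n1B _ _)); rewrite (mulrDl C D); apply: lerD.
  by apply: (le_trans (h z)); rewrite ler_wpM2l // ler_expR ler_wpM2r // lerDl.
by apply: (le_trans (k z)); rewrite ler_wpM2l // ler_expR ler_wpM2r // lerDr.
Qed.

Lemma exp_type_star (H : R[i] -> R[i]) : exp_type H -> exp_type (fun z => conjc (H (conjc z))).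
Proof.
move=> [C C0 [a a0 h]]; exists C => //; exists a => // z.
by rewrite n1J; have := h (conjc z); rewrite cImJ normrN.
Qed.

Lemma exp_type_shift (H : R[i] -> R[i]) (b : R) : exp_type H -> exp_type (fun z => H (z + b%:C)).
Proof.
move=> [C C0 [a a0 h]]; exists C => //; exists a => // z.
by have := h (z + b%:C); rewrite cImD /= addr0.
Qed.

(** Multiplication by [exp (i a z)] makes the function bounded on [Im z >= -1] without moving its
    zeros. *)
Lemma entire_zero_real (H : R[i] -> R[i]) : entire H -> exp_type H -> many_zeros H ->
  forall x : R, H x%:C = 0.
Proof.
move=> eH [C C0 [a a0 gr]] Hz x.
pose F z := H z * cexp (('i * a%:C) * z).
have F0 : F x%:C = 0.
  apply: (@entire_identity _ F (C ^+ 2 * expR (4 * a))) => //.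
  - by move=> z; apply: analyticM => //; exact: analytic_cexp.
  - move=> z hz; rewrite /F nsqM nsq_cexp.
    have -> : Re ('i * a%:C * z) = - (a * Im z) by rewrite !ReImE /=; ring.
    apply: (@le_trans _ _ (C ^+ 2 * expR (2 * (a * `|Im z|)) * expR (2 * - (a * Im z)))).
      rewrite ler_wpM2r ?expR_ge0 //; apply: (le_trans (nsq_le _)).
      by rewrite expRM_natl -exprMn lerXn2r ?nnegrE ?n1_ge0 // mulr_ge0 ?expR_ge0.
    rewrite -mulrA -expRD ler_wpM2l ?sqr_ge0 // ler_expR.
    case: (ger0P (Im z)) => z0; first by have : 0 <= a * 1 := mulr_ge0 a0 ler01; lra.
    have : a * - Im z <= a * 1 by rewrite ler_wpM2l //; lra.
    lra.
  - move=> n; have [s [us sn Hs]] := Hz n; exists s; split=> // w ws.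
    by have [h1 h2] := Hs w ws; rewrite /F h2 mul0r.
by move/eqP: F0; rewrite mulf_eq0 (negbTE (cexp_neq0 _)) orbF => /eqP.
Qed.

Lemma finite_zeros (H : R[i] -> R[i]) : entire H -> exp_type H -> (exists x : R, H x%:C != 0) ->
  forall b : R, finite_set [set w : R | 0 <= w <= 1 /\ H (w + b)%:C = 0].
Proof.
move=> eH tH [x Hx] b; apply: contrapT => /infinite_set_fset inf.
have : H ((x - b)%:C + b%:C) = 0.
  apply: (@entire_zero_real (fun z => H (z + b%:C))).
  - exact: entire_shift.
  - exact: exp_type_shift.
  - move=> n; have [A As An] := inf n.
    exists (take n (finmap.enum_fset A)); split.
    + by rewrite take_uniq // finmap.fset_uniq.
    + by rewrite size_takel.
    + move=> w /mem_take wA; have [] := As w wA; by rewrite rmorphD.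
by rewrite -rmorphD subrK; move/eqP: Hx.
Qed.

(* The zeros of all the translates of [H] are countable, so some [w] in [0, 1] avoids them. *)
Lemma avoid_zeros (H : R[i] -> R[i]) (b : R) : entire H -> exp_type H -> (exists x : R, H x%:C != 0) ->
  exists w : R, forall k : int, H (w + k%:~R * b)%:C != 0.
Proof.
move=> eH tH Hx; apply: contrapT => hn.
pose Z (k : int) := [set w : R | 0 <= w <= 1 /\ H (w + k%:~R * b)%:C = 0].
have cZ : countable (\bigcup_(k in [set: int]) Z k).
  apply: bigcup_countable => [|k _]; first exact: countableP.
  by apply: finite_set_countable; exact: finite_zeros.
have sub : `[0, 1]%classic `<=` \bigcup_(k in [set: int]) Z k.
  move=> w /= /[!in_itv] /= w01; apply: contrapT => hw; apply: hn; exists w => k.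
  by apply/eqP => Hk; apply: hw; exists k.
have := countable_lebesgue_measure0 (sub_countable (subset_card_le sub) cZ).
rewrite lebesgue_measure_itv /= lte_fin ltr01 oppr0 adde0 => /eqP.
by rewrite eqe oner_eq0.
Qed.

Section TwoSignals.
Variables (t B b : R).
Hypotheses (B0 : 0 < B) (b0 : 0 < b) (bB : b <= 1 / (2 * B)).
Local Notation c := (clamp t B).
Let mc := clamp_meas t B.
Let cB := clamp_bound t B0.

Lemma FL_exp_type F : cintegrable F -> exp_type (FL F c).
Proof.
move=> hF; have [I I0 hI] := FL_growth_sq t B0 hF; exists I => //.
by exists (2 * pi * B) => //; rewrite !mulr_ge0 ?pi_ge0 // ltW.
Qed.

(** Up to unimodular factors, the samples are the Fourier coefficients of [F] times an exponential
    on the interval of length [1 / b] centred at [t], which contains the window. *)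
Lemma FL_zero_ae F : cintegrable F -> supported t B F ->
  (exists w : R, forall k : int, FL F c (w + k%:~R * b)%:C = 0) -> {ae mu, forall x, F x = 0}.
Proof.
move=> hF sF [w Hw].
have h0 : 0 < (2 * b)^-1 by rewrite invr_gt0 mulr_gt0.
have Bh : B <= (2 * b)^-1.
  rewrite -[leRHS]mul1r ler_pdivlMr ?mulr_gt0 //.
  by move: bB; rewrite ler_pdivlMr ?mulr_gt0 //; lra.
pose K x := F x * ei (- (2 * pi * c x) * w).
have mK (v : R) : cmeasurable (fun x => ei (- (2 * pi * c x) * v)).
  apply: cmeasurable_ei; apply: measurable_funM; last exact: measurable_cst.
  apply: measurableT_comp => //; apply: measurable_funM => //; exact: measurable_cst.
have iK : cintegrable K by apply: (cintegrableM hF (mK w)) => x; exact: n1_ei.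
have K0 : {ae mu, forall x, K x = 0}.
  apply: (@fourier_unique _ K t (2 * b)^-1 h0 iK).
    move: sF; apply: aeS => x Fx xI; rewrite /K Fx ?mul0r //.
    apply: contra xI; rewrite !in_itv /= => /andP[h1 h2]; apply/andP; split; lra.
  move=> k.
  have -> : cintegral (fun x => K x * ei (k%:~R * (pi / (2 * b)^-1 * x))) =
     cintegral (fun x => F x * fker c (w + (- k)%:~R * b)%:C x * ei (k%:~R * (pi / (2 * b)^-1 * t))).
    apply: cintegral_ae.
    - apply: (cintegrableM iK _ (fun x => n1_ei _)); apply: cmeasurable_ei.
      apply: measurable_funM; first exact: measurable_cst.
      exact: measurable_mull.
    - by apply: cintegrableZ; exact: (fker_integrable mc cB).
    - move: sF; apply: aeS => x Fx; rewrite /K fker_real.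
      have [xI|xI] := boolP (x \in `[t - B, t + B]); last by rewrite Fx // !mul0r.
      rewrite clamp_eq // -!mulrA -!eiD; congr (_ * ei _).
      by rewrite mulrNz invrK; ring.
  rewrite cintegralZ; last exact: (fker_integrable mc cB).
  by rewrite -/(FL F c _) Hw mul0r.
move: K0; apply: aeS => x /eqP; rewrite mulf_eq0 => /orP[/eqP//|].
by rewrite (negbTE (cexp_neq0 _)).
Qed.

Lemma retrieval_direct F G : cintegrable F -> cintegrable G -> supported t B F -> supported t B G ->
  (forall x : R, nsq (FL F c x%:C) = nsq (FL G c x%:C)) ->
  (forall x : R, FL G c (x + b)%:C * conjc (FL G c x%:C) = FL F c (x + b)%:C * conjc (FL F c x%:C)) ->
  exists2 lam : R[i], nsq lam = 1 & {ae mu, forall x, G x = lam * F x}.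
Proof.
move=> hF hG sF sG PQ step.
set P := FL F c in PQ step *; set Q := FL G c in PQ step *.
(* If [P] vanishes on the real line then so does [Q], and both signals are 0; otherwise some
   translate of [b Z] avoids the zeros of [P]. *)
have [Pn|P0] := pselect (exists x : R, P x%:C != 0); last first.
  have Px x : P x%:C = 0 by apply/eqP; apply: contrapT => /negP h; apply: P0; exists x.
  have Qx x : Q x%:C = 0 by apply/eqP; rewrite -nsq_eq0 -PQ Px nsq0.
  exists 1; first exact: nsq1.
  have F0 : {ae mu, forall x, F x = 0} by apply: FL_zero_ae => //; exists 0 => k; exact: Px.
  have G0 : {ae mu, forall x, G x = 0} by apply: FL_zero_ae => //; exists 0 => k; exact: Qx.
  by have := aeI F0 G0; apply: aeS => x [-> ->]; rewrite mulr0.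
have [w Hw] := avoid_zeros b (FL_entire mc cB hF) (FL_exp_type hF) Pn.
pose a (k : int) := P (w + k%:~R * b)%:C; pose q (k : int) := Q (w + k%:~R * b)%:C.
have a0 k : a k != 0 := Hw k.
have aq k : nsq (a k) = nsq (q k) := PQ _.
have q0 k : q k != 0 by rewrite -nsq_eq0 -aq nsq_eq0.
have qs k : q (k + 1) * conjc (q k) = a (k + 1) * conjc (a k).
  have e : w + k%:~R * b + b = w + (k + 1)%:~R * b by rewrite intrD mulrDl mul1r addrA.
  by have := step (w + k%:~R * b); rewrite e.
(* The ratio at 0 has modulus 1, and [qs] carries it to both neighbours because no [a k]
   vanishes. *)
pose m := q 0 / a 0.
have m1 : nsq m = 1 by rewrite nsqM nsqV -aq divff // nsq_eq0.
have mJ : m * conjc m = 1 by rewrite nsqJE m1.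
have q00 : q 0 = m * a 0 by rewrite /m divfK.
clearbody m.
have up k : q k = m * a k -> q (k + 1) = m * a (k + 1).
  move=> e; have := qs k; rewrite e conjcM => /(congr1 (fun u => m * u)).
  have caq : conjc (a k) != 0 by rewrite conjc_eq0.
  have -> : m * (q (k + 1) * (conjc m * conjc (a k))) = (m * conjc m) * q (k + 1) * conjc (a k) by ring.
  by rewrite mJ mul1r mulrA => /(mulIf caq).
have down k : q (k + 1) = m * a (k + 1) -> q k = m * a k.
  move=> e; have := qs k; rewrite e mulrAC => /(congr1 (@conjc R)).
  rewrite !conjcM !conjcK => h.
  have ca : conjc (a (k + 1)) != 0 by rewrite conjc_eq0.
  apply: (mulfI ca).
  transitivity ((m * conjc m) * (conjc (a (k + 1)) * q k)); first by rewrite mJ mul1r.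
  have -> : conjc (a (k + 1)) * (m * a k) = m * (conjc (a (k + 1)) * a k) by ring.
  by rewrite -h; ring.
have qm k : q k = m * a k.
  elim/int_rec: k => [|n IH|n IH].
  - exact: q00.
  - by rewrite -addn1 PoszD; exact: up.
  - apply: down; rewrite (_ : - n.+1%:Z + 1 = - n%:Z) //.
    by rewrite -addn1 PoszD opprD subrK.
exists m => //.
have iD : cintegrable (fun x => G x - F x * m) by apply: cintegrableB => //; exact: cintegrableZ.
have : {ae mu, forall x, G x - F x * m = 0}.
  apply: FL_zero_ae => //.
    by have := aeI sF sG; apply: aeS => x [hF0 hG0] xI; rewrite hF0 // hG0 // mul0r subr0.
  exists w => k; rewrite /FL.
  have -> : (fun x => (G x - F x * m) * fker c (w + k%:~R * b)%:C x) =
    (fun x => G x * fker c (w + k%:~R * b)%:C x - F x * fker c (w + k%:~R * b)%:C x * m).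
    by apply/funext => x; ring.
  rewrite cintegralB; [|exact: (fker_integrable mc cB)|apply: cintegrableZ; exact: (fker_integrable mc cB)].
  rewrite cintegralZ; last exact: (fker_integrable mc cB).
  by have := qm k; rewrite /q /a /Q /P /FL => ->; rewrite mulrC subrr.
by apply: aeS => x /eqP; rewrite subr_eq0 mulrC => /eqP.
Qed.

End TwoSignals.

End Retrieval.

Section FullRetrieval.
Variable R : realType.
Local Notation mu := (@lebesgue_measure R).
Implicit Types (z h a : R[i]).

(** Pigeonhole: if [S1] does not have [n0] zeros in [0, 1], then among [n + n0] points [1 / (k + 1)]
    at least [n] are zeros of [S2]. *)
Lemma zeros_dichotomy (S1 S2 : R[i] -> R[i]) : (forall x : R, S1 x%:C = 0 \/ S2 x%:C = 0) ->
  many_zeros S1 \/ many_zeros S2.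
Proof.
move=> H; have [|h1] := pselect (many_zeros S1); first by left.
right => n; move/existsNP: h1 => [n0 hn0].
pose pts := [seq (k.+1%:R^-1 : R) | k <- iota 0 (n + n0)].
have upts : uniq pts.
  rewrite map_inj_uniq ?iota_uniq // => i j /invr_inj /eqP.
  by rewrite eqr_nat eqSS => /eqP.
have pts01 w : w \in pts -> 0 <= w <= 1.
  move=> /mapP[k _ ->]; rewrite invr_ge0 ler0n /= invf_le1 ?ltr0n // ler1n //.
pose p := fun w : R => S1 w%:C == 0.
have cp : (count p pts < n0)%N.
  rewrite ltnNge; apply/negP => hc; apply: hn0; exists (take n0 (seq.filter p pts)); split.
  - by rewrite take_uniq // filter_uniq.
  - by rewrite size_takel // size_filter.
  - by move=> w /mem_take; rewrite mem_filter => /andP[/eqP ? /pts01].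
exists (take n (seq.filter (predC p) pts)); split.
- by rewrite take_uniq // filter_uniq.
- rewrite size_takel // size_filter.
  have := count_predC p pts; rewrite size_map size_iota.
  by move: cp; lia.
- move=> w /mem_take; rewrite mem_filter => /andP[/= pw /pts01 w01]; split=> //.
  by case: (H w) => // h; move: pw; rewrite /p h eqxx.
Qed.

Section TwoSignals.
Variables (t B b : R).
Hypotheses (B0 : 0 < B) (b0 : 0 < b) (bB : b <= 1 / (2 * B)).
Local Notation c := (clamp t B).
Let mc := clamp_meas t B.
Let cB := clamp_bound t B0.

Lemma FL_reflect F (x : R) : cintegrable F ->
  FL (fun y => conjc (F (2 * t - y))) c x%:C = conjc (FL F c x%:C).
Proof.
move=> hF; rewrite /FL -cintegralJ; last exact: (fker_integrable mc cB).
rewrite -(@cintegral_refl R (2 * t) (fun y => conjc (F y * fker c x%:C y))); last first.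
  by apply: cintegrableJ; exact: (fker_integrable mc cB).
congr cintegral; apply/funext => y; rewrite conjcM !fker_real clamp_refl // eiJ.
by congr (_ * ei _); ring.
Qed.

Lemma supported_reflect F : supported t B F -> supported t B (fun y => conjc (F (2 * t - y))).
Proof.
move=> /(ae_refl (2 * t)); apply: aeS => x h xI; rewrite h ?conjc0 //.
apply: contra xI; rewrite !in_itv /= => /andP[h1 h2]; apply/andP; split; lra.
Qed.

Lemma nsqB z w : nsq (z - w) = nsq z - 2 * Re (z * conjc w) + nsq w.
Proof. by rewrite /nsq !ReImE; ring. Qed.

Lemma same_or_conj z w : nsq z = nsq w -> Re z = Re w -> z = w \/ z = conjc w.
Proof.
case: z w => [a1 a2] [b1 b2]; rewrite /nsq /= => + e; rewrite e => /addrI /eqP.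
by rewrite eqf_sqr => /orP[/eqP->|/eqP->]; [left|right].
Qed.

Lemma retrieval F G : cintegrable F -> cintegrable G -> supported t B F -> supported t B G ->
  (forall x : R, nsq (FL F c x%:C) = nsq (FL G c x%:C)) ->
  (forall x : R, nsq (FL F c (x + b)%:C - FL F c x%:C) = nsq (FL G c (x + b)%:C - FL G c x%:C)) ->
  exists2 lam : R[i], nsq lam = 1 &
    {ae mu, forall x, G x = lam * F x} \/ {ae mu, forall x, G x = lam * conjc (F (2 * t - x))}.
Proof.
move=> hF hG sF sG PQ PQb.
set P := FL F c in PQ PQb *; set Q := FL G c in PQ PQb *.
have eP : entire P := FL_entire mc cB hF; have eQ : entire Q := FL_entire mc cB hG.
have tP : exp_type P := FL_exp_type t B0 hF; have tQ : exp_type Q := FL_exp_type t B0 hG.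
pose Ps z := conjc (P (conjc z)); pose Qs z := conjc (Q (conjc z)).
have ePs : entire Ps := entire_star eP; have eQs : entire Qs := entire_star eQ.
have tPs : exp_type Ps := exp_type_star tP; have tQs : exp_type Qs := exp_type_star tQ.
(* On the real line these compare [Q(. + b) conj Q] with [P(. + b) conj P] and with its conjugate.
   Equal moduli and equal real parts make one of them vanish at each real point, and
   [zeros_dichotomy] makes the choice global. *)
pose S1 z := Q (z + b%:C) * Qs z - P (z + b%:C) * Ps z.
pose S2 z := Q (z + b%:C) * Qs z - Ps (z + b%:C) * P z.
have S1E (x : R) : S1 x%:C = Q (x + b)%:C * conjc (Q x%:C) - P (x + b)%:C * conjc (P x%:C).
  by rewrite /S1 /Ps /Qs conjc_real -rmorphD.
have S2E (x : R) : S2 x%:C = Q (x + b)%:C * conjc (Q x%:C) - conjc (P (x + b)%:C) * P x%:C.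
  by rewrite /S2 /Ps /Qs -rmorphD !conjc_real.
have e1 : entire S1.
  by move=> z; apply: analyticB; apply: analyticM => //; exact: entire_shift.
have e2 : entire S2.
  by move=> z; apply: analyticB; apply: analyticM => //; exact: entire_shift.
have t1 : exp_type S1.
  by apply: exp_typeB; apply: exp_typeM => //; exact: exp_type_shift.
have t2 : exp_type S2.
  by apply: exp_typeB; apply: exp_typeM => //; exact: exp_type_shift.
have dich x : S1 x%:C = 0 \/ S2 x%:C = 0.
  rewrite S1E S2E.
  have := PQb x; rewrite !nsqB !PQ => hb.
  have hre : Re (Q (x + b)%:C * conjc (Q x%:C)) = Re (P (x + b)%:C * conjc (P x%:C)) by lra.
  have hn : nsq (Q (x + b)%:C * conjc (Q x%:C)) = nsq (P (x + b)%:C * conjc (P x%:C)).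
    by rewrite !nsqM !nsqJ !PQ.
  case: (same_or_conj hn hre) => ->; [left|right]; first by rewrite subrr.
  by rewrite conjcM conjcK subrr.
case: (zeros_dichotomy dich) => hz.
- have z1 := entire_zero_real e1 t1 hz.
  have [lam l1 HL] := retrieval_direct B0 b0 bB hF hG sF sG PQ (fun x => subr0_eq (etrans (esym (S1E x)) (z1 x))).
  by exists lam => //; left.
- have z2 := entire_zero_real e2 t2 hz.
  pose F' y := conjc (F (2 * t - y)).
  have hF' : cintegrable F' by apply: cintegrableJ; exact: cintegrable_refl.
  have [||lam l1 HL] := retrieval_direct B0 b0 bB hF' hG (supported_reflect sF) sG.
  + by move=> x; rewrite FL_reflect // nsqJ; exact: PQ.
  + move=> x; rewrite !FL_reflect // conjcK.
    exact: (subr0_eq (etrans (esym (S2E x)) (z2 x))).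
  by exists lam => //; right.
Qed.

End TwoSignals.

End FullRetrieval.

(** * From measurements to windowed signals *)

Section Measurements.
Variable R : realType.
Local Notation mu := (@lebesgue_measure R).
Implicit Types (z w : R[i]) (f g phi : R -> R[i]).

(** Definedness of the transform is stated with [phi], its integrand with the conjugate. Conjugating
    one factor preserves [nsq] but not [n1], hence the constant. *)
Lemma n1MJ z w : n1 (z * conjc w) <= 2 * n1 (z * w).
Proof.
have h1 := n1_sq_le (z * conjc w); have h2 := nsq_le (z * w).
have e : nsq (z * conjc w) = nsq (z * w) by rewrite !nsqM nsqJ.
have h : n1 (z * conjc w) ^+ 2 <= (2 * n1 (z * w)) ^+ 2.
  rewrite exprMn; move: h1; rewrite e => h1; apply: (le_trans h1).
  have := sqr_ge0 (n1 (z * w)); lra.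
by move: h; rewrite ler_pXn2r // nnegrE ?mulr_ge0 ?n1_ge0.
Qed.

Lemma stft_integrable phi f t : cmeasurable phi -> cmeasurable f -> stft_defined phi f t ->
  cintegrable (fun x => f x * conjc (phi (x - t))).
Proof.
move=> mp mf h; apply: (@cintegrable_le _ _ (fun x => n1 (f x * phi (x - t)) * 2)).
- apply: cmeasurableM => //; apply: cmeasurableJ; apply: cmeasurable_comp => //.
  exact: measurable_subr.
- by move=> x; rewrite [leRHS]mulrC; exact: n1MJ.
- by apply: rintZ; exact: cintegrable_n1.
Qed.

Lemma stft_definedZ phi f t (k : R -> R[i]) M : cmeasurable k -> (forall x, n1 (k x) <= M) ->
  stft_defined phi f t -> cintegrable (fun x => f x * (phi (x - t) * k x)).
Proof.
move=> mk kM h; have := cintegrableM h mk kM; congr cintegrable.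
by apply/funext => x; rewrite mulrA.
Qed.

Lemma sampling B omega t (F G : R -> R[i]) : 0 < B -> admissible_frequencies B omega ->
  cintegrable F -> cintegrable G -> supported t B F -> supported t B G ->
  (forall n, (0 < n)%N ->
     nsq (FL F (clamp t B) (omega n)%:C) = nsq (FL G (clamp t B) (omega n)%:C)) ->
  forall x : R, nsq (FL F (clamp t B) x%:C) = nsq (FL G (clamp t B) x%:C).
Proof.
move=> B0 [om|[om0 omlt omsup]] hF hG sF sG h; last exact: sampling_density h.
apply: sampling_lattice => // k.
have : range (fun k : int => k%:~R / (4 * B)) (k%:~R / (4 * B)) by exists k.
by rewrite -om => -[n n0 <-]; exact: h.
Qed.

Section Window.
Variables (B b t : R) (phi : R -> R[i]).
Hypotheses (B0 : 0 < B) (phiP : admissible_window B phi).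
Local Notation c := (clamp t B).
Let mc := clamp_meas t B.
Let cB := clamp_bound t B0.

Definition windowed f (x : R) : R[i] := f x * conjc (phi (x - t)).

Lemma windowed_supported f : supported t B (windowed f).
Proof.
have [_ + _ _] := phiP; move=> /(ae_shift (- t)); apply: aeS => x h xI.
rewrite /windowed h ?conjc0 ?mulr0 //; apply: contra xI.
rewrite !in_itv /= => /andP[h1 h2]; apply/andP; split; lra.
Qed.

(** The signal seen through [psi]: on the window the conjugate of [exp (2 pi i (x - t) b)] is the
    kernel at frequency [b], so the transform is a difference of translates. *)
Definition modulated f (x : R) : R[i] := windowed f x * (fker c b%:C x - 1).

Lemma modulated_supported f : supported t B (modulated f).
Proof.
by move: (@windowed_supported f); apply: aeS => x h xI; rewrite /modulated h // mul0r.
Qed.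

Lemma modulated_integrable f : cintegrable (windowed f) -> cintegrable (modulated f).
Proof.
move=> h; have := cintegrableB (fker_integrable mc cB b%:C h) h; congr cintegrable.
by apply/funext => x; rewrite /modulated; ring.
Qed.

Lemma FL_modulated f (w : R) : cintegrable (windowed f) ->
  FL (modulated f) c w%:C = FL (windowed f) c (w + b)%:C - FL (windowed f) c w%:C.
Proof.
move=> h; rewrite /FL -cintegralB; try exact: (fker_integrable mc cB).
congr cintegral; apply/funext => x; rewrite /modulated !fker_real (mulrDr _ w b) eiD; ring.
Qed.

(** The kernel of [FL] is centred at [t], so the two transforms differ by the unimodular factor
    [exp (- 2 pi i t w)]. *)
Lemma cintegral_FL F (w : R) : cintegrable F -> supported t B F ->
  nsq (cintegral (fun x => F x * cis2pi (- (x * w)))) = nsq (FL F c w%:C).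
Proof.
move=> hF sF.
have me := cmeasurable_cis2pi w.
have -> : cintegral (fun x => F x * cis2pi (- (x * w))) =
  FL F c w%:C * ei (- (2 * pi * t * w)); last by rewrite nsqM nsq_ei mulr1.
rewrite /FL -cintegralZ; last exact: (fker_integrable mc cB).
apply: cintegral_ae.
- by apply: (cintegrableM (M := 2)) => // x; rewrite cis2pi_ei n1_ei.
- by apply: cintegrableZ; exact: (fker_integrable mc cB).
move: sF; apply: aeS => x Fx.
have [xI|xI] := boolP (x \in `[t - B, t + B]); last by rewrite Fx // !mul0r.
rewrite cis2pi_ei fker_real clamp_eq // -(mulrA (F x)) -eiD; congr (_ * ei _); ring.
Qed.

Lemma nsq_stft f (w : R) : cintegrable (windowed f) ->
  nsq (stft phi f t w) = nsq (FL (windowed f) c w%:C).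
Proof. by move=> h; exact: (cintegral_FL w h (@windowed_supported f)). Qed.

Lemma nsq_stft_modulated f (w : R) : cintegrable (windowed f) ->
  nsq (stft (modulated_window phi b) f t w) = nsq (FL (modulated f) c w%:C).
Proof.
move=> h; have hm := modulated_integrable h.
rewrite -(cintegral_FL w hm (@modulated_supported f)); congr nsq.
have sm := @modulated_supported f.
have sw := @windowed_supported f.
have E (x : R) : f x * conjc (modulated_window phi b (x - t)) =
    windowed f x * (ei (- (2 * pi * ((x - t) * b))) - 1).
  by rewrite /modulated_window conjcM conjcD conjcN conjc1 cis2pi_ei eiJ mulrA.
have me := cmeasurable_cis2pi w.
have nc (x : R) : n1 (cis2pi (- (x * w))) <= 2 := n1_cis2pi _.
apply: cintegral_ae.
- apply: (cintegrableM (M := 2)) => //.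
  under eq_fun do rewrite E.
  apply: (cintegrableM (M := 2 + 1)) => //.
    apply: cmeasurableB; last exact: cmeasurable_cst.
    apply: cmeasurable_ei; apply: measurableT_comp => //.
    apply: measurable_funM; first exact: measurable_cst.
    apply: measurable_funM; last exact: measurable_cst.
    exact: measurable_subr.
  by move=> x; apply: (le_trans (n1B _ _)); rewrite lerD ?n1_ei // n1_1.
- exact: (cintegrableM (M := 2)).
move: sw; apply: aeS => x h0; rewrite E /modulated fker_real.
have [xI|xI] := boolP (x \in `[t - B, t + B]); last by rewrite h0 // !mul0r.
by rewrite clamp_eq //; congr (_ * (ei _ - 1) * _); ring.
Qed.

Hypotheses (b0 : 0 < b) (bB : b <= 1 / (2 * B)).

Lemma measurement_retrieval omega f g : admissible_frequencies B omega ->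
  cmeasurable f -> cmeasurable g -> stft_defined phi f t -> stft_defined phi g t ->
  same_measurements phi (modulated_window phi b) omega t f g ->
  exists2 lam : R[i], nsq lam = 1 &
    {ae mu, forall x, x \in `[t - B, t + B] -> g x = lam * f x} \/
    {ae mu, forall x, x \in `[t - B, t + B] -> g x = lam * conjc (f (2 * t - x))}.
Proof.
move=> om mf mg df dg same; have [ip _ ph pn] := phiP.
have mp := cintegrable_meas ip.
have hF : cintegrable (windowed f) := stft_integrable mp mf df.
have hG : cintegrable (windowed g) := stft_integrable mp mg dg.
have sF := @windowed_supported f; have sG := @windowed_supported g.
have PQ : forall x : R, nsq (FL (windowed f) c x%:C) = nsq (FL (windowed g) c x%:C).
  apply: (sampling B0 om) => // n n0.
  by rewrite -!nsq_stft //; apply/norm_eq_nsq; rewrite (same n n0).1.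
have PQb : forall x : R, nsq (FL (modulated f) c x%:C) = nsq (FL (modulated g) c x%:C).
  apply: (sampling B0 om); try exact: modulated_integrable; try exact: modulated_supported.
  by move=> n n0; rewrite -!nsq_stft_modulated //; apply/norm_eq_nsq; rewrite (same n n0).2.
have [|lam l1 HL] := retrieval B0 b0 bB hF hG sF sG PQ.
- by move=> x; rewrite -!FL_modulated //; exact: PQb.
exists lam => //.
have pn' := ae_shift (- t) pn; have ph' := ae_shift (- t) ph.
have nz (x : R) : (x - t \in `[- B, B] -> phi (x - t) != 0) -> x \in `[t - B, t + B] ->
    conjc (phi (x - t)) != 0.
  move=> h xI; rewrite -nsq_eq0 nsqJ nsq_eq0; apply: h; move: xI.
  rewrite !in_itv /= => /andP[h1 h2]; apply/andP; split; lra.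
case: HL => HL; [left|right].
- move: (aeI HL pn'); apply: aeS => x [+ h] xI; rewrite /windowed mulrA => /mulIf; apply.
  exact: nz.
(* The symmetry [conjc (phi (- x)) = phi x] makes the reflected windowed signal carry the same
   window factor at [x], which can then be cancelled. *)
- move: (aeI HL (aeI pn' ph')); apply: aeS => x [+ [h e]] xI.
  rewrite /windowed conjcM conjcK mulrA => H.
  apply: (mulIf (nz x h xI)); rewrite H; congr (_ * _).
  by rewrite -e conjcK; congr phi; ring.
Qed.

End Window.

End Measurements.

(** * Quasi-periodic signals *)

Section QuasiPeriodic.
Variable R : realType.
Local Notation mu := (@lebesgue_measure R).
Implicit Types (f h : R -> R[i]) (m c : R[i]).

Lemma ae_forallz (P : int -> R -> Prop) : (forall k, {ae mu, forall x, P k x}) ->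
  {ae mu, forall x, forall k, P k x}.
Proof.
move=> h; have := ae_foralln (fun n : nat => aeI (h n%:Z) (h (- n%:Z))).
apply: aeS => x H [n|n]; first exact: (H n).1.
by rewrite NegzE; exact: (H n.+1).2.
Qed.

Definition qper T m f : Prop := {ae mu, forall x, f x = m * f (x + T)}.

Lemma qper_int T m f : m != 0 -> qper T m f ->
  {ae mu, forall x, forall k : int, f x = m ^ k * f (x + k%:~R * T)}.
Proof.
move=> m0 h.
have : {ae mu, forall x, forall k : int, f (x + k%:~R * T) = m * f (x + (k + 1)%:~R * T)}.
  apply: ae_forallz => k; move: (ae_shift (k%:~R * T) h); apply: aeS => x ->.
  by congr (_ * f _); rewrite rmorphD /=; ring.
apply: aeS => x H; case=> n.
  elim: n => [|n IH]; first by rewrite mul0r addr0 expr0z mul1r.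
  rewrite {1}IH H mulrA; congr (_ * f _); last by rewrite -addn1 PoszD.
  by rewrite -addn1 PoszD expfzDr // expr1z.
rewrite NegzE; elim: n.+1 => [|j IH]; first by rewrite oppr0 mul0r addr0 expr0z mul1r.
have e : - j.+1%:Z + 1 = - j%:Z by rewrite -addn1 PoszD opprD addrNK.
rewrite H e mulrA; rewrite {1}IH; congr (_ * _).
by rewrite -e expfzDr // expr1z.
Qed.

Lemma period_point (T a x : R) : 0 < T -> exists k : int, a <= x + k%:~R * T < a + T.
Proof.
move=> T0; have := floor_itv ((x - a) / T); set n := Num.floor _ => /andP[h1 h2].
exists (- n); rewrite mulrNz mulNr.
move: h1 h2; rewrite ler_pdivlMr // ltr_pdivrMr // intrD mulrDl mul1r => h1 h2.
by apply/andP; split; lra.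
Qed.

Lemma qper_eq0 T m f a : 0 < T -> m != 0 -> qper T m f ->
  {ae mu, forall x, x \in `[a, a + T[ -> f x = 0} -> {ae mu, forall x, f x = 0}.
Proof.
move=> T0 m0 hf hw.
have hw' : {ae mu, forall x, forall k : int, x + k%:~R * T \in `[a, a + T[ -> f (x + k%:~R * T) = 0}.
  by apply: ae_forallz => k; exact: (ae_shift (k%:~R * T) hw).
move: (aeI (qper_int m0 hf) hw'); apply: aeS => x [H1 H2].
have [k hk] := period_point a x T0.
by rewrite (H1 k) H2 ?mulr0 // in_itv.
Qed.

(* If the multipliers [m] and [m'] differ, comparing [h = c f] at [x] and [x + T] gives
   [f = 0] on an interval of length [2 B - T]: excluded by nonseparability if [B < T], and
   a full period otherwise. *)
Lemma extension B T m m' c f h a : 0 < B -> 0 < T -> T < 2 * B -> m != 0 -> m' != 0 -> c != 0 ->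
  qper T m f -> qper T m' h ->
  (B < T -> nonseparable_by (2 * B - T) f) ->
  {ae mu, forall x, x \in `[a, a + 2 * B] -> h x = c * f x} ->
  {ae mu, forall x, h x = c * f x}.
Proof.
move=> B0 T0 TB m0 m'0 c0 hf hh nsep hw.
have hw' : {ae mu, forall x, forall k : int, x + k%:~R * T \in `[a, a + 2 * B] ->
    h (x + k%:~R * T) = c * f (x + k%:~R * T)}.
  by apply: ae_forallz => k; exact: (ae_shift (k%:~R * T) hw).
have [mm|mm] := eqVneq m m'.
  move: (aeI (aeI (qper_int m0 hf) (qper_int m'0 hh)) hw'); apply: aeS => x [[H1 H2] H3].
  have [k hk] := period_point a x T0.
  rewrite (H2 k) (H1 k) H3 ?mm; first by ring.
  by rewrite in_itv /=; move: hk => /andP[h1 h2]; apply/andP; split; lra.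
have f0 : {ae mu, forall x, x \in `[a, a + (2 * B - T)] -> f x = 0}.
  move: (aeI (aeI hf hh) (aeI hw (ae_shift T hw))); apply: aeS => x [[H1 H2] [H3 H4]] xI.
  move: xI; rewrite in_itv /= => /andP[x1 x2].
  have e1 : h x = c * f x by apply: H3; rewrite in_itv /=; apply/andP; split; lra.
  have e2 : h (x + T) = c * f (x + T) by apply: H4; rewrite in_itv /=; apply/andP; split; lra.
  have : c * (m - m') * f (x + T) = 0.
    have -> : c * (m - m') * f (x + T) = c * (m * f (x + T)) - m' * (c * f (x + T)) by ring.
    by rewrite -H1 -e2 -H2 e1 subrr.
  move=> /eqP; rewrite mulf_eq0 mulf_eq0 (negbTE c0) subr_eq0 (negbTE mm) /= => /eqP f1.
  by rewrite H1 f1 mulr0.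
have [BT|TB'] := ltP B T; first by case: (nsep BT); exists a.
have z : {ae mu, forall x, f x = 0}.
  apply: (qper_eq0 (a := a) T0 m0 hf); move: f0; apply: aeS => x H xI; apply: H.
  move: xI; rewrite !in_itv /= => /andP[h1 h2]; apply/andP; split; lra.
have z' : {ae mu, forall x, h x = 0}.
  apply: (qper_eq0 (a := a) T0 m'0 hh); move: (aeI hw z); apply: aeS => x [H H0] xI.
  rewrite H ?H0 ?mulr0 //; move: xI; rewrite !in_itv /= => /andP[h1 h2]; apply/andP; split; lra.
by move: (aeI z z'); apply: aeS => x [-> ->]; rewrite mulr0.
Qed.

(** Reflection replaces the multiplier by its inverse, and conjugation restores it because it has
    modulus 1. *)
Lemma qper_reflect T m f t : nsq m = 1 -> qper T m f -> qper T m (fun x => conjc (f (2 * t - x))).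
Proof.
move=> m1 /(ae_refl (2 * t - T)); apply: aeS => x.
rewrite (_ : 2 * t - T - x + T = 2 * t - x); last by ring.
rewrite (_ : 2 * t - (x + T) = 2 * t - T - x) => [->|]; last by ring.
by rewrite conjcM mulrA nsqJE m1 mul1r.
Qed.

Lemma nonseparable_reflect L f t : nonseparable_by L f ->
  nonseparable_by L (fun x => conjc (f (2 * t - x))).
Proof.
move=> h [a H]; apply: h; exists (2 * t - a - L).
move: (ae_refl (2 * t) H); apply: aeS => x H' xI.
rewrite -[f x]conjcK; rewrite (_ : x = 2 * t - (2 * t - x)); last by ring.
by rewrite H' ?conjc0 //; move: xI; rewrite !in_itv /= => /andP[h1 h2]; apply/andP; split; lra.
Qed.

End QuasiPeriodic.

(** * Rigidity under an irrational translation *)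

Section Rigidity.
Variable R : realType.
Local Notation mu := (@lebesgue_measure R).
Implicit Types (f h : R -> R[i]) (m c : R[i]).

Lemma polar m : nsq m = 1 -> exists al : R, m = ei al.
Proof.
case: m => a b; rewrite /nsq /= => ab.
have a1 : -1 <= a <= 1.
  have : a ^+ 2 <= 1 by rewrite -ab lerDl sqr_ge0.
  rewrite -ler_norml => a2; rewrite leNgt; apply/negP => a3; move: a2; apply/negP; rewrite -ltNge.
  by rewrite -[a ^+ 2]real_normK ?num_real // exprn_egt1.
have ca : cos (acos a) = a by apply: acosK; rewrite in_itv.
have sb : `|b| = sin (acos a).
  by rewrite sin_acos // -sqrtr_sqr; congr Num.sqrt; rewrite -ab; ring.
exists (if 0 <= b then acos a else - acos a).
apply: complex_ext; rewrite /ei /cexp /= expR0 !mul1r.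
  by case: ifP => _; rewrite ?cosN ca.
have [b0|b0] := leP 0 b; first by rewrite -sb ger0_norm.
by rewrite sinN -sb ltr0_norm // opprK.
Qed.

Lemma ei2pi_int (k : int) : ei (2 * pi * k%:~R) = 1 :> R[i].
Proof.
have e1 : ei (2 * pi) = 1 :> R[i].
  by rewrite /ei /cexp /= expR0 !mul1r mulr_natl cos2pi sin2pi.
have en (n : nat) : ei (2 * pi * n%:R) = 1 :> R[i].
  elim: n => [|n IH]; first by rewrite mulr0 ei0.
  by rewrite -[n.+1%:R]natr1 mulrDr mulr1 eiD IH e1 mulr1.
case: k => n; first exact: en.
by rewrite NegzE mulrNz mulrN -eiJ -pmulrn en conjc1.
Qed.

Lemma ei_eq1 (x : R) : ei x = 1 -> exists k : int, x = 2 * pi * k%:~R.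
Proof.
move=> h; have pp : (0 : R) < pi := pi_gt0 R.
have [k /andP[k1 k2]] := @period_point R (2 * pi) 0 x (mulr_gt0 (ltr0Sn R 1) pp).
exists (- k); suff : x + k%:~R * (2 * pi) = 0 by rewrite mulrNz; lra.
have : ei (x + k%:~R * (2 * pi)) = 1 :> R[i].
  by rewrite eiD h mul1r [_ * (2 * pi)]mulrC ei2pi_int.
move: (x + _) k1 k2 => y k1 k2; rewrite /ei /cexp /= expR0 !mul1r => -[cy _].
have [yp|yp] := leP y pi.
  by apply: (@cos_inj R); rewrite ?cos0 // in_itv /=; apply/andP; split; lra.
suff : 2 * pi - y = 0 by lra.
apply: (@cos_inj R); rewrite ?cos0 ?in_itv /=; try by apply/andP; split; lra.
by rewrite mulr_natl addrC cosD2pi cosN.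
Qed.


(** With half-open intervals the translates of a period tile the line without overlap, so indicator
    functions split exactly. *)
Definition locint f : Prop := forall a b : R, cintegrable (fun x => f x * cindic `[a, b[%classic x).

Lemma cindic_itv (i : interval R) (x : R) : cindic [set` i] x = ((x \in i)%:R)%:C.
Proof. by rewrite /cindic indicE mem_setE. Qed.

Lemma clocally_meas f : clocally_integrable f -> cmeasurable f.
Proof. by move=> [[f1 _ _] [f2 _ _]]. Qed.

Lemma clocally_locint f : clocally_integrable f -> locint f.
Proof.
move=> hf a b; have mf := clocally_meas hf.
have aux (u : R -> R) : locally_integrable [set: R] u ->
    mu.-integrable [set: R] (fun x => (u x * \1_(`[a, b]%classic : set R) x)%:E).
  move=> [mu1 _ h]; have mI : measurable (`[a, b]%classic : set (measurableTypeR R)) by exact: measurable_itv.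
  have hi : mu.-integrable `[a, b] (fun x => (u x)%:E).
    apply/integrableP; split; last by apply: h => //; exact: segment_compact.
    by apply/measurable_EFinP; exact: (measurable_funS measurableT).
  have := (@integrable_mkcond _ _ R mu _ _ mI).1 hi; congr (_.-integrable _ _).
  by apply/funext => x; rewrite patchE indicE; case: ifP; rewrite ?mulr1 ?mulr0.
have h : cintegrable (fun x => f x * cindic `[a, b]%classic x).
  case: hf => /aux h1 /aux h2; split.
    by under eq_fun do rewrite cReM /= mulr0 subr0.
  by under eq_fun do rewrite cImM /= mulr0 add0r.
have := cintegrableM h (cmeasurable_indic (measurable_itv `[a, b[)) (@n1_indic _ `[a, b[%classic).
congr cintegrable; apply/funext => x; rewrite -mulrA !cindic_itv; congr (_ * _).
rewrite !in_itv /=; have [_|_] := leP a x => /=; last by rewrite mul0r.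
by have [|] := ltP x b => xb; rewrite ?mulr0 // mulr1 ltW.
Qed.

Lemma locint_mul f k M : cmeasurable k -> (forall x, n1 (k x) <= M) -> locint f ->
  locint (fun x => f x * k x).
Proof.
move=> mk kM h a b; have := cintegrableM (h a b) mk kM; congr cintegrable.
by apply/funext => x; ring.
Qed.

Lemma locintB f h : locint f -> locint h -> locint (fun x => f x - h x).
Proof.
move=> h1 h2 a b; have := cintegrableB (h1 a b) (h2 a b); congr cintegrable.
by apply/funext => x; ring.
Qed.

Lemma locint_cst c : locint (fun _ => c).
Proof.
move=> a b; have h : cintegrable (@cindic R `[a, b[%classic).
  split; first exact: (@integrable_indic_itv R a b true true).
  exact: integrable0.
have := cintegrableZ c h; congr cintegrable; apply/funext => x; exact: mulrC.
Qed.

Section PeriodIntegral.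
Variable T : R.
Hypothesis T0 : 0 < T.
Local Notation per F := (cintegral (fun x => F x * cindic `[0, T[%classic x)).

Lemma period_integral_shift F s : 0 <= s < T -> qper T 1 F -> locint F ->
  cintegral (fun x => F x * cindic `[s, s + T[%classic x) = per F.
Proof.
move=> /andP[s0 sT] hF lF; have Tp := T0.
have split_ind (a b' c' : R) : a <= b' <= c' -> cintegral (fun x => F x * cindic `[a, c'[%classic x) =
  cintegral (fun x => F x * cindic `[a, b'[%classic x) + cintegral (fun x => F x * cindic `[b', c'[%classic x).
  move=> /andP[ab bc]; rewrite -cintegralD //; congr cintegral; apply/funext => x.
  rewrite -mulrDr; congr (_ * _); rewrite !cindic_itv !in_itv /=.
  have [h1|h1] := leP a x; have [h2|h2] := leP b' x; have [h3|h3] := ltP x c' => /=;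
    rewrite ?addr0 ?add0r //; exfalso; lra.
rewrite (@split_ind s T (s + T)); last by apply/andP; split; lra.
rewrite (@split_ind 0 s T); last by apply/andP; split; lra.
rewrite addrC; congr (_ + _).
rewrite -(cintegral_shift T) //; apply: cintegral_ae => //.
  exact: (@cintegrable_shift _ T (fun x => F x * cindic `[T, (s + T)[%classic x)).
move: hF; apply: aeS => x ->; rewrite mul1r !cindic_itv !in_itv /=.
by rewrite lerDr ltrD2r.
Qed.

(** The integral over a period does not change when the period is translated by [s]. Applied to
    Fourier coefficients in [rigid], this kills those whose multiplier is not 1. *)
Lemma period_integral_eigen F s c : 0 <= s < T -> qper T 1 F -> locint F ->
  {ae mu, forall x, F x = c * F (x + s)} -> per F = c * per F.
Proof.
move=> sT hF lF hc; rewrite -[in RHS](period_integral_shift sT hF lF) [RHS]mulrC.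
have hs : cintegrable (fun x => F x * cindic `[s, (s + T)[%classic x * c).
  by apply: cintegrableZ; exact: lF.
rewrite -cintegralZ; last exact: lF.
rewrite -(cintegral_shift s hs); apply: cintegral_ae => //.
  exact: (cintegrable_shift s hs).
move: hc; apply: aeS => x ->; rewrite !cindic_itv !in_itv /=.
rewrite lerDr [x + s]addrC ltrD2l; ring.
Qed.

End PeriodIntegral.

End Rigidity.

Section RigidityTheorem.
Variable R : realType.
Local Notation mu := (@lebesgue_measure R).
Implicit Types (f h : R -> R[i]) (m c : R[i]).

Lemma ei_neq0 (x : R) : ei x != 0.
Proof. exact: cexp_neq0. Qed.

Lemma cmeasurable_ei_lin (a : R) : cmeasurable (fun x : R => ei (a * x)).
Proof.
by apply: cmeasurable_ei; apply: measurable_funM; [exact: measurable_cst|exact: measurable_id].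
Qed.

Lemma locint_ei f (a : R) : locint f -> locint (fun x => f x * ei (a * x)).
Proof. by apply: (locint_mul (M := 2)); [exact: cmeasurable_ei_lin|move=> x; exact: n1_ei]. Qed.

Section Rigid.
Variable T : R.
Hypothesis T0 : 0 < T.
Local Notation per F := (cintegral (fun x => F x * cindic `[0, T[%classic x)).

Lemma qper_eiM f (k : int) (m : R[i]) : qper T m f ->
  qper T m (fun x => f x * ei (k%:~R * (2 * pi / T) * x)).
Proof.
apply: aeS => x ->; rewrite (mulrDr _ x T) eiD.
have -> : k%:~R * (2 * pi / T) * T = 2 * pi * k%:~R :> R by field; rewrite gt_eqF.
by rewrite ei2pi_int mulr1 mulrA.
Qed.

Lemma qper_cst c : qper T 1 (fun _ => c).
Proof. by apply: ae_all => x; rewrite mul1r. Qed.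

Lemma per_fourier0 F : locint F -> qper T 1 F ->
  (forall k : int, per (fun x => F x * ei (k%:~R * (2 * pi / T) * x)) = 0) ->
  {ae mu, forall x, x \in `[0, T[ -> F x = 0}.
Proof.
move=> lF pF H; have Tp := T0.
have := @fourier_unique R (fun x => F x * cindic `[0, T[%classic x) (T / 2) (T / 2).
move=> /(_ (divr_gt0 T0 (ltr0Sn R 1)) (lF 0 T)) hh.
have : {ae mu, forall x, F x * cindic `[0, T[%classic x = 0}.
  apply: hh.
    apply: ae_all => x; rewrite cindic_itv => xI; rewrite (_ : x \in `[0, T[ = false) ?mulr0 //.
    apply/negbTE; apply: contra xI; rewrite !in_itv /= => /andP[x1 x2]; apply/andP; split; lra.
  move=> k; rewrite -[RHS](H k); congr cintegral; apply/funext => x.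
  have -> : k%:~R * (pi / (T / 2) * x) = k%:~R * (2 * pi / T) * x by field; rewrite gt_eqF.
  ring.
by apply: aeS => x; rewrite cindic_itv => + xI; rewrite xI mulr1.
Qed.

Lemma per_cst c : per (fun _ => c) = c * T%:C.
Proof.
have h : cintegrable (@cindic R `[0, T[%classic).
  have := @locint_cst R 1 0 T; congr cintegrable; apply/funext => x; exact: mul1r.
under [fun x => c * _]eq_fun do rewrite mulrC.
rewrite cintegralZ // mulrC; congr (_ * _); apply: complex_ext => /=; last first.
  by rewrite /Rintegral /= integral0.
rewrite /Rintegral integral_indic // setIT.
have := lebesgue_measure_itv `[0, T[; rewrite /= lte_fin T0 -EFinB subr0 => e.
by rewrite (_ : mu _ = T%:E).
Qed.

(* After multiplication by an exponential [f] is [T]-periodic, and a translation by [s] multiplies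
   its [k]-th Fourier coefficient by a number that determines [k], since [s / T] is irrational:
   at most one coefficient is not zero. *)
Lemma rigid m c f s : nsq m = 1 -> locint f -> qper T m f ->
  {ae mu, forall x, f x = c * f (x + s)} -> @irrational R (s / T) ->
  exists (d : R[i]) (kappa : R), {ae mu, forall x, f x = d * ei (kappa * x)}.
Proof.
move=> m1 lf pf hc irr; have Tp := T0.
have m0 : m != 0 by rewrite -nsq_eq0 m1 oner_eq0.
(* [s] is reduced modulo [T]: adding a multiple of [T] changes [c] by a power of [m] and [s / T] by
   an integer. *)
wlog s0T : s c hc irr / 0 <= s < T.
  move=> W; have [k hk] := period_point 0 s T0; rewrite add0r in hk.
  apply: (W (s + k%:~R * T) (c * m ^ k)) => //.
    move: (aeI hc (ae_shift s (qper_int m0 pf))); apply: aeS => x [-> /(_ k) ->].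
    by rewrite mulrA -addrA.
  move=> [q _ hq]; apply: irr; exists (q - k%:~R) => //.
  rewrite rmorphB /= rmorph_int hq; field; by rewrite gt_eqF.
have [al mal] := polar m1.
pose th : R := 2 * pi / T.
(* Since [m = ei al], this exponential absorbs the multiplier and makes [F] periodic. *)
pose F x := f x * ei (al / T * x).
have lF : locint F by exact: locint_ei.
have pF : qper T 1 F.
  move: pf; apply: aeS => x h; rewrite mul1r /F h (mulrDr _ x T) divfK ?gt_eqF // eiD mal; ring.
pose E (k : int) x : R[i] := ei (k%:~R * th * x).
have lE G k : locint G -> locint (fun x => G x * E k x) by move=> h; exact: locint_ei.
have pE G k : qper T 1 G -> qper T 1 (fun x => G x * E k x) by move=> h; exact: qper_eiM.
pose a k := per (fun x => F x * E k x).
have eN y : ei (- y) * ei y = 1 :> R[i] by rewrite -eiD addNr ei0.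
pose c1 := c * ei (- (al / T * s)).
have aE k : a k = c1 * ei (- (k%:~R * th * s)) * a k.
  apply: (period_integral_eigen T0 s0T); [exact: pE|exact: lE|].
  move: hc; apply: aeS => x h; rewrite /F /E h /c1 !(mulrDr _ x s) !eiD.
  rewrite -(mulr1 (c * _)) -(eN (al / T * s)) -[LHS]mulr1 -(eN (k%:~R * th * s)); ring.
have uniq k j : ei (- (k%:~R * th * s)) = ei (- (j%:~R * th * s)) -> k = j.
  move=> h; apply: contrapT => kj.
  have : ei ((j - k)%:~R * th * s) = 1.
    rewrite intrB mulrBl mulrBl eiD h -eiD addrN ei0 //.
  move=> /ei_eq1 [n hn].
  have jk : (j - k)%:~R != 0 :> R by rewrite intr_eq0 subr_eq0; apply/eqP => e; apply: kj.
  apply: irr; exists (n%:~R / (j - k)%:~R) => //.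
  rewrite fmorph_div /= !rmorph_int.
  apply: (mulIf jk); rewrite divfK //.
  have pp : (2 * pi : R) != 0 by rewrite mulf_neq0 // ?gt_eqF ?pi_gt0.
  apply: (mulfI pp); rewrite -hn /th; field; by rewrite gt_eqF.
have [[k0 ak0]|none] := pselect (exists k, a k != 0); last first.
  exists 0, 0; suff : {ae mu, forall x, f x = 0} by apply: aeS => x ->; rewrite mul0r.
  apply: (qper_eq0 (a := 0) T0 m0 pf).
  have : {ae mu, forall x, x \in `[0, T[ -> F x = 0}.
    by apply: per_fourier0 => // k; apply/eqP; apply: contrapT => /negP h; apply: none; exists k.
  apply: aeS => x H; rewrite add0r => /H /eqP; rewrite mulf_eq0 (negbTE (ei_neq0 _)) orbF.
  by move/eqP.
pose d := a k0 / T%:C; exists d, (- (k0%:~R * th) - al / T).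
have T0' : T%:C != 0 :> R[i] by apply/eqP => -[e]; move: Tp; rewrite e ltxx.
have c1k k : a k != 0 -> c1 * ei (- (k%:~R * th * s)) = 1.
  by move=> ak; apply: (mulIf ak); rewrite -aE mul1r.
pose G x := d * E (- k0) x.
have lG : locint G by apply: lE; exact: locint_cst.
have pG : qper T 1 G by apply: pE; exact: qper_cst.
have GE k : per (fun x => G x * E k x) = if k == k0 then a k0 else 0.
  have GEk x : G x * E k x = d * E (k - k0) x.
    by rewrite /G /E -mulrA -eiD -!mulrDl -intrD [- k0 + k]addrC.
  under eq_fun do rewrite GEk.
  case: eqP => [->|/eqP kk0].
    have E1 x : d * E (k0 - k0) x = d by rewrite /E subrr !mul0r ei0 mulr1.
    under eq_fun do rewrite E1.
    by rewrite per_cst /d divfK.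
  (* Orthogonality of the exponentials also comes from the translation by [s], which multiplies an
     exponential of nonzero frequency by a number other than 1. *)
  have h := @period_integral_eigen R T T0 (fun x => d * E (k - k0) x) s (ei (- ((k - k0)%:~R * th * s))) s0T
     (pE _ _ (qper_cst d)) (lE _ _ (locint_cst d)).
  have {}h : per (fun x => d * E (k - k0) x) = ei (- ((k - k0)%:~R * th * s)) * per (fun x => d * E (k - k0) x).
    apply: h; apply: ae_all => x; rewrite /E (mulrDr _ x s) eiD.
    by rewrite -[LHS]mulr1 -(eN ((k - k0)%:~R * th * s)); ring.
  apply/eqP; apply: contrapT => /negP h0.
  have : 1 = ei (- ((k - k0)%:~R * th * s)) by apply: (mulIf h0); rewrite mul1r {1}h.
  move=> /esym h1; have : k - k0 = 0 by apply: uniq; rewrite h1 !mul0r oppr0 ei0.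
  by move/eqP; rewrite subr_eq0 (negbTE kk0).
have : {ae mu, forall x, x \in `[0, T[ -> F x - G x = 0}.
  apply: per_fourier0; [exact: locintB| |].
    by move: (aeI pF pG); apply: aeS => x [h1 h2]; rewrite mul1r {1}h1 {1}h2 !mul1r.
  move=> k.
  have -> : per (fun x => (F x - G x) * ei (k%:~R * (2 * pi / T) * x)) =
     per (fun x => F x * E k x) - per (fun x => G x * E k x).
    rewrite -cintegralB; try exact: lE.
    by congr cintegral; apply/funext => x; rewrite /E; ring.
  rewrite GE -/(a k); case: eqP => [->|kk]; first by rewrite subrr.
  rewrite subr0; apply/eqP; apply: contrapT => /negP ak; apply: kk.
  apply: uniq; have := c1k _ ak; rewrite -(c1k _ ak0) => /mulfI; apply.
  apply/eqP => c10; move: (c1k _ ak); rewrite c10 mul0r => /esym/eqP; by rewrite oner_eq0.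
move=> FG.
have pD : qper T m (fun x => f x - d * ei ((- (k0%:~R * th) - al / T) * x)).
  have e : ei ((- (k0%:~R * th) - al / T) * T) * m = 1.
    rewrite mal -eiD -(ei2pi_int R (- k0)); congr ei.
    by rewrite /th mulrNz; field; rewrite gt_eqF.
  move: pf; apply: aeS => x h; rewrite mulrBr -h; congr (_ - _).
  by rewrite (mulrDr _ x T) eiD -[LHS]mulr1 -e; ring.
have : {ae mu, forall x, f x - d * ei ((- (k0%:~R * th) - al / T) * x) = 0}.
  apply: (qper_eq0 (a := 0) T0 m0 pD).
  move: FG; apply: aeS => x H; rewrite add0r => /H h.
  apply: (mulIf (ei_neq0 (al / T * x))); rewrite mul0r -h mulrBl /F /G; congr (_ - _).
  rewrite -(mulrA d) -eiD; congr (_ * ei _); rewrite mulrNz; ring.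
by apply: aeS => x /subr0_eq.
Qed.

End Rigid.
End RigidityTheorem.

Section Uniqueness.
Variable R : realType.
Local Notation mu := (@lebesgue_measure R).
Implicit Types (f g h : R -> R[i]) (m c : R[i]).

Lemma irrationalM2 (x : R) : @irrational R x -> @irrational R (2 * x).
Proof.
move=> h [q _ hq]; apply: h; exists (q / 2) => //.
by rewrite fmorph_div /= hq rmorph_nat; field.
Qed.

Lemma reflected_extension B T m m' lam f g t : 0 < B -> 0 < T -> T < 2 * B ->
  nsq m = 1 -> m' != 0 -> lam != 0 -> qper T m f -> qper T m' g ->
  (B < T -> nonseparable_by (2 * B - T) f) ->
  {ae mu, forall x, x \in `[t - B, t + B] -> g x = lam * conjc (f (2 * t - x))} ->
  {ae mu, forall x, g x = lam * conjc (f (2 * t - x))}.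
Proof.
move=> B0 T0 TB m1 m'0 lam0 pf pg nsep hw.
have m0 : m != 0 by rewrite -nsq_eq0 m1 oner_eq0.
apply: (extension (a := t - B) B0 T0 TB m0 m'0 lam0 (qper_reflect t m1 pf) pg).
  by move=> /nsep; exact: nonseparable_reflect.
by move: hw; rewrite (_ : t - B + 2 * B = t + B) //; ring.
Qed.

Theorem uniqueness B phi b omega T f t0 t1 : 0 < B -> admissible_window B phi ->
  0 < b -> b <= 1 / (2 * B) -> admissible_frequencies B omega -> 0 < T -> T < 2 * B ->
  quasi_periodic T f -> stft_defined phi f t0 -> stft_defined phi f t1 ->
  @irrational R ((t1 - t0) / T) -> (B < T -> nonseparable_by (2 * B - T) f) ->
  determined_up_to_phase phi (modulated_window phi b) omega T t0 t1 f.
Proof.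
move=> B0 phiP b0 bB om T0 TB [lf [m /norm_eq1_nsq m1 pf]] df0 df1 irr nsep.
move=> g [lg [m' /norm_eq1_nsq m'1 pg]] dg0 _ dg1 _ same0 same1.
have nz (z : R[i]) : nsq z = 1 -> z != 0 by move=> h; rewrite -nsq_eq0 h oner_eq0.
have mf := clocally_meas lf; have mg := clocally_meas lg.
have done_ lam : nsq lam = 1 -> {ae mu, forall x, g x = lam * f x} ->
    exists2 lam : R[i], `|lam| = 1 & {ae mu, forall x, f x = lam * g x}.
  move=> l1 h; exists (conjc lam); first by apply/norm_eq1_nsq; rewrite nsqJ.
  by move: h; apply: aeS => x ->; rewrite mulrA [conjc _ * _]mulrC nsqJE l1 mul1r.
have direct t lam : nsq lam = 1 ->
    {ae mu, forall x, x \in `[t - B, t + B] -> g x = lam * f x} ->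
    exists2 lam : R[i], `|lam| = 1 & {ae mu, forall x, f x = lam * g x}.
  move=> l1 h; apply: (done_ lam) => //.
  apply: (extension (a := t - B) B0 T0 TB (nz _ m1) (nz _ m'1) (nz _ l1) pf pg nsep).
  by move: h; rewrite (_ : t - B + 2 * B = t + B) //; ring.
have [lam0 l0 [h0|h0]] := measurement_retrieval B0 phiP b0 bB om mf mg df0 dg0 same0.
  exact: (direct t0 lam0).
have [lam1 l1 [h1|h1]] := measurement_retrieval B0 phiP b0 bB om mf mg df1 dg1 same1.
  exact: (direct t1 lam1).
have r0 := reflected_extension B0 T0 TB m1 (nz _ m'1) (nz _ l0) pf pg nsep h0.
have r1 := reflected_extension B0 T0 TB m1 (nz _ m'1) (nz _ l1) pf pg nsep h1.
have hc : {ae mu, forall x, f x = lam0 * conjc lam1 * f (x + 2 * (t1 - t0))}.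
  move: (ae_refl (2 * t0) (aeI r0 r1)); apply: aeS => x [-> /(congr1 (fun z => conjc (conjc lam0 * z)))].
  rewrite (_ : 2 * t0 - (2 * t0 - x) = x); last by ring.
  rewrite (_ : 2 * t1 - (2 * t0 - x) = x + 2 * (t1 - t0)); last by ring.
  by rewrite mulrA [conjc lam0 * lam0]mulrC nsqJE l0 mul1r conjcK !conjcM !conjcK => ->; ring.
have irr2 : @irrational R (2 * (t1 - t0) / T) by rewrite -mulrA; exact: irrationalM2.
have [d [kappa hf]] := rigid T0 m1 (clocally_locint lf) pf hc irr2.
have [d0|d0] := eqVneq d 0.
  apply: (done_ 1); first by rewrite nsq1.
  have f0 : {ae mu, forall x, f x = 0} by move: hf; apply: aeS => x ->; rewrite d0 mul0r.
  move: (aeI f0 (aeI r0 (ae_refl (2 * t0) f0))); apply: aeS => x [-> [-> ->]].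
  by rewrite conjc0 !mulr0.
(* Reflecting [d * ei (kappa * x)] about [t0] and conjugating gives [conjc d * ei (- (2 * kappa *
   t0)) * ei (kappa * x)], a unimodular multiple of it. *)
apply: (done_ (lam0 * conjc d * ei (- (2 * kappa * t0)) / d)).
  by rewrite !nsqM l0 nsqJ nsq_ei nsqV mul1r mulr1 divff // nsq_eq0.
move: (aeI hf (aeI r0 (ae_refl (2 * t0) hf))); apply: aeS => x [-> [-> ->]].
rewrite conjcM eiJ (_ : - (kappa * (2 * t0 - x)) = - (2 * kappa * t0) + kappa * x); last by ring.
by rewrite eiD; field.
Qed.

End Uniqueness.

(** * Counterexamples *)

Section RationalRatio.
Variable R : realType.
Local Notation mu := (@lebesgue_measure R).
Implicit Types (f g h phi w : R -> R[i]) (m c : R[i]).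

Lemma clocally_bounded f M : cmeasurable f -> (forall x, n1 (f x) <= M) -> clocally_integrable f.
Proof.
move=> [f1 f2] fM.
have M0 : 0 <= M := le_trans (n1_ge0 _) (fM 0).
have aux (u : R -> R) : measurable_fun [set: R] u -> (forall x, `|u x| <= M) ->
    locally_integrable [set: R] u.
  move=> mu_ uM; split=> //; first exact: openT.
  move=> K _ cK; have mK : measurable (K : set (measurableTypeR R)) := compact_measurable cK.
  apply: (@le_lt_trans _ _ (M%:E * mu K)%E).
    apply: (@integral_le_bound _ _ _ mu K (fun x => (u x)%:E) M%:E mK) => //.
      by apply/measurable_EFinP; exact: (measurable_funS measurableT).
    by apply: ae_all => x _; rewrite lee_fin.
  by rewrite lte_mul_pinfty // ?lee_fin //; exact: compact_finite_measure.
split; apply: aux => // x; apply: le_trans (fM x); rewrite /n1 ?lerDl ?lerDr //.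
Qed.

Lemma ae_itv_false (a b : R) : a < b -> ~ {ae mu, forall x : R, x \notin `[a, b]}.
Proof.
move=> ab [A [mA A0 H]].
have mI : measurable (`[a, b]%classic : set (measurableTypeR R)) by exact: measurable_itv.
have sub : (`[a, b]%classic : set R) `<=` A.
  by move=> x; rewrite /= => xI; apply: H => /= h; move: h; rewrite xI.
have : (mu `[a, b] <= mu A)%E by apply: le_measure; rewrite ?inE.
rewrite A0; have := lebesgue_measure_itv `[a, b]; rewrite /= lte_fin ab => ->.
by rewrite -EFinB lee_fin leNgt subr_gt0 ab.
Qed.

Lemma stft_reflect w f t (xi : R) : {ae mu, forall x, conjc (w (- x)) = w x} ->
  cintegrable (fun x => f x * conjc (w (x - t))) ->
  cintegrable (fun x => conjc (f (2 * t - x)) * conjc (w (x - t))) ->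
  `|stft w (fun x => conjc (f (2 * t - x))) t xi| = `|stft w f t xi|.
Proof.
move=> hw hf hg; apply/norm_eq_nsq.
have me := cmeasurable_cis2pi xi.
have nc (x : R) : n1 (cis2pi (- (x * xi))) <= 2 := n1_cis2pi _.
pose G x := f x * conjc (w (x - t)) * cis2pi (- (x * xi)).
have iG : cintegrable G by apply: (cintegrableM (M := 2)).
have iG' : cintegrable (fun x => conjc (G (2 * t - x))).
  by apply: cintegrableJ; exact: cintegrable_refl.
have -> : stft w (fun x => conjc (f (2 * t - x))) t xi =
    cintegral (fun x => conjc (G (2 * t - x)) * cis2pi (- (2 * t * xi))).
  rewrite /stft; apply: cintegral_ae; [exact: (cintegrableM (M := 2))|exact: cintegrableZ|].
  move: (ae_shift (- t) hw); apply: aeS => x h.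
  rewrite /G !conjcM -h !conjcK (_ : 2 * t - x - t = - (x - t)); last by ring.
  rewrite !cis2pi_ei eiJ -[RHS]mulrA -eiD; congr (_ * ei _); ring.
rewrite cintegralZ // cis2pi_ei nsqM nsq_ei mulr1 cintegralJ ?nsqJ; last exact: cintegrable_refl.
by rewrite (cintegral_refl (2 * t) iG).
Qed.

Section RationalWindow.
Variables (B b T : R) (phi : R -> R[i]).
Hypotheses (phiP : admissible_window B phi) (T0 : 0 < T).
Local Notation psi := (modulated_window phi b).

Lemma modulated_window_hermitian : {ae mu, forall x, conjc (psi (- x)) = psi x}.
Proof.
have [_ _ + _] := phiP; apply: aeS => x h.
rewrite /modulated_window conjcM h conjcD conjcN conjc1 !cis2pi_ei eiJ.
by congr (_ * (ei _ - 1)); ring.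
Qed.

Lemma modulated_window_integrable : cintegrable psi.
Proof.
have [h _ _ _] := phiP; apply: (cintegrableM (M := 2 + 1)) => //.
  apply: cmeasurableB; last exact: cmeasurable_cst.
  under eq_fun do rewrite cis2pi_ei; apply: cmeasurable_ei.
  apply: measurable_funM; first exact: measurable_cst.
  exact: measurable_mulr.
by move=> x; apply: (le_trans (n1B _ _)); rewrite lerD ?cis2pi_ei ?n1_ei // n1_1.
Qed.

Lemma bounded_stft_defined w f M t : cintegrable w -> cmeasurable f -> (forall x, n1 (f x) <= M) ->
  stft_defined w f t.
Proof.
move=> hw mf fM; have := cintegrableM (cintegrable_shift (- t) hw) mf fM.
by congr cintegrable; apply/funext => x; rewrite mulrC.
Qed.

Lemma bounded_stft_integrable w f M t : cintegrable w -> cmeasurable f -> (forall x, n1 (f x) <= M) ->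
  cintegrable (fun x => f x * conjc (w (x - t))).
Proof.
move=> hw mf fM; apply: stft_integrable => //; first exact: cintegrable_meas.
exact: (bounded_stft_defined t hw mf fM).
Qed.

Lemma reflect_same_measurements omega t f M : cmeasurable f -> (forall x, n1 (f x) <= M) ->
  same_measurements phi psi omega t f (fun x => conjc (f (2 * t - x))).
Proof.
move=> mf fM; have [ip _ hp _] := phiP.
have mg : cmeasurable (fun x => conjc (f (2 * t - x))).
  by apply: cmeasurableJ; apply: cmeasurable_comp => //; exact: measurable_refl.
have gM x : n1 (conjc (f (2 * t - x))) <= M by rewrite n1J.
have ips := modulated_window_integrable.
move=> n _; split.
  exact: (stft_reflect _ hp (bounded_stft_integrable t ip mf fM) (bounded_stft_integrable t ip mg gM)).
exact: (stft_reflect _ modulated_window_hermitian (bounded_stft_integrable t ips mf fM)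
  (bounded_stft_integrable t ips mg gM)).
Qed.

(* The signal [f = 2 + i exp (2 pi i q (x - t0) / T)], where [(t1 - t0) / T = p / q], and its
   reflection [conjc (f (2 t0 - x))], which is also its reflection at [t1]. *)
Theorem rational_failure omega t0 t1 : T < 2 * B -> @rational R ((t1 - t0) / T) ->
  exists f : R -> R[i],
    [/\ quasi_periodic T f, stft_defined phi f t0, stft_defined phi f t1,
      (B < T -> nonseparable_by (2 * B - T) f) &
      ~ determined_up_to_phase phi psi omega T t0 t1 f].
Proof.
move=> TB /rationalP[p [q0 pq0]]; have [ip _ hp _] := phiP.
(* The denominator given by [rationalP] may be 0, in which case the quotient is 0 and [0 / 1]
   replaces it. *)
have [q [q_gt0 [p' pq]]] : exists q : nat, (0 < q)%N /\ exists p : int, t1 - t0 = p%:~R / q%:R * T.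
  case: q0 pq0 => [|q] h; [exists 1%N|exists q.+1]; split=> //.
    exists 0; rewrite mulr0n invr0 mulr0 in h; rewrite !mul0r.
    by apply/eqP; move/eqP: h; rewrite mulf_eq0 invr_eq0 (gt_eqF T0) orbF.
  by exists p; rewrite -h divfK // gt_eqF.
have q0' : (q%:R : R) != 0 by rewrite pnatr_eq0 -lt0n.
have qp : (0 : R) < q%:R by rewrite ltr0n.
pose z x : R[i] := ei (2 * pi * q%:R / T * (x - t0)).
pose f x := 2 + (0 +i* 1) * z x.
pose g x := conjc (f (2 * t0 - x)).
have gE x : g x = 2 - (0 +i* 1) * z x.
  rewrite /g /f conjcD conjcM /z eiJ; congr (_ + _).
    by rewrite (rmorph_nat (@conjc R) 2).
  rewrite -[RHS]mulNr; congr (_ * ei _); first by apply: complex_ext; rewrite /= ?oppr0.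
  by field; rewrite gt_eqF.
have g1E x : g x = conjc (f (2 * t1 - x)).
  rewrite /g /f; congr (conjc (_ + _ * _)); rewrite /z.
  rewrite (_ : _ * (2 * t1 - x - t0) = 2 * pi * q%:R / T * (2 * t0 - x - t0) + 2 * pi * (2 * p')%:~R).
    by rewrite eiD ei2pi_int mulr1.
  rewrite (_ : t1 = t0 + p'%:~R / q%:R * T); last by rewrite -pq; ring.
  by rewrite intrM; field; rewrite q0' gt_eqF.
have fM x : n1 (f x) <= n1 2 + n1 (0 +i* 1 : R[i]) * 2.
  by apply: (le_trans (n1D _ _)); rewrite lerD2l; apply: (le_trans (n1M _ _)); rewrite ler_wpM2l ?n1_ge0 // n1_ei.
have mz : cmeasurable z.
  apply: cmeasurable_ei; apply: measurable_funM; first exact: measurable_cst.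
  exact: measurable_subr.
have mf : cmeasurable f.
  apply: cmeasurableD; first exact: cmeasurable_cst.
  by apply: cmeasurableM => //; exact: cmeasurable_cst.
have mg : cmeasurable g.
  by apply: cmeasurableJ; apply: cmeasurable_comp => //; exact: measurable_refl.
have gM x : n1 (g x) <= n1 2 + n1 (0 +i* 1 : R[i]) * 2 by rewrite /g n1J.
have zT x : z (x + T) = z x.
  rewrite /z (_ : _ * (x + T - t0) = 2 * pi * q%:R / T * (x - t0) + 2 * pi * (q%:Z)%:~R).
    by rewrite eiD ei2pi_int mulr1.
  by rewrite -pmulrn; field; rewrite gt_eqF.
have qf : quasi_periodic T f.
  split; first exact: clocally_bounded fM.
  by exists 1; [exact: normr1|apply: ae_all => x; rewrite mul1r /f zT].
have qg : quasi_periodic T g.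
  split; first exact: clocally_bounded gM.
  by exists 1; [exact: normr1|apply: ae_all => x; rewrite mul1r !gE zT].
have ips := modulated_window_integrable.
exists f; split=> //.
- exact: (bounded_stft_defined _ ip mf fM).
- exact: (bounded_stft_defined _ ip mf fM).
- move=> _ [a H]; have aL : a < a + (2 * B - T) by lra.
  apply: (ae_itv_false aL); move: H; apply: aeS => x Hx; apply/negP => /Hx.
  (* [f] vanishes nowhere, since 2 and [i z] have different moduli. *)
  rewrite /f => /eqP; rewrite addr_eq0 => /eqP /(congr1 (@nsq R)).
  by rewrite nsqN nsqM nsq_ei /nsq /= => h; lra.
move=> /(_ g qg (bounded_stft_defined _ ip mg gM) (bounded_stft_defined _ ips mg gM)
   (bounded_stft_defined _ ip mg gM) (bounded_stft_defined _ ips mg gM)).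
move=> /(_ (reflect_same_measurements omega t0 mf fM)).
have : same_measurements phi psi omega t1 f g.
  have := reflect_same_measurements omega t1 mf fM; congr same_measurements.
  by apply/funext => x; rewrite g1E.
move=> h /(_ h) [lam /norm_eq1_nsq l1 H].
(* Equality of [|f|] and [|g|] forces the sine to vanish, but on [t0 + d, t0 + 2 d] its argument
   runs from [pi / 4] to [pi / 2]. *)
pose d := T / (8 * q%:R).
have d0 : 0 < d by rewrite divr_gt0 // mulr_gt0.
have dd : t0 + d < t0 + 2 * d by lra.
apply: (ae_itv_false dd); move: H; apply: aeS => x Hx; apply/negP.
rewrite in_itv /= => /andP[x1 x2]; move: Hx => /(congr1 (@nsq R)).
rewrite nsqM l1 mul1r gE /f /nsq !ReImE /z /ei /cexp /= expR0 => h'.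
have : sin (2 * pi * q%:R / T * (x - t0)) = 0 by lra.
apply/eqP; rewrite gt_eqF //; apply: sin_gt0_pi.
have pp := pi_gt0 R.
have e : 2 * pi * q%:R / T * (x - t0) = pi / 4 * ((x - t0) / d) by rewrite /d; field; rewrite q0' gt_eqF.
have y1 : 1 <= (x - t0) / d by rewrite ler_pdivlMr // mul1r; lra.
have y2 : (x - t0) / d <= 2 by rewrite ler_pdivrMr //; lra.
rewrite e; apply/andP; split; first by rewrite !mulr_gt0 ?invr_gt0 //; lra.
have : pi / 4 * ((x - t0) / d) <= pi / 4 * 2 by rewrite ler_wpM2l // divr_ge0 // ltW.
lra.
Qed.

End RationalWindow.

End RationalRatio.

(** * Window positions at which the transform is defined *)

Section AeStft.
Variable R : realType.
Local Notation mu := (@lebesgue_measure R).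
Implicit Types (f g h phi w : R -> R[i]) (m c : R[i]).

Lemma rint_ae (u v : R -> R) : measurable_fun [set: R] u -> {ae mu, forall x, u x = v x} ->
  mu.-integrable [set: R] (fun x => (v x)%:E) -> mu.-integrable [set: R] (fun x => (u x)%:E).
Proof.
move=> mu_ uv /integrableP[mv hv]; apply/integrableP; split; first exact/measurable_EFinP.
have -> : (\int[mu]_x `|(u x)%:E| = \int[mu]_x `|(v x)%:E|)%E.
  apply: ge0_ae_eq_integral => //.
  - by apply: measurableT_comp => //; exact/measurable_EFinP.
  - exact: measurableT_comp.
  - by move: uv; apply: aeS => x -> _.
by [].
Qed.

Lemma cintegrable_ae f g : cmeasurable f -> {ae mu, forall x, f x = g x} -> cintegrable g ->
  cintegrable f.
Proof.
by move=> [f1 f2] fg [g1 g2]; split; [apply: (rint_ae f1 _ g1)|apply: (rint_ae f2 _ g2)];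
  move: fg; apply: aeS => x ->.
Qed.

(** By Tonelli's theorem the convolution of [n1 f] with the reflection of [n1 w] has finite
    integral, the product of theirs, so it is finite almost everywhere. *)
Lemma ae_convolution_integrable f w : cintegrable f -> cintegrable w ->
  {ae mu, forall t, cintegrable (fun x => f x * w (x - t))}.
Proof.
move=> hf hw; have mf := cintegrable_meas hf; have mw := cintegrable_meas hw.
have rf := cintegrable_n1 hf; have rw := cintegrable_n1 hw.
pose F (p : measurableTypeR R * measurableTypeR R) : \bar R := (n1 (f p.2) * n1 (w (p.2 - p.1)))%:E.
have mF : measurable_fun [set: measurableTypeR R * measurableTypeR R] F.
  apply/measurable_EFinP; apply: measurable_funM.
    exact: (measurableT_comp (cmeasurable_n1 mf) measurable_snd).
  apply: (measurableT_comp (cmeasurable_n1 mw)).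
  by apply: measurable_funB; [exact: measurable_snd|exact: measurable_fst].
have F0 p : (0 <= F p)%E by rewrite lee_fin mulr_ge0 ?n1_ge0.
have inner (t : R) : cmeasurable (fun x => f x * w (x - t)).
  apply: cmeasurableM => //; apply: cmeasurable_comp => //.
  exact: measurable_subr.
have key : (\int[mu]_t \int[mu]_x F (t, x) < +oo)%E.
  rewrite (fubini_tonelli (m1 := mu) (m2 := mu) F mF F0).
  have e x : (\int[mu]_t F (t, x) = (n1 (f x))%:E * \int[mu]_t (n1 (w t))%:E)%E.
    rewrite -(@integral_refl R x (fun t => (n1 (w t))%:E)); last 2 first.
    - by apply/measurable_EFinP; exact: cmeasurable_n1.
    - by move=> t; rewrite lee_fin n1_ge0.
    rewrite -ge0_integralZl //.
    - apply/measurable_EFinP; apply: (measurableT_comp (cmeasurable_n1 mw)).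
      exact: measurable_refl.
    - by move=> t _; rewrite lee_fin n1_ge0.
    - by rewrite lee_fin n1_ge0.
  under eq_integral do rewrite e.
  rewrite ge0_integralZr //; last 3 first.
  - by apply/measurable_EFinP; exact: cmeasurable_n1.
  - by move=> x _; rewrite lee_fin n1_ge0.
  - by apply: integral_ge0 => t _; rewrite lee_fin n1_ge0.
  have fin (u : R -> R) : (forall x, 0 <= u x) -> mu.-integrable [set: R] (fun x => (u x)%:E) ->
      (\int[mu]_x (u x)%:E)%E \is a fin_num.
    by move=> _; exact: integrable_fin_num.
  apply: lte_mul_pinfty.
  - by apply: integral_ge0 => t _; rewrite lee_fin n1_ge0.
  - by apply: fin => // x; exact: n1_ge0.
  - by rewrite ltey_eq fin // => x; exact: n1_ge0.
have mG : measurable_fun [set: measurableTypeR R] (fun t => (\int[mu]_x F (t, x))%E).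
  exact: (@measurable_fun_fubini_tonelli_F _ _ _ _ _ mu F mF F0).
have iG : mu.-integrable [set: R] (fun t => (\int[mu]_x F (t, x))%E).
  apply/integrableP; split=> //.
  under eq_integral do rewrite gee0_abs ?integral_ge0 //.
  exact: key.
move: (integrable_ae measurableT iG); apply: aeS => t /(_ I) ht.
apply: (@cintegrable_le _ _ (fun x => n1 (f x) * n1 (w (x - t)))) => //.
  by move=> x; exact: n1M.
have mh : measurable_fun [set: R] (fun x => n1 (f x) * n1 (w (x - t))).
  apply: measurable_funM; first exact: cmeasurable_n1.
  apply: (measurableT_comp (cmeasurable_n1 mw)).
  exact: measurable_subr.
apply/integrableP; split; first exact/measurable_EFinP.
under eq_integral do rewrite gee0_abs ?lee_fin ?mulr_ge0 ?n1_ge0 //.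
by move: ht; rewrite fin_numE ltey => /andP[].
Qed.

(** Windows centred in [c, d] see only a bounded piece of [f], which is integrable; the extra 1 in
    the cut-off covers the end point missing from the half-open interval. *)
Lemma ae_stft_defined B phi f (c d : R) : admissible_window B phi -> clocally_integrable f ->
  {ae mu, forall t, t \in `[c, d] -> stft_defined phi f t}.
Proof.
move=> [ip sp _ _] lf; have mf := clocally_meas lf; have mp := cintegrable_meas ip.
have := ae_convolution_integrable (clocally_locint lf (c - B) (d + B + 1)) ip.
apply: aeS => t ht; rewrite in_itv /= => /andP[t1 t2].
apply: (cintegrable_ae _ _ ht).
  apply: cmeasurableM => //; apply: cmeasurable_comp => //.
  exact: measurable_subr.
move: (ae_shift (- t) sp); apply: aeS => x h.
rewrite cindic_itv in_itv /=; have [xI|xI] := boolP (x - t \in `[- B, B]); last first.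
  by rewrite h // !mulr0.
move: xI; rewrite in_itv /= => /andP[x1 x2].
have -> : c - B <= x by lra.
have -> : x < d + B + 1 by lra.
by rewrite mulr1.
Qed.

Lemma ae_exists (P : R -> Prop) a b : a < b -> {ae mu, forall x, P x} -> exists2 x, x \in `[a, b] & P x.
Proof.
move=> ab hP; apply: contrapT => h; apply: (ae_itv_false ab).
by move: hP; apply: aeS => x Px; apply/negP => xI; apply: h; exists x.
Qed.

Lemma ae_irrational (t0 T : R) : 0 < T -> {ae mu, forall t, @irrational R ((t - t0) / T)}.
Proof.
move=> T0.
have : {ae mu, forall t, forall n : nat, forall q : rat, pickle q = n -> t != t0 + ratr q * T}.
  apply: ae_foralln => n; have [|] := pselect (exists q : rat, pickle q = n); last first.
    by move=> nq; apply: ae_all => t q qn; case: nq; exists q.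
  case=> q <-; move: (ae_neq (t0 + ratr q * T)); apply: aeS => t h q' /(pcan_inj pickleK) ->.
  exact: h.
apply: aeS => t H [q _ hq]; have /eqP := H _ q erefl; apply.
by rewrite hq divfK ?gt_eqF //; ring.
Qed.

End AeStft.

(** * Failure for separable signals *)

Section SeparableFailure.
Variable R : realType.
Local Notation mu := (@lebesgue_measure R).
Implicit Types (f g h phi w : R -> R[i]) (m c : R[i]).

Section SquareWave.
Variables (a T : R).
Hypothesis T0 : 0 < T.

(* The sign of [sin (pi (x - a) / T)], equal to 0 where the sine vanishes so that it
   is antiperiodic everywhere. *)
Definition square_wave (x : R) : R :=
  \1_(`]0, +oo[%classic : set R) (sin (pi * ((x - a) / T))) -
  \1_(`]-oo, 0[%classic : set R) (sin (pi * ((x - a) / T))).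

Lemma square_waveE x : square_wave x =
  (0 < sin (pi * ((x - a) / T)))%R%:R - (sin (pi * ((x - a) / T)) < 0)%R%:R.
Proof. by rewrite /square_wave !indicE !mem_setE !in_itv /= andbT. Qed.

Lemma square_wave_shift x : square_wave (x + T) = - square_wave x.
Proof.
rewrite !square_waveE (_ : pi * ((x + T - a) / T) = pi * ((x - a) / T) + pi); last first.
  by field; rewrite gt_eqF.
by rewrite sinDpi oppr_gt0 oppr_lt0 opprB.
Qed.

Lemma square_wave_eq1 x : a < x < a + T -> square_wave x = 1.
Proof.
move=> /andP[x1 x2]; rewrite square_waveE.
have s0 : 0 < sin (pi * ((x - a) / T)).
  have pp := pi_gt0 R; apply: sin_gt0_pi; apply/andP; split.
    by rewrite mulr_gt0 // divr_gt0 //; lra.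
  by rewrite gtr_pMr // ltr_pdivrMr // mul1r; lra.
by rewrite s0 ltNge (ltW s0) subr0.
Qed.

Lemma square_wave_le1 x : `|square_wave x| <= 1.
Proof.
rewrite square_waveE; case: ltrgtP => _; rewrite ?subr0 ?sub0r ?normrN ?normr1 //.
by rewrite normr0 ler01.
Qed.

Lemma measurable_square_wave : measurable_fun [set: R] square_wave.
Proof.
have mS : measurable_fun [set: R] (fun x : R => sin (pi * ((x - a) / T))).
  apply: (@measurableT_comp _ _ _ _ _ _ (@sin R)); first by apply: continuous_measurable_fun; exact: continuous_sin.
  apply: measurable_funM; first exact: measurable_cst.
  apply: measurable_funM; last exact: measurable_cst.
  exact: measurable_subr.
by apply: measurable_funB; apply: measurableT_comp mS => //; exact: measurable_indic.
Qed.

End SquareWave.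

Lemma clocally_le f g : cmeasurable g -> (forall x, `|Re (g x)| <= `|Re (f x)|) ->
  (forall x, `|Im (g x)| <= `|Im (f x)|) -> clocally_integrable f -> clocally_integrable g.
Proof.
move=> [g1 g2] hr hi [lr li].
have aux (u v : R -> R) : measurable_fun [set: R] v -> (forall x, `|v x| <= `|u x|) ->
    locally_integrable [set: R] u -> locally_integrable [set: R] v.
  move=> mv vu [mu_ oT h]; split=> // K sK cK; apply: le_lt_trans (h K sK cK).
  have mK : measurable (K : set (measurableTypeR R)) := compact_measurable cK.
  apply: ge0_le_integral => //.
  - by apply/measurable_EFinP; apply: measurableT_comp => //; exact: (measurable_funS measurableT).
  - by apply/measurable_EFinP; apply: measurableT_comp => //; exact: (measurable_funS measurableT).
  - by move=> x _; rewrite lee_fin.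
by split; [exact: aux lr|exact: aux li].
Qed.

Variables (B b T : R) (phi : R -> R[i]).
Hypotheses (B0 : 0 < B) (phiP : admissible_window B phi) (T0 : 0 < T).
Local Notation psi := (modulated_window phi b).

Lemma stft_window w f g t (xi : R) : {ae mu, forall x, x \notin `[- B, B] -> w x = 0} ->
  cintegrable (fun x => f x * conjc (w (x - t))) -> cintegrable (fun x => g x * conjc (w (x - t))) ->
  {ae mu, forall x, x \in `[t - B, t + B] -> g x = f x} -> stft w g t xi = stft w f t xi.
Proof.
move=> sw hf hg fg.
have me := cmeasurable_cis2pi xi.
have nc (x : R) : n1 (cis2pi (- (x * xi))) <= 2 := n1_cis2pi _.
apply: cintegral_ae; try exact: (cintegrableM (M := 2)).
move: (aeI fg (ae_shift (- t) sw)); apply: aeS => x [h1 h2].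
have [xI|xI] := boolP (x - t \in `[- B, B]); last by rewrite h2 // conjc0 !mulr0 !mul0r.
by rewrite h1 //; move: xI; rewrite !in_itv /= => /andP[x1 x2]; apply/andP; split; lra.
Qed.

(* If [f] vanishes on [a, a + 2 B - T + eps], changing its sign on every other period from [a]
   is invisible from the windows centred in [a + B, a + B + eps]. *)
Theorem separable_failure omega eps f : B < T -> 0 < eps -> quasi_periodic T f ->
  separable_by (2 * B - T + eps) f -> ~ {ae mu, forall x : R, f x = 0} ->
  exists t0 t1 : R,
    [/\ @irrational R ((t1 - t0) / T), stft_defined phi f t0, stft_defined phi f t1 &
      ~ determined_up_to_phase phi psi omega T t0 t1 f].
Proof.
move=> BT eps0 qf [a fa] fn0; have [lf [m m1 pf]] := qf.
have mf := clocally_meas lf; have [ip sp _ _] := phiP; have mp := cintegrable_meas ip.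
have ce : a + B < a + B + eps by lra.
have hdef := ae_stft_defined (a + B) (a + B + eps) phiP lf.
have [t0 t0I d0] := ae_exists ce hdef.
(* The forbidden positions, including the countably many with rational ratio, form a null set, so an
   interval of length [eps] contains a suitable one. *)
have [t1 t1I [d1 irr]] := ae_exists ce (aeI hdef (ae_irrational t0 T0)).
exists t0, t1; split=> //; [exact: d0|exact: d1|].
pose s x : R[i] := (square_wave a T x)%:C.
pose g x := f x * s x.
have ms : cmeasurable s by apply: cmeasurableC; exact: measurable_square_wave.
have s1 x : n1 (s x) <= 1 by rewrite /n1 /= normr0 addr0 square_wave_le1.
have mg : cmeasurable g by exact: cmeasurableM.
have lg : clocally_integrable g.
  apply: clocally_le lf => // x; rewrite /g ?cReM ?cImM /= mulr0 ?subr0 ?add0r normrM;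
  by rewrite ?ler_piMr ?square_wave_le1.
have sT x : s (x + T) = - s x by apply: complex_ext; rewrite !ReImE /= ?square_wave_shift ?oppr0.
(* The antiperiodic factor changes the multiplier to [- m], which is again of modulus 1. *)
have qg : quasi_periodic T g.
  split=> //; exists (- m); first by rewrite normrN.
  by move: pf; apply: aeS => x h; rewrite /g sT h; ring.
(* On the first period from [a] the square wave is 1; on [a + T, a + 2 B + eps], a translate by [T]
   of the interval where [f] vanishes, its sign does not matter. *)
have gf : {ae mu, forall x, x \in `[a, a + 2 * B + eps] -> g x = f x}.
  have := ae_shift (- T) (aeI pf fa).
  move=> h; move: (aeI h (aeI (ae_neq a) (ae_neq (a + T)))); apply: aeS => x [[h1 h2] [n1_ n2_]].
  rewrite in_itv /= => /andP[x1 x2]; rewrite /g.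
  have [xT|xT] := ltP x (a + T).
    rewrite /s square_wave_eq1 ?mulr1 //; apply/andP; split=> //.
    by rewrite lt_neqAle x1 eq_sym n1_.
  have f0 : f (x - T) = 0 by apply: h2; rewrite in_itv /=; apply/andP; split; lra.
  have : m * f x = 0 by rewrite -f0 h1 subrK.
  move=> /eqP; rewrite mulf_eq0 => /orP[/eqP mz|/eqP ->]; last by rewrite mul0r.
  by move: m1; rewrite mz normr0 => /esym/eqP; rewrite oner_eq0.
have gw t : t \in `[a + B, a + B + eps] -> {ae mu, forall x, x \in `[t - B, t + B] -> g x = f x}.
  rewrite in_itv /= => /andP[tl tr]; move: gf; apply: aeS => x h; rewrite in_itv /= => /andP[x1 x2].
  by apply: h; rewrite in_itv /=; apply/andP; split; lra.
have dg w t : stft_defined w f t -> stft_defined w g t.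
  move=> h; have := cintegrableM h ms s1; congr cintegrable.
  by apply/funext => x; rewrite /g; ring.
have ips : cintegrable psi := modulated_window_integrable b phiP.
have sps : {ae mu, forall x, x \notin `[- B, B] -> psi x = 0}.
  by move: sp; apply: aeS => x h xI; rewrite /modulated_window h // mul0r.
have dpsi t : stft_defined phi f t -> stft_defined psi f t.
  move=> h; apply: (stft_definedZ (k := fun x => cis2pi ((x - t) * b) - 1) (M := 2 + 1) _ _ h).
    apply: cmeasurableB; last exact: cmeasurable_cst.
    under eq_fun do rewrite cis2pi_ei; apply: cmeasurable_ei.
    apply: measurable_funM; first exact: measurable_cst.
    apply: measurable_funM; last exact: measurable_cst.
    exact: measurable_subr.
  by move=> x; apply: (le_trans (n1B _ _)); rewrite lerD ?cis2pi_ei ?n1_ei // n1_1.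
have mps := cintegrable_meas ips.
have same t : t \in `[a + B, a + B + eps] -> stft_defined phi f t ->
    same_measurements phi psi omega t f g.
  move=> tI h n _; split; congr `|_|; apply: stft_window => //.
  - exact: stft_integrable.
  - by apply: stft_integrable => //; exact: dg.
  - exact: gw.
  - by apply: stft_integrable => //; exact: dpsi.
  - by apply: stft_integrable => //; apply: dg; exact: dpsi.
  - exact: gw.
have df0 := d0 t0I; have df1 := d1 t1I.
move=> /(_ g qg (dg _ _ df0) (dg _ _ (dpsi _ df0)) (dg _ _ df1) (dg _ _ (dpsi _ df1))
  (same _ t0I df0) (same _ t1I df1)) [lam _ H].
have m0 : m != 0 by apply/eqP => mz; move: m1; rewrite mz normr0 => /esym/eqP; rewrite oner_eq0.
apply: fn0; apply: (qper_eq0 (a := a) T0 m0 pf).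
(* On this period [g = f] and on the next [g = - f], so a single phase gives both [f = lam f] and
   [f = - lam f]. *)
move: (aeI (aeI H (ae_shift T H)) (aeI pf (ae_neq a))); apply: aeS => x [[h1 h2] [h3 xa]].
rewrite in_itv /= => /andP[x1 x2].
have sx : s x = 1.
  by rewrite /s square_wave_eq1 //; apply/andP; split=> //; rewrite lt_neqAle x1 eq_sym xa.
have e1 : f x = lam * f x by rewrite {1}h1 /g sx mulr1.
have e2 : f x = - (lam * f x).
  by rewrite {1}h3 h2 /g sT sx h3; ring.
have : f x *+ 2 = 0 by rewrite mulr2n [X in X + _]e1 [X in _ + X]e2 subrr.
by move=> /eqP; rewrite mulrn_eq0 => /eqP.
Qed.

End SeparableFailure.

Section SeparableSignal.
Variable R : realType.
Local Notation mu := (@lebesgue_measure R).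

(** The signal is the indicator function of the intervals of half-length [h] about the multiples of
    [T]; consecutive ones leave a gap of length [T - 2 h = L]. Writing it through [cos (k x)] makes
    the periodicity exact. *)
Lemma separable_signal_exists (T L : R) : 0 < L -> L < T -> exists f : R -> R[i],
  [/\ quasi_periodic T f, separable_by L f & ~ {ae mu, forall x : R, f x = 0}].
Proof.
move=> L0 LT; have T0 : 0 < T by lra.
have pp := pi_gt0 R; pose k : R := 2 * pi / T; pose h := (T - L) / 2.
have k0 : 0 < k by rewrite divr_gt0 // mulr_gt0.
have kT : k * T = 2 * pi by rewrite /k divfK // gt_eqF.
have h0 : 0 < h by rewrite /h; lra.
have kh : 0 < k * h < pi.
  apply/andP; split; first exact: mulr_gt0.
  have : k * h < k * (T / 2) by rewrite ltr_pM2l // /h; lra.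
  by rewrite mulrA kT; lra.
pose u (x : R) : R := \1_(`]cos (k * h), +oo[%classic : set R) (cos (k * x)).
have uE x : u x = (cos (k * h) < cos (k * x))%R%:R.
  by rewrite /u indicE mem_setE in_itv /= andbT.
have arc x : 0 <= x -> x < T - h -> x != h -> u x = (x < h)%R%:R.
  move=> x0 xT xh; rewrite uE.
  have e : `|k * x| = k * x by rewrite ger0_norm // mulr_ge0 // ltW.
  have [||_ ->] := @cos_arc R (k * h) (k * x) kh; rewrite ?e ?ltr_pM2l //.
  - by rewrite -kT -mulrBr ltr_pM2l.
  - by rewrite (inj_eq (mulfI (lt0r_neq0 k0))).
have mu_ : measurable_fun [set: R] u.
  have mc : measurable_fun [set: R] (fun x => cos (k * x)).
    apply: (@measurableT_comp _ _ _ _ _ _ (@cos R)).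
      by apply: continuous_measurable_fun; exact: continuous_cos.
    exact: measurable_mull.
  by apply: measurableT_comp mc => //; exact: measurable_indic.
exists (fun x => (u x)%:C); split.
- split.
    apply: (@clocally_bounded _ _ 1); first exact: cmeasurableC.
    by move=> x; rewrite /n1 /= normr0 addr0 uE; case: (_ < _); rewrite ?normr1 ?normr0.
  exists 1; first exact: normr1.
  apply: ae_all => x; rewrite mul1r !uE mulrDr kT.
  by rewrite (_ : 2 * pi = pi *+ 2) ?cosD2pi // mulr_natl.
- exists h; move: (aeI (ae_neq h) (ae_neq (h + L))); apply: aeS => x [xh xhL].
  rewrite in_itv /= => /andP[x1 x2].
  have hL : h + L = T - h by rewrite /h; field.
  rewrite arc //; first by rewrite ltNge x1.
    by apply: le_trans x1; exact: ltW.
  by rewrite -hL lt_neqAle xhL x2.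
- have hh : h / 3 < h / 2 by lra.
  move=> H; apply: (ae_itv_false hh); move: H; apply: aeS => x ux; apply/negP.
  rewrite in_itv /= => /andP[x1 x2]; move: ux => [].
  have hT : h < T by rewrite /h; lra.
  have xh : x < h by lra.
  rewrite arc ?xh //; first by move/eqP; rewrite oner_eq0.
  - by lra.
  - by rewrite /h in x2 *; lra.
  - by rewrite lt_eqF.
Qed.

End SeparableSignal.

Theorem theorem4p4 (R : realType) (B : R) (phi : R -> R[i]) (b : R)
    (omega : nat -> R) (T : R) (B_gt0 : 0 < B)
    (phiP : admissible_window B phi)
    (b_gt0 : 0 < b) (b_le : b <= 1 / (2 * B))
    (omegaP : admissible_frequencies B omega)
    (T_gt0 : 0 < T) (T_lt : T < 2 * B) :
  let psi := modulated_window phi b in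
  [/\ (* uniqueness *)
      forall (f : R -> R[i]) (t0 t1 : R),
        quasi_periodic T f ->
        stft_defined phi f t0 -> stft_defined phi f t1 ->
        @irrational R ((t1 - t0) / T) ->
        (B < T -> nonseparable_by (2 * B - T) f) ->
        determined_up_to_phase phi psi omega T t0 t1 f,
      (* failure for every rational ratio *)
      forall t0 t1 : R, @rational R ((t1 - t0) / T) ->
        exists f : R -> R[i],
          [/\ quasi_periodic T f,
              stft_defined phi f t0, stft_defined phi f t1,
              (B < T -> nonseparable_by (2 * B - T) f) &
              ~ determined_up_to_phase phi psi omega T t0 t1 f],
      (* failure for every separable signal other than 0 *)
      forall (eps : R) (f : R -> R[i]),
        B < T -> 0 < eps ->
        quasi_periodic T f -> separable_by (2 * B - T + eps) f ->
        ~ {ae (@lebesgue_measure R), forall x : R, f x = 0} ->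
        exists t0 t1 : R,
          [/\ @irrational R ((t1 - t0) / T),
              stft_defined phi f t0, stft_defined phi f t1 &
              ~ determined_up_to_phase phi psi omega T t0 t1 f]
    & (* such separable signals exist whenever 2B - T + eps < T *)
      forall eps : R, B < T -> 0 < eps -> eps < 2 * (T - B) ->
        exists (f : R -> R[i]) (t0 t1 : R),
          [/\ quasi_periodic T f /\ separable_by (2 * B - T + eps) f,
              @irrational R ((t1 - t0) / T),
              stft_defined phi f t0, stft_defined phi f t1 &
              ~ determined_up_to_phase phi psi omega T t0 t1 f]].
Proof.
move=> psi; split.
- by move=> f t0 t1; exact: uniqueness.
- by move=> t0 t1; exact: rational_failure.
- by move=> eps f; exact: separable_failure.
- move=> eps BT eps0 epsT.
  have [f [qf sf fn0]] : exists f : R -> R[i],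
      [/\ quasi_periodic T f, separable_by (2 * B - T + eps) f
        & ~ {ae (@lebesgue_measure R), forall x : R, f x = 0}].
    by apply: separable_signal_exists; lra.
  have [t0 [t1 [irr d0 d1 nd]]] :=
    separable_failure b phiP T_gt0 omega BT eps0 qf sf fn0.
  by exists f, t0, t1; split.
Qed.
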